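(* Let $0<\alpha<1$ and $s\in\mathbb{R}$, and consider the Majda-Biello system $$u_t+u_{xxx}+vv_x=0,\qquad v_t+\alpha v_{xxx}+(uv)_x=0,\qquad (u,v)|_{t=0}=(u_0,v_0),\qquad (x,t)\in\mathbb{R}\times\mathbb{R}.$$ Suppose that it is well-posed in $H^s(\mathbb{R})\times H^s(\mathbb{R})$ over a small time interval, and for a fixed small $t\neq0$ let $\Phi_t:(u_0,v_0)\in H^s\times H^s\mapsto(u(t),v(t))\in H^s\times H^s$ be the solution map. If the solution map is $C^2$, then $s\ge0$.
   Context: $u,v$ are real-valued. Well-posed over a small time interval means that there is $T>0$ such that for data in a neighbourhood of the origin of $H^s\times H^s$ there is a unique solution of the Duhamel integral form of the system on $[-T,T]$, depending continuously on the data; $\Phi_t$ is then defined on that neighbourhood for $|t|\le T$ (with $\Phi_t(0,0)=(0,0)$). ''$C^2$'' means twice continuously Fréchet differentiable. *)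

(* Defs.v *)
From HB Require Import structures.
From mathcomp Require Import all_boot all_order all_algebra.
From mathcomp Require Import ring_quotient.
From mathcomp Require Import all_classical all_reals all_analysis.
From mathcomp Require Import measurable_realfun.

Set Implicit Arguments.
Unset Strict Implicit.
Unset Printing Implicit Defensive.

Import Order.TTheory GRing.Theory Num.Theory.
Import numFieldNormedType.Exports.
From mathcomp Require Import complex.

Local Open Scope classical_set_scope.
Local Open Scope ring_scope.
Local Open Scope quotient_scope.

Section Sobolev.
Context (R : realType) (s : R).

Local Notation C := (Rcomplex R).
Local Notation mu := (@lebesgue_measure R).

#[local] Instance ae_filter_mu : Filter (nbhs (almost_everywhere mu)).
Proof. exact: (ae_filter_ringOfSetsType mu). Qed.

(* H^s(R) = { u tempered distribution : <xi>^s u^ in L^2 } is carried by the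
   Fourier transform u^ of its elements, normalised by
     u^(xi) = (2 pi)^-1 \int u(x) exp(- i x xi) dx,
   so that d/dx acts as i xi and (u v)^ = u^ * v^ without constants.  A
   tempered distribution of this class is determined by u^ modulo null sets,
   and every such class of functions occurs.  Complex values are taken in
   Rcomplex R, that is R[i] seen as an R-algebra with an R-valued norm. *)

Definition japanese (xi : R) : R := Num.sqrt (1 + xi ^+ 2).

Definition Hs_weighted (f : R -> C) : R -> R :=
  fun xi => japanese xi `^ s * `|f xi|.

(* The third clause expresses that u is real-valued.  Asking for it at every xi
   rather than almost every xi loses no class: redefine f on a null set. *)
Definition is_Hs (f : R -> C) : Prop :=
  [/\ measurable_fun setT (fun xi => Re (f xi)),
      measurable_fun setT (fun xi => Im (f xi)),
      (forall xi, f (- xi) = conjc (f xi)) &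
      ('N[mu]_2%:E[EFin \o Hs_weighted f] < +oo)%E].

Definition Hs_norm (f : R -> C) : R := fine 'N[mu]_2%:E[EFin \o Hs_weighted f]%E.

Lemma normCE (z : C) : `|z| = Num.sqrt (Re z ^+ 2 + Im z ^+ 2).
Proof. by case: z. Qed.

Lemma normCZ (a : R) (z : C) : `|a *: z| = `|a| * `|z|.
Proof.
case: z => x y; rewrite !normCE /= -sqrtr_sqr -sqrtrM ?sqr_ge0//.
by rewrite mulrDr !exprMn.
Qed.

Lemma measurable_sqrtr : measurable_fun setT (@Num.sqrt R).
Proof. by apply: continuous_measurable_fun; exact: sqrt_continuous. Qed.

Lemma measurable_japanese : measurable_fun setT (fun xi => japanese xi `^ s).
Proof.
rewrite -[X in measurable_fun _ X]/((@powR R ^~ s) \o japanese).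
apply: measurableT_comp; first exact: measurable_powR.
rewrite -[X in measurable_fun _ X]/((@Num.sqrt R) \o (fun xi : R => 1 + xi ^+ 2)).
apply: measurableT_comp; first exact: measurable_sqrtr.
by apply: measurable_funD => //; apply: measurable_funX.
Qed.

Lemma japanese_gt0 xi : 0 < japanese xi.
Proof. by rewrite sqrtr_gt0 ltr_pwDl// sqr_ge0. Qed.

Lemma Hs_weighted_ge0 f xi : 0 <= Hs_weighted f xi.
Proof. by rewrite mulr_ge0// powR_ge0. Qed.

Lemma Hs_weighted_eq0 f xi : Hs_weighted f xi = 0 -> f xi = 0.
Proof.
move=> /eqP; rewrite mulf_eq0 normr_eq0 gt_eqF ?powR_gt0 ?japanese_gt0//=.
by move/eqP.
Qed.

Lemma Hs_weightedD f g xi :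
  Hs_weighted (f + g) xi <= Hs_weighted f xi + Hs_weighted g xi.
Proof. by rewrite -mulrDr ler_wpM2l ?powR_ge0// ler_normD. Qed.

Lemma Hs_weightedZ a f xi : Hs_weighted (a *: f) xi = `|a| * Hs_weighted f xi.
Proof. by rewrite /Hs_weighted [(a *: f) xi]/(a *: f xi) normCZ mulrCA. Qed.

Lemma measurable_normC (f : R -> C) :
  measurable_fun setT (fun xi => Re (f xi)) ->
  measurable_fun setT (fun xi => Im (f xi)) ->
  measurable_fun setT (fun xi => `|f xi|).
Proof.
move=> mr mi.
rewrite [X in measurable_fun _ X](_ : _ =
  (@Num.sqrt R) \o (fun xi => Re (f xi) ^+ 2 + Im (f xi) ^+ 2)); last first.
  by apply/funext => xi; rewrite normCE.
apply: measurableT_comp; first exact: measurable_sqrtr.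
by apply: measurable_funD; apply: measurable_funX.
Qed.

Lemma measurable_Hs_weighted (f : R -> C) :
  measurable_fun setT (fun xi => Re (f xi)) ->
  measurable_fun setT (fun xi => Im (f xi)) ->
  measurable_fun setT (Hs_weighted f).
Proof.
move=> mr mi; apply: measurable_funM; first exact: measurable_japanese.
exact: measurable_normC.
Qed.

Lemma Hs_normE f : is_Hs f ->
  (Hs_norm f)%:E = 'N[mu]_2%:E[EFin \o Hs_weighted f]%E.
Proof. by move=> [_ _ _ fy]; rewrite fineK// ge0_fin_numE// Lnorm_ge0. Qed.

Lemma le_Lnorm2 (f g : R -> R) :
  measurable_fun setT f -> measurable_fun setT g ->
  (forall x, `|f x| <= `|g x|) ->
  ('N[mu]_2%:E[EFin \o f] <= 'N[mu]_2%:E[EFin \o g])%E.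
Proof.
move=> mf mg fg; rewrite unlock; apply: gt0_ler_poweR.
- by rewrite invr_ge0.
- by rewrite in_itv /= leey andbT integral_ge0// => x _; exact: poweR_ge0.
- by rewrite in_itv /= leey andbT integral_ge0// => x _; exact: poweR_ge0.
apply: ge0_le_integral => //.
- by move=> x _; exact: poweR_ge0.
- apply: (measurableT_comp (measurable_poweR _)).
  exact/measurableT_comp/measurable_EFinP.
- apply: (measurableT_comp (measurable_poweR _)).
  exact/measurableT_comp/measurable_EFinP.
- by move=> x _; rewrite lee_fin ge0_ler_powR// nnegrE.
Qed.

Lemma Hs_Lnorm_subadd (f g : R -> C) : is_Hs f -> is_Hs g ->
  ('N[mu]_2%:E[EFin \o Hs_weighted (f + g)%R] <=
   'N[mu]_2%:E[EFin \o Hs_weighted f] + 'N[mu]_2%:E[EFin \o Hs_weighted g])%E.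
Proof.
move=> [fr fi _ _] [gr gi _ _].
have mf := measurable_Hs_weighted fr fi; have mg := measurable_Hs_weighted gr gi.
have p1 : 1 <= 2 :> R by rewrite ler1n.
apply: le_trans (minkowski_EFin mu mf mg p1).
have -> : (EFin \o (Hs_weighted f \+ Hs_weighted g)) =
  EFin \o (fun x => Hs_weighted f x + Hs_weighted g x) by [].
apply: le_Lnorm2.
- apply: measurable_Hs_weighted.
    rewrite (_ : (fun _ => _) = (fun xi => Re (f xi) + Re (g xi))).
      exact: measurable_funD.
    by apply/funext => xi; rewrite [(f + g) xi]/(f xi + g xi); case: (f xi); case: (g xi).
  rewrite (_ : (fun _ => _) = (fun xi => Im (f xi) + Im (g xi))).
    exact: measurable_funD.
  by apply/funext => xi; rewrite [(f + g) xi]/(f xi + g xi); case: (f xi); case: (g xi).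
- exact: measurable_funD.
move=> x; rewrite !ger0_norm ?addr_ge0 ?Hs_weighted_ge0//.
exact: Hs_weightedD.
Qed.

Lemma Hs_LnormZ (a : R) (f : R -> C) : is_Hs f ->
  ('N[mu]_2%:E[EFin \o Hs_weighted (a *: f)%R] =
   `|a|%:E * 'N[mu]_2%:E[EFin \o Hs_weighted f])%E.
Proof.
move=> [fr fi _ fy]; have mf := measurable_Hs_weighted fr fi.
have Lf : Hs_weighted f \in Lfun mu 2%:E.
  by rewrite inE; apply/andP; split; rewrite inE.
have p1 : (1 <= 2%:E :> \bar R)%E by rewrite lee_fin ler1n.
have := LnormZ (Lfun_Sub p1 Lf) `|a|.
rewrite normr_id => <-; apply: eq_Lnorm => xi.
by rewrite /= Hs_weightedZ.
Qed.

Definition Hs_pred : {pred R -> C} := mem [set f | is_Hs f].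

Lemma Hs_predP f : reflect (is_Hs f) (f \in Hs_pred).
Proof. by apply: (iffP idP); rewrite inE. Qed.

Lemma Hs_submod_closed : submod_closed Hs_pred.
Proof.
have Z a f : is_Hs f -> is_Hs (a *: f).
  move=> Hf; have [fr fi fs fy] := Hf; split.
  - rewrite (_ : (fun _ => _) = (fun xi => a * Re (f xi))).
      exact: measurable_funM.
    by apply/funext => xi; rewrite [(a *: f) xi]/(a *: f xi); case: (f xi).
  - rewrite (_ : (fun _ => _) = (fun xi => a * Im (f xi))).
      exact: measurable_funM.
    by apply/funext => xi; rewrite [(a *: f) xi]/(a *: f xi); case: (f xi).
  - move=> xi; rewrite [LHS]/(a *: f (- xi)) fs [(a *: f) xi]/(a *: f xi).
    by case: (f xi) => x y; congr Complex; rewrite mulrN.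
  - by rewrite Hs_LnormZ// -Hs_normE// -EFinM ltry.
have D f g : is_Hs f -> is_Hs g -> is_Hs (f + g).
  move=> Hf Hg; have [fr fi fs fy] := Hf; have [gr gi gs gy] := Hg; split.
  - rewrite (_ : (fun _ => _) = (fun xi => Re (f xi) + Re (g xi))).
      exact: measurable_funD.
    by apply/funext => xi; rewrite [(f + g) xi]/(f xi + g xi); case: (f xi); case: (g xi).
  - rewrite (_ : (fun _ => _) = (fun xi => Im (f xi) + Im (g xi))).
      exact: measurable_funD.
    by apply/funext => xi; rewrite [(f + g) xi]/(f xi + g xi); case: (f xi); case: (g xi).
  - move=> xi; rewrite [LHS]/(f (- xi) + g (- xi)) fs gs [(f + g) xi]/(f xi + g xi).
    by case: (f xi) => x y; case: (g xi) => x' y'; congr Complex; rewrite opprD.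
  - apply: le_lt_trans (Hs_Lnorm_subadd Hf Hg) _.
    by rewrite lte_add_pinfty.
split.
  apply/Hs_predP; split => //.
  - by move=> xi; congr Complex; rewrite oppr0.
  - rewrite (_ : EFin \o _ = cst 0%E) ?Lnorm0//.
    by apply/funext => xi /=; rewrite /Hs_weighted [X in `|X|]/(0 : C) normr0 mulr0.
by move=> a f g /Hs_predP Hf /Hs_predP Hg; apply/Hs_predP/D => //; exact: Z.
Qed.

HB.instance Definition _ :=
  GRing.isSubmodClosed.Build R (R -> C) Hs_pred Hs_submod_closed.

Record HsFun := MkHsFun { hsfun :> R -> C ; hsfunP : hsfun \in Hs_pred }.
HB.instance Definition _ := [isSub for hsfun].
HB.instance Definition _ := [Choice of HsFun by <:].
HB.instance Definition _ := [SubChoice_isSubLmodule of HsFun by <:].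

Lemma hsfun_is_Hs (f : HsFun) : is_Hs f.
Proof. exact/Hs_predP/hsfunP. Qed.

Lemma hsfunD (f g : HsFun) xi : (f + g) xi = f xi + g xi :> C.
Proof. by []. Qed.
Lemma hsfunB (f g : HsFun) xi : (f - g) xi = f xi - g xi :> C.
Proof. by []. Qed.
Lemma hsfunZ a (f : HsFun) xi : (a *: f) xi = a *: f xi :> C.
Proof. by []. Qed.

Definition Hs_null : {pred HsFun} :=
  mem [set f : HsFun | {ae mu, forall xi, f xi = 0}].

Lemma Hs_nullP (f : HsFun) :
  reflect ({ae mu, forall xi, f xi = 0}) (f \in Hs_null).
Proof. by apply: (iffP idP); rewrite inE. Qed.

Lemma Hs_null_submod_closed : submod_closed Hs_null.
Proof.
split; first by apply/Hs_nullP/aeW.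
move=> a f g /Hs_nullP f0 /Hs_nullP g0; apply/Hs_nullP.
move: f0 g0; apply: filterS2 => xi f0 g0.
by rewrite hsfunD hsfunZ f0 g0 scaler0 addr0.
Qed.

HB.instance Definition _ :=
  GRing.isSubmodClosed.Build R HsFun Hs_null Hs_null_submod_closed.

(* H^s(R), real-valued: functions in is_Hs modulo equality a.e. *)
Definition Hs : Type := Quotient.quot Hs_null.
HB.instance Definition _ := Choice.on Hs.
HB.instance Definition _ := GRing.Zmodule.on Hs.
HB.instance Definition _ := EqQuotient.on Hs.

Definition Hs_class (f : HsFun) : Hs := \pi_(Quotient.quot Hs_null) f.

Lemma Hs_classP (f g : HsFun) :
  Hs_class f = Hs_class g <-> {ae mu, forall xi, f xi = g xi}.
Proof.
split=> [/eqP|fg].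
  rewrite -Quotient.idealrBE => /Hs_nullP; apply: filterS => xi.
  by rewrite hsfunB => /eqP; rewrite subr_eq0 => /eqP.
apply/eqP; rewrite -Quotient.idealrBE; apply/Hs_nullP.
by apply: filterS fg => xi fg; rewrite hsfunB fg subrr.
Qed.

(* Some representative of the Fourier transform; every later use of hat only
   depends on its a.e. class. *)
Definition hat (u : Hs) : HsFun := repr (u : Quotient.quot Hs_null).

Lemma hatK : cancel hat Hs_class.
Proof. by move=> u; rewrite /Hs_class /hat reprK. Qed.

Lemma hat_class f : {ae mu, forall xi, hat (Hs_class f) xi = f xi}.
Proof. by apply/Hs_classP; rewrite hatK. Qed.

Lemma Hs_classD f g : Hs_class (f + g) = Hs_class f + Hs_class g.
Proof. by rewrite /Hs_class; exact: (Quotient.pi_add Hs_null). Qed.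

Definition Hs_scale (a : R) (u : Hs) : Hs := Hs_class (a *: hat u).

Lemma Hs_classZ a f : Hs_class (a *: f) = Hs_scale a (Hs_class f).
Proof.
apply/Hs_classP; apply: filterS (hat_class f) => xi fE.
by rewrite !hsfunZ fE.
Qed.

Lemma Hs_scaleA a b u : Hs_scale a (Hs_scale b u) = Hs_scale (a * b) u.
Proof. by rewrite -[u]hatK -!Hs_classZ scalerA. Qed.
Lemma Hs_scale1 : left_id 1 Hs_scale.
Proof. by move=> u; rewrite -[u]hatK -!Hs_classZ scale1r. Qed.
Lemma Hs_scaleDr : right_distributive Hs_scale +%R.
Proof.
by move=> a u v; rewrite -[u]hatK -[v]hatK -Hs_classD -!Hs_classZ scalerDr Hs_classD.
Qed.
Lemma Hs_scaleDl u : {morph Hs_scale^~ u : a b / a + b}.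
Proof. by move=> a b; rewrite -[u]hatK -!Hs_classZ scalerDl Hs_classD. Qed.

HB.instance Definition _ :=
  GRing.Zmodule_isLmodule.Build R Hs Hs_scaleA Hs_scale1 Hs_scaleDr Hs_scaleDl.

Definition Hs_normQ (u : Hs) : R := Hs_norm (hat u).

Lemma Hs_norm_ae (f g : HsFun) :
  {ae mu, forall xi, f xi = g xi} -> Hs_norm f = Hs_norm g.
Proof.
move=> fg; have [fr fi _ _] := hsfun_is_Hs f; have [gr gi _ _] := hsfun_is_Hs g.
rewrite /Hs_norm unlock; congr (fine (_ `^ _)).
apply: ae_eq_integral => //.
- apply: (measurableT_comp (measurable_poweR _)).
  apply: measurableT_comp => //; apply/measurable_EFinP.
  exact: measurable_Hs_weighted.
- apply: (measurableT_comp (measurable_poweR _)).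
  apply: measurableT_comp => //; apply/measurable_EFinP.
  exact: measurable_Hs_weighted.
by apply: filterS fg => xi fg _; rewrite /= /Hs_weighted fg.
Qed.

Lemma Hs_normQ_class f : Hs_normQ (Hs_class f) = Hs_norm f.
Proof. exact/Hs_norm_ae/hat_class. Qed.

Lemma Hs_normQD u v : Hs_normQ (u + v) <= Hs_normQ u + Hs_normQ v.
Proof.
rewrite -[u]hatK -[v]hatK -Hs_classD !Hs_normQ_class -lee_fin EFinD.
rewrite !Hs_normE; try exact: hsfun_is_Hs.
exact: Hs_Lnorm_subadd (hsfun_is_Hs _) (hsfun_is_Hs _).
Qed.

Lemma Hs_normQZ (a : R) u : Hs_normQ (a *: u) = `|a| * Hs_normQ u.
Proof.
rewrite -[u]hatK [_ *: _](esym (Hs_classZ _ _)) !Hs_normQ_class.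
apply: EFin_inj; rewrite EFinM !Hs_normE; try exact: hsfun_is_Hs.
exact: Hs_LnormZ (hsfun_is_Hs _).
Qed.

Lemma Hs_normQ_eq0 u : Hs_normQ u = 0 -> u = 0.
Proof.
rewrite -[u]hatK; set f := hat u; rewrite Hs_normQ_class => f0.
have [fr fi _ _] := hsfun_is_Hs f.
have -> : 0 = Hs_class 0.
  by apply: (addrI (Hs_class 0)); rewrite -Hs_classD !addr0.
apply/Hs_classP.
have N0 : 'N[mu]_2%:E[EFin \o Hs_weighted f]%E = 0%E.
  by rewrite -Hs_normE ?f0//; exact: hsfun_is_Hs.
have p0 : (0 < 2%:E :> \bar R)%E by rewrite lte_fin.
have mf : measurable_fun [set: measurableTypeR R] (EFin \o Hs_weighted f).
  by apply/measurable_EFinP; exact: measurable_Hs_weighted.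
have := Lnorm_eq0_eq0 mf p0 N0.
apply: filterS => xi /(_ I)[].
exact: Hs_weighted_eq0.
Qed.

HB.instance Definition _ :=
  Lmodule_isNormed.Build R Hs Hs_normQD Hs_normQZ Hs_normQ_eq0.

End Sobolev.

Section Frechet.
Context {R : realType} {V W : normedModType R}.

(* f is twice Frechet differentiable at every point of the open set U, and
   D^2 f : U -> L(V, L(V, W)) is continuous for the operator norm.  B x h k is
   D^2 f(x)(h)(k), and 'd f is differentiable as a map into L(V, W): the library
   has no normed space L(V, W), so operator norms are written out. *)
Definition C2_on (U : set V) (f : V -> W) : Prop :=
  (forall x, U x -> differentiable f x) /\
  exists B : V -> V -> V -> W,
  [/\ forall x, U x ->
        [/\ forall h, linear (B x h),
            forall k, linear (fun h => B x h k) &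
            exists M : R, forall h k, `|B x h k| <= M * `|h| * `|k|],
      forall x, U x -> forall e : R, 0 < e -> \forall y \near x, forall k,
        `|'d f y k - 'd f x k - B x (y - x) k| <= e * `|y - x| * `|k| &
      forall x, U x -> forall e : R, 0 < e -> \forall y \near x, forall h k,
        `|B y h k - B x h k| <= e * `|h| * `|k|].

End Frechet.

Section MajdaBiello.
Context {R : realType}.

Local Notation C := (Rcomplex R).
Local Notation mu := (@lebesgue_measure R).

Definition cint (D : set R) (f : R -> C) : C :=
  Complex (\int[mu]_(x in D) Re (f x)) (\int[mu]_(x in D) Im (f x)).

(* Oriented integral from 0 to t. *)
Definition cint0 (t : R) (f : R -> C) : C :=
  if 0 <= t then cint `[0, t] f else - cint `[t, 0] f.

Definition ddx (f : R -> C) : R -> C := fun xi => (Complex 0 xi : C) * f xi.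

(* Fourier transform of a product. *)
Definition prod_hat (f g : R -> C) : R -> C :=
  fun xi => cint setT (fun eta => f (xi - eta) * g eta).

(* S_beta(t) = exp(- beta t d^3/dx^3), the flow of w_t + beta w_xxx = 0. *)
Definition airy (beta t : R) (f : R -> C) : R -> C :=
  fun xi => (Complex (cos (beta * t * xi ^+ 3)) (sin (beta * t * xi ^+ 3)) : C)
            * f xi.

(* v v_x and (u v)_x *)
Definition nonlin_u (u v : R -> C) : R -> C := prod_hat v (ddx v).
Definition nonlin_v (u v : R -> C) : R -> C := ddx (prod_hat u v).

(* \int_0^t S_beta(t - t') F(t') dt' *)
Definition duhamel (beta t : R) (F : R -> R -> C) : R -> C :=
  fun xi => cint0 t (fun t' => airy beta (t - t') (F t') xi).

Definition schwartz (psi : R -> R) : Prop :=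
  (forall n x, derivable (derive1n n psi) x 1) /\
  (forall k n, exists M : R, forall x, `|x ^+ k * derive1n n psi x| <= M).

Definition pairing (f : R -> C) (psi : R -> R) : C :=
  cint setT (fun xi => psi xi *: f xi).

(* Sequences of Fourier multipliers approximating the identity. *)
Definition cutoffs (m : nat -> R -> R) : Prop :=
  [/\ forall n, measurable_fun setT (m n),
      forall n, exists K : R, forall xi, K < `|xi| -> m n xi = 0,
      exists M : R, forall n xi, `|m n xi| <= M &
      forall xi, (fun n => m n xi) @ \oo --> (1 : R)].

Definition freq_cut (m : R -> R) (f : R -> C) : R -> C := fun xi => m xi *: f xi.

Context {s : R}.

(* When s < 0, elements of H^s cannot be multiplied directly.  As usual for weak
   solutions of dispersive equations below L^2 (Christ's weak solutions in the
   extended sense), the Duhamel integral of the nonlinearity is the limit, in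
   the sense of tempered distributions, of those of the frequency-truncated
   functions; the limit is required to exist and to be z for every admissible
   sequence of cutoffs.  When s >= 0 the products are integrable functions and
   this is the ordinary Duhamel integral.  For a curve w continuous in H^s the
   truncated functions are continuous in time with values in L^1 and L^2, so
   that all the integrals below converge absolutely. *)
Definition is_duhamel (beta t : R) (N : (R -> C) -> (R -> C) -> R -> C)
    (w : R -> Hs s * Hs s) (z : R -> C) : Prop :=
  forall m, cutoffs m -> forall psi, schwartz psi ->
  (fun n => `|pairing (duhamel beta t (fun t' =>
       N (freq_cut (m n) (hat (w t').1)) (freq_cut (m n) (hat (w t').2)))) psi
     - pairing z psi|) @ \oo --> (0 : R).

(* (u, v) = w in C([-T, T]; H^s x H^s) satisfies, for (u0, v0) = d,
     u(t) = S_1(t) u0 - \int_0^t S_1(t - t') (v v_x)(t') dt'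
     v(t) = S_alpha(t) v0 - \int_0^t S_alpha(t - t') (u v)_x(t') dt'. *)
Definition MB_solution (alpha T : R) (d : Hs s * Hs s) (w : R -> Hs s * Hs s)
    : Prop :=
  {within `[- T, T], continuous w} /\
  forall t, - T <= t <= T ->
    is_duhamel 1 t nonlin_u w
      (fun xi => airy 1 t (hat d.1) xi - hat (w t).1 xi) /\
    is_duhamel alpha t nonlin_v w
      (fun xi => airy alpha t (hat d.2) xi - hat (w t).2 xi).

(* U is the neighbourhood of the origin, Phi t the solution map at time t; the
   last clause is continuity of U -> C([-T, T]; H^s x H^s).  Only the values
   Phi t d with |t| <= T and d in U are meaningful. *)
Definition MB_wellposed (alpha T : R) (U : set (Hs s * Hs s))
    (Phi : R -> Hs s * Hs s -> Hs s * Hs s) : Prop :=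
  [/\ 0 < T, open U, U 0,
      forall d, U d -> MB_solution alpha T d (fun t => Phi t d) /\
        (forall w, MB_solution alpha T d w ->
           forall t, - T <= t <= T -> w t = Phi t d) &
      forall d, U d -> forall e : R, 0 < e -> \forall d' \near d,
        forall t, - T <= t <= T -> `|Phi t d' - Phi t d| < e].

End MajdaBiello.

(* Main.v *)
(* For data (u0, v0) whose Fourier transforms are bounded by a small multiple of
   e^{-2T|xi|} / (1 + xi^2), the Duhamel equations are solved for |t| <= T by
   Picard iteration in the norms sup |f(t, xi)| (1 + xi^2) e^{(2T - |t|)|xi|}, as in
   the Cauchy-Kovalevskaya theorem: the time derivative of the weight absorbs the
   factor xi of the nonlinearity.  By uniqueness this solution is the given flow, so
   with d = (u0, v0) fixed and k -> 0 the second component of Phi_t(k d) is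
     k S_alpha(t) v0 - k^2 Q(u0, v0) + O(k^3),
   where Q is the Duhamel integral of (S_1 u0 S_alpha v0)_x.  If Phi_t is C^2, its
   second differences are O(k^2 |d|^2), hence |Q(u0, v0)| <= M max(|u0|, |v0|)^2
   with M independent of d.

   Let 0 < x < 1 solve x^3 + alpha (1 - x)^3 = alpha, which is possible because
   0 < alpha < 1, and let u0^, v0^ be the indicators of the intervals of radius
   g ~ N^-2 around +-x N and +-(1 - x) N.  The waves interact resonantly, so that
   |Q^| >= c N g |t| near xi = N, and the bound on Q reads N^s (N g) g^(1/2) <~
   (N^s g^(1/2))^2, i.e. N^s is bounded below as N -> oo; hence s >= 0. *)
From HB Require Import structures.
Require Import Defs.
From mathcomp Require Import all_boot all_order all_algebra.
From mathcomp Require Import all_classical all_reals all_analysis.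
From mathcomp Require Import measurable_realfun ring lra.
Import Order.TTheory GRing.Theory Num.Theory.
Import numFieldNormedType.Exports.
From mathcomp Require Import complex.
Set Implicit Arguments.
Unset Strict Implicit.
Unset Printing Implicit Defensive.
Local Open Scope classical_set_scope.
Local Open Scope ring_scope.

(** * Integration of complex-valued functions *)

(** For [s < 0] the Duhamel formula cannot be differentiated at general data, because the products
    exist only as limits of truncations. The argument therefore works with data whose solution can
    be built by hand and then recognised as the flow. Smallness is asked of the data alone, not of
    the time: the exponential weight lets the construction reach the whole prescribed interval
    [[- T, T]].

    The price is that the constants of the expansion grow exponentially with the frequency [N] of
    the data. This is harmless, since [k] tends to 0 while the data are fixed, and [N] grows only
    afterwards. The single constant that must not depend on the data is the bound on the second
    differences of [Phi t].

    The exponent in [g ~ N^-2] comes from the phase: moving the three interacting frequencies, all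
    of size at most of order [N], by at most [g] changes it by at most [36 T N^2 g], and this must
    stay below a fixed small number. The negation of the goal is used in the form [s <= 0], for
    which square integrable functions belong to [H^s]. *)

Section ComplexIntegral.
Context {R : realType}.
Local Notation C := (Rcomplex R).
Local Notation mu := (@lebesgue_measure R).
Local Notation nc z := (@Num.norm R _ (z : C)).

#[local] Instance ae_filter_lebesgue : Filter (nbhs (almost_everywhere mu)).
Proof. exact: (ae_filter_ringOfSetsType mu). Qed.

Lemma cnormM (z w : C) : nc (z * w) = nc z * nc w.
Proof. exact: Normc.normcM. Qed.

Lemma cReD (z w : C) : Re (z + w) = Re z + Re w. Proof. by move: z w => [a b] [c d]. Qed.
Lemma cImD (z w : C) : Im (z + w) = Im z + Im w. Proof. by move: z w => [a b] [c d]. Qed.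
Lemma cReN (z : C) : Re (- z) = - Re z. Proof. by case: z. Qed.
Lemma cImN (z : C) : Im (- z) = - Im z. Proof. by case: z. Qed.
Lemma cReM (z w : C) : Re (z * w) = Re z * Re w - Im z * Im w.
Proof. by move: z w => [a b] [c d]. Qed.
Lemma cImM (z w : C) : Im (z * w) = Re z * Im w + Im z * Re w.
Proof. by move: z w => [a b] [c d]. Qed.
Lemma cReZ (a : R) (z : C) : Re (a *: z) = a * Re z. Proof. by case: z. Qed.
Lemma cImZ (a : R) (z : C) : Im (a *: z) = a * Im z. Proof. by case: z. Qed.

Lemma ceqP (z w : C) : Re z = Re w -> Im z = Im w -> z = w.
Proof. by case: z w => [a b] [c d] /= -> ->. Qed.

Lemma cscaleE (a : R) (z : C) : a *: z = (Complex a 0 : C) * z.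
Proof. by apply: ceqP; rewrite ?cReZ ?cImZ ?cReM ?cImM /=; ring. Qed.

Lemma cnorm_Re (z : C) : `|Re z| <= `|z|.
Proof.
by rewrite normCE -sqrtr_sqr ler_sqrt ?addr_ge0 ?sqr_ge0// lerDl sqr_ge0.
Qed.

Lemma cnorm_Im (z : C) : `|Im z| <= `|z|.
Proof.
by rewrite normCE -sqrtr_sqr ler_sqrt ?addr_ge0 ?sqr_ge0// lerDr sqr_ge0.
Qed.

Lemma norm_Complex_le (a b : R) : `|Complex a b : C| <= `|a| + `|b|.
Proof.
rewrite -(ler_pXn2r (n := 2)) ?nnegrE ?addr_ge0//.
rewrite normCE /= sqr_sqrtr ?addr_ge0 ?sqr_ge0// sqrrD !real_normK ?num_real//.
by rewrite lerD2r lerDl mulrn_wge0 ?mulr_ge0.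
Qed.

Definition cmeas d (X : measurableType d) (f : X -> C) :=
  measurable_fun setT (fun x => Re (f x)) /\ measurable_fun setT (fun x => Im (f x)).

Section cmeas.
Context d (X : measurableType d).
Implicit Types f g : X -> C.

Lemma cmeasD f g : cmeas f -> cmeas g -> cmeas (fun x => f x + g x).
Proof.
move=> [f1 f2] [g1 g2]; split.
  by under eq_fun do rewrite cReD; exact: measurable_funD.
by under eq_fun do rewrite cImD; exact: measurable_funD.
Qed.

Lemma cmeasN f : cmeas f -> cmeas (fun x => - f x).
Proof.
move=> [f1 f2]; split.
  by under eq_fun do rewrite cReN; exact: measurableT_comp.
by under eq_fun do rewrite cImN; exact: measurableT_comp.
Qed.

Lemma cmeasB f g : cmeas f -> cmeas g -> cmeas (fun x => f x - g x).
Proof. by move=> cf cg; apply: cmeasD => //; exact: cmeasN. Qed.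

Lemma cmeasM f g : cmeas f -> cmeas g -> cmeas (fun x => f x * g x).
Proof.
move=> [f1 f2] [g1 g2]; split.
  under eq_fun do rewrite cReM.
  by apply: measurable_funB; exact: measurable_funM.
under eq_fun do rewrite cImM.
by apply: measurable_funD; exact: measurable_funM.
Qed.

Lemma cmeas_Complex (f g : X -> R) : measurable_fun setT f -> measurable_fun setT g ->
  cmeas (fun x => Complex (f x) (g x) : C).
Proof. by []. Qed.

Lemma cmeasZ (a : X -> R) f : measurable_fun setT a -> cmeas f ->
  cmeas (fun x => a x *: f x).
Proof.
move=> ma cf; under eq_fun do rewrite cscaleE.
by apply: cmeasM => //; exact: cmeas_Complex.
Qed.

Lemma cmeas_if (b : X -> bool) f g : measurable_fun setT b ->
  cmeas f -> cmeas g -> cmeas (fun x => if b x then f x else g x).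
Proof.
move=> mb [f1 f2] [g1 g2]; split.
  rewrite (_ : (fun _ => _) = fun x => if b x then Re (f x) else Re (g x)).
    by apply: measurable_fun_ifT.
  by apply/funext => x; case: ifP.
rewrite (_ : (fun _ => _) = fun x => if b x then Im (f x) else Im (g x)).
  by apply: measurable_fun_ifT.
by apply/funext => x; case: ifP.
Qed.

End cmeas.

Lemma cmeas_comp d (X : measurableType d) d' (Y : measurableType d')
    (f : Y -> C) (p : X -> Y) :
  measurable_fun setT p -> cmeas f -> cmeas (fun x => f (p x)).
Proof. by move=> mp [f1 f2]; split; [exact: (measurableT_comp f1 mp)|exact: (measurableT_comp f2 mp)]. Qed.

(** Tonelli is applied to the positive and the negative part separately, so no integrability in [y]
    is required; where the integral is infinite [fine] returns 0, which is still measurable in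
    [x]. *)
Lemma measurable_Rint d (X : measurableType d) (f : X * R -> R) :
  measurable_fun setT f -> measurable_fun setT (fun x => \int[mu]_y f (x, y)).
Proof.
move=> mf; apply: (@measurableT_comp _ _ _ _ _ _ fine setT (fun x => \int[mu]_y (f (x, y))%:E)%E) => //.
under eq_fun do rewrite integralE.
have mE : measurable_fun setT (EFin \o f) by exact/measurable_EFinP.
have h g : measurable_fun [set: X * measurableTypeR R] g -> (forall x, 0 <= g x)%E ->
    measurable_fun setT (fubini_F mu g) by exact: measurable_fun_fubini_tonelli_F.
apply: emeasurable_funB.
  rewrite [X in measurable_fun _ X](_ : _ = fubini_F mu (EFin \o f)^\+%E).
    by apply: h; [exact: measurable_funepos|move=> x; exact: funepos_ge0].
  by apply/funext => x; apply: eq_integral => y _; rewrite !funeposE.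
rewrite [X in measurable_fun _ X](_ : _ = fubini_F mu (EFin \o f)^\-%E).
  by apply: h; [exact: measurable_funeneg|move=> x; exact: funeneg_ge0].
by apply/funext => x; apply: eq_integral => y _; rewrite !funenegE.
Qed.

Lemma cmeas_cint d (X : measurableType d) (f : X * R -> C) :
  cmeas f -> cmeas (fun x => cint setT (fun y => f (x, y))).
Proof. by move=> [f1 f2]; split; [exact: (measurable_Rint f1)|exact: (measurable_Rint f2)]. Qed.

Definition rint (g : R -> R) := mu.-integrable setT (EFin \o g).

Lemma rint_dom (f g : R -> R) : measurable_fun setT f -> rint g ->
  (forall x, `|f x| <= g x) -> rint f.
Proof.
move=> mf ig fg; apply: le_integrable ig => //; first exact/measurable_EFinP.
by move=> x _ /=; rewrite lee_fin (le_trans (fg x)) ?ler_norm.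
Qed.

Lemma rintZ (k : R) (g : R -> R) : rint g -> rint (fun x => k * g x).
Proof. exact: integrableZl. Qed.

Lemma rintD (f g : R -> R) : rint f -> rint g -> rint (fun x => f x + g x).
Proof. by move=> If Ig; exact: (integrableD measurableT If Ig). Qed.

Lemma measurable_rint (g : R -> R) : rint g -> measurable_fun setT g.
Proof. by move/measurable_int/measurable_EFinP. Qed.

(** The majorant is carried along because integrability, norm bounds and dominated convergence all
    draw on the same one. *)
Definition cdom (g : R -> R) (f : R -> C) :=
  [/\ cmeas f, rint g & forall x, `|f x| <= g x].

Lemma cdom_Re g f : cdom g f -> rint (fun x => Re (f x)).
Proof.
move=> [[f1 _] ig fg]; apply: rint_dom ig _ => // x.
exact: le_trans (cnorm_Re _) (fg x).
Qed.

Lemma cdom_Im g f : cdom g f -> rint (fun x => Im (f x)).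
Proof.
move=> [[_ f1] ig fg]; apply: rint_dom ig _ => // x.
exact: le_trans (cnorm_Im _) (fg x).
Qed.

Lemma Rint_norm_le (f g : R -> R) : measurable_fun setT f -> rint g ->
  (forall x, `|f x| <= g x) -> `|\int[mu]_x f x| <= \int[mu]_x g x.
Proof.
move=> mf ig fg; have if_ := rint_dom mf ig fg.
apply: le_trans (le_normr_Rintegral _ if_) _ => //.
apply: le_Rintegral => //; apply: (@rint_dom _ g) => // [|x].
  exact: measurableT_comp.
by rewrite normr_id.
Qed.

(** The factor 2 comes from estimating real and imaginary parts separately; it enters the constants
    8, 16 and 128 below. *)
Lemma cint_norm_le g f : cdom g f -> nc (cint setT f) <= 2 * \int[mu]_x g x.
Proof.
move=> [[f1 f2] ig fg]; apply: le_trans (norm_Complex_le _ _) _.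
rewrite mulrDl mul1r; apply: lerD; apply: Rint_norm_le => // x.
  exact: le_trans (cnorm_Re _) (fg x).
exact: le_trans (cnorm_Im _) (fg x).
Qed.

Lemma eq_cint D (f g : R -> C) : (forall x, D x -> f x = g x) -> cint D f = cint D g.
Proof.
by move=> fg; congr Complex; apply: eq_Rintegral => x /set_mem Dx; rewrite fg.
Qed.

Lemma cintD g h f k : cdom g f -> cdom h k ->
  cint setT (fun x => f x + k x) = cint setT f + cint setT k.
Proof.
move=> df dk; apply: ceqP; rewrite ?cReD ?cImD /=.
  rewrite -(RintegralD _ (cdom_Re df) (cdom_Re dk))//.
  by apply: eq_Rintegral => x _; rewrite cReD.
rewrite -(RintegralD _ (cdom_Im df) (cdom_Im dk))//.
by apply: eq_Rintegral => x _; rewrite cImD.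
Qed.

Lemma cintM (z : C) g f : cdom g f -> cint setT (fun x => z * f x) = z * cint setT f.
Proof.
move=> df; have iR := cdom_Re df; have iI := cdom_Im df.
apply: ceqP; rewrite ?cReM ?cImM /=.
  rewrite -!RintegralZl// -RintegralB//; try exact: rintZ.
  by apply: eq_Rintegral => x _; rewrite cReM.
rewrite -!RintegralZl// -RintegralD//; try exact: rintZ.
by apply: eq_Rintegral => x _; rewrite cImM.
Qed.

Lemma cintN g f : cdom g f -> cint setT (fun x => - f x) = - cint setT f.
Proof.
move=> df; rewrite -mulN1r -(cintM _ df); apply: eq_cint => x _.
by rewrite mulN1r.
Qed.

Lemma cdomN g f : cdom g f -> cdom g (fun x => - f x).
Proof. by move=> [mf ig fg]; split => [||x] //; [exact: cmeasN|rewrite normrN]. Qed.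

Lemma cdomM (z : C) g f : cdom g f -> cdom (fun x => nc z * g x) (fun x => z * f x).
Proof.
move=> [mf ig fg]; split; [|exact: rintZ|by move=> x; rewrite cnormM ler_wpM2l].
by apply: cmeasM.
Qed.

Lemma cintB g h f k : cdom g f -> cdom h k ->
  cint setT (fun x => f x - k x) = cint setT f - cint setT k.
Proof. by move=> df dk; rewrite (cintD df (cdomN dk)) (cintN dk). Qed.

Lemma cint_conj g f : cdom g f ->
  cint setT (fun x => conjc (f x)) = conjc (cint setT f).
Proof.
move=> df; apply: ceqP => /=.
  by apply: eq_Rintegral => x _; case: (f x).
rewrite -mulN1r -(RintegralZl _ _ (cdom_Im df))//.
by apply: eq_Rintegral => x _; rewrite mulN1r; case: (f x).
Qed.

(** By uniqueness of Lebesgue measure it is enough to compare half-open intervals; the reflection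
    only changes which end is closed. *)
Lemma lebesgue_measure_reflect (c : R) (A : set R) : measurable A ->
  pushforward mu ((fun x => c - x) : _ -> measurableTypeR R) A = mu A.
Proof.
have mc : measurable_fun setT ((fun x => c - x) : R -> measurableTypeR R).
  exact: measurable_funB.
move=> mA; apply/esym/lebesgue_measure_unique => //= _ [[a b]] _ <-.
rewrite /pushforward (_ : _ @^-1` _ = `[c - b, c - a[%classic); last first.
  by apply/seteqP; split=> x /=; rewrite !in_itv/= => /andP[]; lra.
rewrite !lebesgue_measure_itv/= !lte_fin ltrD2l ltrN2; case: ifP => // _.
by rewrite -!EFinD; congr EFin; ring.
Qed.

Lemma ge0_integral_reflect (c : R) (f : R -> \bar R) : measurable_fun setT f ->
  (forall x, 0 <= f x)%E ->
  (\int[mu]_x f (c - x)%R = \int[mu]_x f x)%E.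
Proof.
move=> mf f0.
have mc : measurable_fun setT ((fun x => c - x) : measurableTypeR R -> measurableTypeR R).
  exact: measurable_funB.
have := @ge0_integral_pushforward _ _ _ _ _ _ mc lebesgue_measure setT f measurableT mf (fun x _ => f0 x).
rewrite preimage_setT /comp => <-.
apply: eq_measure_integral => //= A mA _; exact: lebesgue_measure_reflect.
Qed.

Lemma Rint_reflect (c : R) (f : R -> R) : measurable_fun setT f ->
  \int[mu]_x f (c - x) = \int[mu]_x f x.
Proof.
move=> mf; congr fine; rewrite [LHS]integralE [RHS]integralE.
have mE : measurable_fun setT (EFin \o f) by exact/measurable_EFinP.
congr (_ - _)%E.
  rewrite -[RHS](ge0_integral_reflect c (measurable_funepos mE))//.
  by apply: eq_integral => x _; rewrite !funeposE.
rewrite -[RHS](ge0_integral_reflect c (measurable_funeneg mE))//.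
by apply: eq_integral => x _; rewrite !funenegE.
Qed.

Lemma cint_reflect (c : R) (f : R -> C) : cmeas f ->
  cint setT (fun x => f (c - x)) = cint setT f.
Proof.
move=> [f1 f2]; congr Complex; first exact: (Rint_reflect c f1).
exact: (Rint_reflect c f2).
Qed.

Lemma rint_reflect (c : R) (f : R -> R) : rint f -> rint (fun x => f (c - x)).
Proof.
move=> If; have mf := measurable_rint If; apply/integrableP; split.
  by apply/measurable_EFinP; apply: (measurableT_comp mf); exact: measurable_funB.
have /integrableP[_] := If.
rewrite -(@ge0_integral_reflect c (fun x => `|(f x)%:E|%E))//.
by apply: measurableT_comp => //; exact/measurable_EFinP.
Qed.

Lemma ae_reflect (c : R) (P : R -> Prop) :
  {ae mu, forall x, P x} -> {ae mu, forall x, P (c - x)}.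
Proof.
move=> [N [mN N0 PN]]; exists ((fun x => c - x) @^-1` N).
have mc : measurable_fun setT ((fun x => c - x) : R -> measurableTypeR R).
  exact: measurable_funB.
split.
- by rewrite -[X in measurable X]setTI; exact: mc.
- by rewrite -N0; exact: lebesgue_measure_reflect.
- by move=> x /= nP; apply: PN.
Qed.

Lemma cint_ae (f g : R -> C) : cmeas f -> cmeas g ->
  {ae mu, forall x, f x = g x} -> cint setT f = cint setT g.
Proof.
move=> [f1 f2] [g1 g2] fg; congr Complex; congr fine; apply: ae_eq_integral => //;
  try exact/measurable_EFinP.
  by apply: filterS fg => x fg _; rewrite fg.
by apply: filterS fg => x fg _; rewrite fg.
Qed.

Lemma Rint_dct (f_ : nat -> R -> R) (f g : R -> R) :
  (forall n, measurable_fun setT (f_ n)) -> measurable_fun setT f -> rint g ->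
  (forall n x, `|f_ n x| <= g x) -> (forall x, f_ n x @[n --> \oo] --> f x) ->
  (\int[mu]_x f_ n x) @[n --> \oo] --> \int[mu]_x f x.
Proof.
move=> mf_ mf ig fg cf.
have [] := @dominated_convergence _ _ _ mu setT measurableT
  (fun n => EFin \o f_ n) (EFin \o f) (EFin \o g).
- by move=> n; apply/measurable_EFinP; exact: mf_.
- exact/measurable_EFinP.
- by apply: aeW => x _; apply/cvg_EFin; [exact: nearW|exact: cf].
- by [].
- by apply: aeW => x n _; rewrite /= lee_fin.
move=> if_ _ h; apply: fine_cvg; move: h; rewrite /Rintegral.
by rewrite fineK//; exact: integrable_fin_num.
Qed.

Definition ccvg (z_ : nat -> C) (z : C) := nc (z_ n - z) @[n --> \oo] --> (0 : R).

Lemma ccvgP (z_ : nat -> C) z : ccvg z_ z <->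
  Re (z_ n) @[n --> \oo] --> Re z /\ Im (z_ n) @[n --> \oo] --> Im z.
Proof.
split=> [h|[hr hi]].
  have sq (p : C -> R) : (forall x y, p (x - y) = p x - p y) ->
     (forall x, `|p x| <= nc x) -> p (z_ n) @[n --> \oo] --> p z.
    move=> pB pn; apply/subr_cvg0/norm_cvg0P.
    apply: (@squeeze_cvgr _ _ _ _ (cst 0) (fun n => nc (z_ n - z))) => //.
      by apply: nearW => n /=; rewrite normr_ge0 -pB pn.
    exact: cvg_cst.
  split; apply: sq => //; [|exact: cnorm_Re| |exact: cnorm_Im].
    by move=> x y; rewrite cReD cReN.
  by move=> x y; rewrite cImD cImN.
rewrite /ccvg.
apply: (@squeeze_cvgr _ _ _ _ (cst 0)
  (fun n => `|Re (z_ n) - Re z| + `|Im (z_ n) - Im z|)).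
- apply: nearW => n /=; rewrite normr_ge0/=.
  apply: le_trans (norm_Complex_le _ _).
  by rewrite -cReN -cImN -cReD -cImD; case: (z_ n - z).
- exact: cvg_cst.
- rewrite -[X in _ --> X]addr0; apply: cvgD; apply/norm_cvg0P/subr_cvg0; assumption.
Qed.

Lemma cint_dct g (f_ : nat -> R -> C) (f : R -> C) :
  (forall n, cdom g (f_ n)) -> cmeas f -> (forall x, ccvg (f_^~ x) (f x)) ->
  ccvg (fun n => cint setT (f_ n)) (cint setT f).
Proof.
move=> df [m1 m2] cf; apply/ccvgP; split => /=.
  apply: (@Rint_dct _ _ g) => //.
  - by move=> n; have [[]] := df n.
  - by have [] := df 0%N.
  - by move=> n x; have [_ _ h] := df n; exact: le_trans (cnorm_Re _) (h x).
  - by move=> x; have /ccvgP[] := cf x.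
apply: (@Rint_dct _ _ g) => //.
- by move=> n; have [[]] := df n.
- by have [] := df 0%N.
- by move=> n x; have [_ _ h] := df n; exact: le_trans (cnorm_Im _) (h x).
- by move=> x; have /ccvgP[] := cf x.
Qed.

End ComplexIntegral.

(** * Exponential weights and the oriented time integral *)

Section Weights.
Context {R : realType}.
Local Notation mu := (@lebesgue_measure R).

Definition lorentz (x : R) : R := (1 + x ^+ 2)^-1.

Lemma lorentz_gt0 x : 0 < lorentz x.
Proof. by rewrite invr_gt0 ltr_pwDl// sqr_ge0. Qed.

Lemma lorentz_le1 x : lorentz x <= 1.
Proof. by rewrite invf_le1 ?ltr_pwDl ?sqr_ge0// lerDl sqr_ge0. Qed.

Lemma lorentzN x : lorentz (- x) = lorentz x.
Proof. by rewrite /lorentz sqrrN. Qed.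

Lemma measurable_lorentz : measurable_fun setT lorentz.
Proof. by apply: continuous_measurable_fun; exact: continuous_oneDsqrV. Qed.

(** The arctangent gives the value [pi / 2] on the right half line, and evenness carries it over to
    the left one. *)
Lemma rint_lorentz : rint lorentz.
Proof.
have mV := measurable_lorentz.
apply/integrableP; split; first exact/measurable_EFinP.
under eq_integral do rewrite gee0_abs ?lee_fin ?ltW ?lorentz_gt0//.
have h : (\int[mu]_(x in `[0%R, +oo[) (lorentz x)%:E = (pi / 2)%:E)%E.
  exact: integral0y_oneDsqr.
have -> : setT = `]-oo, 0%R] `|` `]0%R, +oo[ :> set R.
  by apply/seteqP; split=> x //= _; rewrite !in_itv/= andbT; case: (leP x 0) => ?; [left|right].
have m0 A : measurable_fun A (fun x => (lorentz x)%:E).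
  by apply: measurable_funTS; exact/measurable_EFinP.
have c0 x : (0 <= (lorentz x)%:E)%E by rewrite lee_fin ltW ?lorentz_gt0.
rewrite ge0_integral_setU//=; last 2 first.
  exact: m0.
  rewrite disj_set2E; apply/eqP; rewrite -subset0 => x /=; rewrite !in_itv/= andbT.
  by move=> [x0]; rewrite ltNge x0.
apply: lte_add_pinfty.
  have := @ge0_integration_by_substitution0 _ (fun x => (lorentz x)%:E) (m0 _) c0.
  by under [in RHS]eq_integral do rewrite lorentzN; move=> <-; rewrite h ltry.
apply: (@le_lt_trans _ _ (pi / 2)%:E); last by rewrite ltry.
rewrite -h; apply: ge0_subset_integral => //; first exact: m0.
by move=> x /=; rewrite !in_itv/= !andbT; exact: ltW.
Qed.

(** From [x = (x - y) + y] one gets [1 + x^2 <= 2 (a + b)] with [a = 1 + (x - y)^2] and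
    [b = 1 + y^2]; divide by [a b (1 + x^2)]. The right-hand side is integrable in [y], so the
    weight is stable under convolution. *)
Lemma lorentz_conv (x y : R) :
  lorentz (x - y) * lorentz y <= 2 * lorentz x * (lorentz (x - y) + lorentz y).
Proof.
rewrite /lorentz; set a := 1 + (x - y) ^+ 2; set b := 1 + y ^+ 2.
have a0 : 0 < a by rewrite ltr_pwDl// sqr_ge0.
have b0 : 0 < b by rewrite ltr_pwDl// sqr_ge0.
have c0 : 0 < 1 + x ^+ 2 by rewrite ltr_pwDl// sqr_ge0.
have -> : 2 * (1 + x ^+ 2)^-1 * (a^-1 + b^-1) =
  (a^-1 * b^-1) * ((2 * (a + b)) / (1 + x ^+ 2)).
  by field; rewrite !gt_eqF.
rewrite ler_peMr ?mulr_ge0 ?invr_ge0 ?(ltW a0) ?(ltW b0)// ler_pdivlMr// mul1r /a /b.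
have : 0 <= (x - y - y) ^+ 2 by exact: sqr_ge0.
nra.
Qed.

(** [sigma] is a radius of analyticity; the algebraic factor keeps the weight integrable even when
    [sigma = 0]. *)
Definition wt (sigma x : R) : R := expR (- (sigma * `|x|)) * lorentz x.

Lemma wt_ge0 sigma x : 0 <= wt sigma x.
Proof. by rewrite mulr_ge0 ?expR_ge0// ltW ?lorentz_gt0. Qed.

Lemma wt_le_lorentz sigma x : 0 <= sigma -> wt sigma x <= lorentz x.
Proof.
move=> s0; rewrite ler_piMl ?(ltW (lorentz_gt0 _))//.
by rewrite -expR0 ler_expR oppr_le0 mulr_ge0.
Qed.

(** Giving up a part [r] of the radius gains the factor [e^{|x| r}], whose derivative in [r]
    produces the [|x|] lost in the nonlinearity. *)
Lemma wt_shift sigma r x : wt (sigma - r) x = expR (`|x| * r) * wt sigma x.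
Proof. by rewrite /wt mulrA -expRD; congr (expR _ * _); ring. Qed.

(** The triangle inequality [|x| <= |x - y| + |y|] handles the exponential factors and
    [lorentz_conv] the algebraic ones. *)
Lemma wt_conv sigma (x y : R) : 0 <= sigma ->
  wt sigma (x - y) * wt sigma y <= 2 * wt sigma x * (lorentz (x - y) + lorentz y).
Proof.
move=> s0; rewrite /wt mulrACA -expRD.
rewrite (_ : 2 * _ * _ = expR (- (sigma * `|x|)) *
  (2 * lorentz x * (lorentz (x - y) + lorentz y))); last by ring.
apply: ler_pM; rewrite ?expR_ge0 ?mulr_ge0 ?(ltW (lorentz_gt0 _))//.
  rewrite ler_expR -opprD lerN2 -mulrDr ler_wpM2l//.
  by rewrite -{1}(subrK y x) ler_normD.
exact: lorentz_conv.
Qed.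

Lemma pow_exp_bound (sigma : R) (n : nat) : 0 < sigma ->
  exists2 M : R, 0 <= M & forall x : R, `|x| ^+ n * expR (- (sigma * `|x|)) <= M.
Proof.
(* The exponential is bounded below by a term of its series of degree [n.+1], whence the factorial;
   the summand 1 pays for [y <= 1] in [y^n <= y^(n+1) + 1]. *)
move=> s0; exists (n.+1`!%:R / sigma ^+ n.+1 + 1).
  by rewrite addr_ge0// divr_ge0 ?exprn_ge0// ltW.
move=> x; have : 0 <= `|x| by []; move: (`|x| : R) => y x0.
have e0 := expR_gt0 (sigma * y).
rewrite expRN ler_pdivrMr//.
have h : y ^+ n <= y ^+ n.+1 + 1.
  have [y1|y1] := leP y 1.
    by apply: (@le_trans _ _ 1); [exact: exprn_ile1|rewrite lerDr exprn_ge0].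
  by rewrite (le_trans (ler_weXn2l (ltW y1) (leqnSn n)))// lerDl.
apply: (le_trans h).
have sy0 : 0 <= sigma * y by rewrite mulr_ge0// ltW.
have := expR_ge1Dxn n sy0; rewrite exprMn => h2.
have f0 : 0 < (n.+1`!%:R : R) by rewrite ltr0n fact_gt0.
have s1 : 0 < sigma ^+ n.+1 by rewrite exprn_gt0.
rewrite mulrDl mul1r; apply: lerD.
  rewrite mulrAC ler_pdivlMr// mulrC -ler_pdivrMl//.
  rewrite [leLHS]mulrC (le_trans _ h2)// lerDr.
  by [].
by rewrite (le_trans _ h2)// lerDl divr_ge0 ?mulr_ge0 ?exprn_ge0// ltW.
Qed.

End Weights.

Section TimeKernel.
Context {R : realType}.
Local Notation C := (Rcomplex R).
Local Notation mu := (@lebesgue_measure R).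

(* [\int_0^t F(r) dr = \int sgk t r F(r) dr] over the whole line, for either sign of [t]. *)
Definition sgk (t r : R) : R :=
  if 0 <= t then (0 <= r <= t)%R%:R else - (t <= r <= 0)%R%:R.

Lemma measurable_boolR d (X : measurableType d) (b : X -> bool) :
  measurable_fun setT b -> measurable_fun setT (fun x => (b x)%:R : R).
Proof.
move=> mb; rewrite (_ : (fun _ => _) = fun x => if b x then 1 else 0 : R).
  exact: measurable_fun_ifT.
by apply/funext => x; case: (b x).
Qed.

Lemma measurable_sgk : measurable_fun setT (fun p : R * R => sgk p.1 p.2).
Proof.
have m1 : measurable_fun setT (fun p : R * R => p.1) by exact: measurable_fst.
have m2 : measurable_fun setT (fun p : R * R => p.2) by exact: measurable_snd.
apply: measurable_fun_ifT.
- by apply: measurable_fun_ler => //; exact: measurable_cst.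
- apply: measurable_boolR; apply: measurable_and; apply: measurable_fun_ler => //.
- apply: measurableT_comp => //; apply: measurable_boolR.
  by apply: measurable_and; apply: measurable_fun_ler => //.
Qed.

Lemma measurable_sgkr t : measurable_fun setT (sgk t).
Proof.
apply: (@measurableT_comp _ _ _ _ _ _ (fun p : R * R => sgk p.1 p.2) setT (fun r => (t, r))).
  exact: measurable_sgk.
exact: measurable_fun_pair.
Qed.

(** Valid without integrability: if the positive or the negative part has infinite integral, [fine]
    makes both sides 0. *)
Lemma RintN (f : R -> R) : \int[mu]_x (- f x) = - \int[mu]_x f x.
Proof.
rewrite /Rintegral integralE [in RHS]integralE.
rewrite (_ : (fun x => (- f x)%:E) = \- (EFin \o f))%E; last by apply/funext.
rewrite funeposN funenegN.
have := @integral_ge0 _ _ _ mu setT (EFin \o f)^\+%E (fun x _ => funepos_ge0 _ x).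
have := @integral_ge0 _ _ _ mu setT (EFin \o f)^\-%E (fun x _ => funeneg_ge0 _ x).
set A := (\int[mu]_x (EFin \o f)^\+%E x)%E; set B := (\int[mu]_x (EFin \o f)^\-%E x)%E.
by case: A => [a| |] //; case: B => [b| |] //= _ _; rewrite ?oppr0//; ring.
Qed.

Lemma cint0E t (f : R -> C) : cint0 t f = cint setT (fun r => sgk t r *: f r).
Proof.
rewrite /cint0 /sgk; case: ifP => t0.
  congr Complex; rewrite Rintegral_mkcond; apply: eq_Rintegral => x _.
    by rewrite patchE mem_setE in_itv/= cReZ; case: ifP; rewrite ?mul1r ?mul0r.
  by rewrite patchE mem_setE in_itv/= cImZ; case: ifP; rewrite ?mul1r ?mul0r.
transitivity (Complex (- Re (cint `[t, 0] f)) (- Im (cint `[t, 0] f)) : C) => //.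
congr Complex; rewrite /= Rintegral_mkcond -RintN; apply: eq_Rintegral => x _.
  by rewrite patchE mem_setE in_itv/= cReZ; case: ifP; rewrite ?mulN1r ?mul0r ?oppr0 ?mul0r.
by rewrite patchE mem_setE in_itv/= cImZ; case: ifP; rewrite ?mulN1r ?mul0r ?oppr0 ?mul0r.
Qed.

Lemma Rint_itv (a b : R) : a <= b ->
  rint (fun r => (a <= r <= b)%R%:R) /\ \int[mu]_r ((a <= r <= b)%R%:R) = b - a.
Proof.
move=> ab.
have mb : measurable_fun setT (fun r : R => (a <= r <= b)%R%:R : R).
  apply: measurable_boolR; apply: measurable_and; apply: measurable_fun_ler => //.
have E : (\int[mu]_r ((a <= r <= b)%R%:R : R)%:E = (b - a)%:E)%E.
  transitivity (\int[mu]_r (\1_(`[a, b]) r)%:E)%E.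
    by apply: eq_integral => x _; rewrite indicE mem_setE in_itv.
  rewrite integral_indic//= setIT lebesgue_measure_itv/= lte_fin.
  by move: ab; rewrite le_eqVlt => /predU1P[->|->]; rewrite ?ltxx ?subrr.
split; last by rewrite /Rintegral E.
apply/integrableP; split; first exact/measurable_EFinP.
under eq_integral do rewrite gee0_abs ?lee_fin//.
by rewrite E ltry.
Qed.

Lemma norm_sgk t r : `|sgk t r| = (Num.min 0 t <= r <= Num.max 0 t)%R%:R.
Proof.
rewrite /sgk; case: leP => t0; last by rewrite normrN normr_nat.
by rewrite normr_nat.
Qed.

Lemma norm_sgk_le1 t r : `|sgk t r| <= 1.
Proof. by rewrite norm_sgk; case: (_ <= _ <= _). Qed.

(** The kernel vanishes unless [r] lies between 0 and [t], so an estimate is needed only for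
    [|r| <= |t|]. *)
Lemma norm_sgk_mul t r (x y : R) : (`|r| <= `|t| -> x <= y) ->
  `|sgk t r| * x <= `|sgk t r| * y.
Proof.
move=> xy; rewrite norm_sgk; case: (boolP (_ <= _ <= _)) => [|_]; last by rewrite !mul0r.
case: (leP 0 t) => t0 /andP[h1 h2]; rewrite !mul1r; apply: xy.
  by rewrite !ger0_norm.
by rewrite !ler0_norm ?lerN2// ltW.
Qed.

Lemma Rint_sgk t : rint (fun r => `|sgk t r|) /\ \int[mu]_r `|sgk t r| = `|t|.
Proof.
have [h1 h2] : rint (fun r => (Num.min 0 t <= r <= Num.max 0 t)%R%:R) /\
   \int[mu]_r ((Num.min 0 t <= r <= Num.max 0 t)%R%:R) = `|t|.
  have m0 : Num.min 0 t <= Num.max 0 t by rewrite le_max ge_min lexx.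
  have [h1 h2] := Rint_itv m0; split => //; rewrite h2.
  by case: leP => t0; [rewrite subr0 ger0_norm|rewrite sub0r ltr0_norm].
by under eq_fun do rewrite norm_sgk.
Qed.

Lemma sgk_out (t t0 r : R) : t <= t0 -> r < t \/ t0 < r -> sgk t r = sgk t0 r.
Proof.
move=> tt h; rewrite /sgk; case: (leP 0 t) => a1; case: (leP 0 t0) => a2.
- by congr (nat_of_bool _)%:R; case: h => h; apply/idP/idP => /andP[? ?]; apply/andP; split; lra.
- lra.
- rewrite (_ : (t <= r <= 0) = false); last first.
    by apply/negbTE/negP => /andP[? ?]; case: h => h; lra.
  rewrite (_ : (0 <= r <= t0) = false) ?oppr0//.
  by apply/negbTE/negP => /andP[? ?]; case: h => h; lra.
- by congr (- (nat_of_bool _)%:R); case: h => h; apply/idP/idP => /andP[? ?]; apply/andP; split; lra.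
Qed.

(** The two kernels agree outside the interval between [t] and [t0], and each is bounded by 1. *)
Lemma Rint_sgkB t t0 : rint (fun r => `|sgk t r - sgk t0 r|) /\
  \int[mu]_r `|sgk t r - sgk t0 r| <= 2 * `|t - t0|.
Proof.
have m0 : Num.min t t0 <= Num.max t t0 by rewrite le_max ge_min lexx.
have [h1 h2] := Rint_itv m0; have h3 := rintZ 2 h1.
have b r : `|sgk t r - sgk t0 r| <= 2 * (Num.min t t0 <= r <= Num.max t t0)%R%:R.
  case: (boolP (_ <= _ <= _)) => [_|].
    rewrite mulr1 (_ : 2 = 1 + 1)//; apply: (le_trans (ler_normB _ _)).
    by apply: lerD; exact: norm_sgk_le1.
  rewrite negb_and -!ltNge mulr0 => /orP h.
  suff -> : sgk t r = sgk t0 r by rewrite subrr normr0.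
  by case: (leP t t0) h => [tt|/ltW tt] h; [|apply/esym]; exact: sgk_out.
have mB : measurable_fun setT (fun r => `|sgk t r - sgk t0 r|).
  by apply: measurableT_comp => //; apply: measurable_funB; exact: measurable_sgkr.
have iB : rint (fun r => `|sgk t r - sgk t0 r|).
  by apply: rint_dom h3 _ => // r; rewrite normr_id.
split => //; apply: (@le_trans _ _ (\int[mu]_r (2 * (Num.min t t0 <= r <= Num.max t t0)%R%:R))).
  exact: le_Rintegral.
rewrite RintegralZl// h2 ler_wpM2l//.
by case: (leP t t0) => a; [rewrite ler0_norm ?subr_le0// opprB|rewrite gtr0_norm ?subr_gt0].
Qed.

(** The integral equals [e^{c |t|} - 1]. With [c = |x|] the factor in front of the exponential is
    the derivative in the nonlinearity, and integrating in time removes it at no cost in the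
    constant. *)
Lemma Rint_sgk_exp (t c : R) : 0 <= c ->
  rint (fun r => `|sgk t r| * (c * expR (c * `|r|))) /\
  \int[mu]_r (`|sgk t r| * (c * expR (c * `|r|))) <= expR (c * `|t|).
Proof.
move=> c0.
have mt : measurable_fun setT (fun r => `|sgk t r|).
  by apply: measurableT_comp => //; exact: measurable_sgkr.
have mE : measurable_fun setT (fun r : R => c * expR (c * `|r|)).
  apply: measurable_funM => //; apply: measurableT_comp => //.
  by apply: measurable_funM => //; exact: measurableT_comp.
have [h1 h2] := Rint_sgk t.
split.
  apply: (rint_dom (g := fun r => (c * expR (c * `|t|)) * `|sgk t r|)).
  - exact: measurable_funM.
  - exact: rintZ.
  - move=> r; rewrite normrM normr_id [leRHS]mulrC ger0_norm ?mulr_ge0 ?expR_ge0//.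
    by apply: norm_sgk_mul => rt; rewrite ler_wpM2l// ler_expR ler_wpM2l.
wlog t0 : t mt h1 h2 / 0 <= t.
  move=> H; have [|tlt0] := leP 0 t; first exact: H.
  have mt' : measurable_fun setT (fun r => `|sgk (- t) r|).
    by apply: measurableT_comp => //; exact: measurable_sgkr.
  have [h1' h2'] := Rint_sgk (- t).
  rewrite -(normrN t) -(Rint_reflect 0); last exact: measurable_funM.
  apply: le_trans (H _ mt' h1' h2' _); last by rewrite oppr_ge0 ltW.
  rewrite le_eqVlt; apply/orP; left; apply/eqP; apply: eq_Rintegral => r _.
  rewrite sub0r normrN; congr (_ * _); rewrite !norm_sgk.
  rewrite (min_r (ltW tlt0)) (max_l (ltW tlt0)) min_l ?max_r ?oppr_ge0 ?(ltW tlt0)//.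
  by rewrite [t <= - r]lerNr oppr_le0 andbC.
apply: (@le_trans _ _ (\int[mu]_(r in `[0, t]) (c * expR (c * r)))).
  rewrite [leRHS]Rintegral_mkcond le_eqVlt; apply/orP; left; apply/eqP.
  apply: eq_Rintegral => r _; rewrite norm_sgk (min_l t0) (max_r t0) patchE mem_setE in_itv/=.
  by case: ifP => [/andP[r0 _]|_]; rewrite ?mul0r// mul1r ger0_norm.
move: t0; rewrite le_eqVlt => /predU1P[<-|t0].
  by rewrite set_itv1 Rintegral_set1 expR_ge0.
have dE (r : R) : is_derive r 1 (fun r : R => expR (c * r)) (c * expR (c * r)).
  by apply: is_derive_eq; rewrite scaler1 mulrC.
rewrite /Rintegral (@continuous_FTC2 _ _ (fun r => expR (c * r)))//=.
- by rewrite gtr0_norm// lerBlDr lerDl expR_ge0.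
- apply: continuous_subspaceT => r; apply: cvgM; first exact: cvg_cst.
  by apply: continuous_comp; [exact: mulrl_continuous|exact: continuous_expR].
- have cE : continuous (fun r : R => expR (c * r)).
    by move=> r; apply: continuous_comp; [exact: mulrl_continuous|exact: continuous_expR].
  split; [by move=> r _; have [] := dE r|apply: cvg_at_right_filter; exact: cE|].
  by apply: cvg_at_left_filter; exact: cE.
- by move=> r _; rewrite derive1E; have [_ ->] := dE r.
Qed.

End TimeKernel.

Lemma measurable_fst_fst {R : realType} : measurable_fun setT (fun p : (R * R) * R => p.1.1).
Proof. exact: (measurableT_comp measurable_fst measurable_fst). Qed.

Lemma measurable_snd_fst {R : realType} : measurable_fun setT (fun p : (R * R) * R => p.1.2).
Proof. exact: (measurableT_comp measurable_snd measurable_fst). Qed.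

Ltac meas := repeat first
  [ exact: measurable_fst | exact: measurable_snd | exact: measurable_cst
  | exact: measurable_id | exact: measurable_fst_fst | exact: measurable_snd_fst
  | apply: measurable_funM | apply: measurable_funB | apply: measurable_funD
  | apply: measurable_funX | apply: measurable_fun_pair ].

(** * The bilinear Duhamel operator *)

Section Convolution.
Context {R : realType}.
Local Notation C := (Rcomplex R).
Local Notation nc z := (@Num.norm R _ (z : C)).
Local Notation mu := (@lebesgue_measure R).

Definition lorentz_mass : R := \int[mu]_x lorentz x.

Lemma lorentz_mass_ge0 : 0 <= lorentz_mass.
Proof. by apply: Rintegral_ge0 => x _; exact/ltW/lorentz_gt0. Qed.

Lemma rint_lorentz2 (x : R) : rint (fun y => lorentz (x - y) + lorentz y).
Proof. by apply: rintD; [exact/rint_reflect/rint_lorentz|exact: rint_lorentz]. Qed.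

Lemma Rint_lorentz2 (x : R) : \int[mu]_y (lorentz (x - y) + lorentz y) = 2 * lorentz_mass.
Proof.
rewrite RintegralD//; [|exact/rint_reflect/rint_lorentz|exact: rint_lorentz].
by rewrite (Rint_reflect x measurable_lorentz) -/lorentz_mass; ring.
Qed.

Lemma cmeas_conv (f g : R -> C) (x : R) : cmeas f -> cmeas g ->
  cmeas (fun y : R => f (x - y) * g y).
Proof.
move=> mf mg; apply: cmeasM => //.
by apply: (@cmeas_comp R _ _ _ _ f (fun y : R => x - y)) => //; meas.
Qed.

Lemma conv_dom (sigma a b : R) (f g : R -> C) (x : R) : 0 <= sigma -> cmeas f -> cmeas g ->
  (forall y, `|f y| <= a * wt sigma y) -> (forall y, `|g y| <= b * wt sigma y) ->
  cdom (fun y => (2 * (a * b) * wt sigma x) * (lorentz (x - y) + lorentz y))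
    (fun y => f (x - y) * g y).
Proof.
move=> s0 mf mg fa gb.
have pos (h : R -> C) (c : R) : (forall y, `|h y| <= c * wt sigma y) -> 0 <= c.
  move=> hc; have := le_trans (normr_ge0 _) (hc 0).
  by rewrite pmulr_lge0// mulr_gt0 ?expR_gt0 ?lorentz_gt0.
have a0 := pos _ _ fa; have b0 := pos _ _ gb.
split; [exact: cmeas_conv|exact/rintZ/rint_lorentz2|move=> y].
rewrite cnormM; apply: (@le_trans _ _ ((a * wt sigma (x - y)) * (b * wt sigma y))).
  exact: ler_pM.
rewrite mulrACA (_ : 2 * (a * b) * _ * _ =
  (a * b) * (2 * wt sigma x * (lorentz (x - y) + lorentz y))); last by ring.
by rewrite ler_wpM2l ?mulr_ge0// wt_conv.
Qed.

Lemma prod_hat_le (sigma a b : R) (f g : R -> C) (x : R) : 0 <= sigma -> cmeas f -> cmeas g ->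
  (forall y, `|f y| <= a * wt sigma y) -> (forall y, `|g y| <= b * wt sigma y) ->
  nc (prod_hat f g x) <= 8 * (a * b) * lorentz_mass * wt sigma x.
Proof.
move=> s0 mf mg fa gb; apply: le_trans (cint_norm_le (conv_dom x s0 mf mg fa gb)) _.
rewrite RintegralZl ?Rint_lorentz2//; last exact: rint_lorentz2.
by rewrite le_eqVlt; apply/orP; left; apply/eqP; ring.
Qed.

(** Substitute [- y] for [y] in the convolution. Hermitian symmetry has to pass through the
    iteration because [is_Hs] asks for it. *)
Lemma prod_hat_herm (f g : R -> C) (x : R) : cmeas f -> cmeas g ->
  (exists h, cdom h (fun y => f (x - y) * g y)) ->
  (forall y, f (- y) = conjc (f y)) -> (forall y, g (- y) = conjc (g y)) ->
  prod_hat f g (- x) = conjc (prod_hat f g x).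
Proof.
move=> mf mg [h dh] hf hg.
rewrite /prod_hat -(cint_conj dh) -(cint_reflect 0 (cmeas_conv (- x) mf mg)).
apply: eq_cint => y _; rewrite (_ : - x - (0 - y) = - (x - y)) ?sub0r ?hg ?hf; last by ring.
by case: (f _) => ? ?; case: (g _) => ? ?; apply: ceqP => /=; ring.
Qed.

(** Equality holds at every [x], although the factors are known only almost everywhere; this makes
    the arbitrary representative chosen by [hat] harmless. *)
Lemma prod_hat_ae (f f' g g' : R -> C) x : cmeas f -> cmeas f' -> cmeas g -> cmeas g' ->
  {ae mu, forall y, f y = f' y} -> {ae mu, forall y, g y = g' y} ->
  prod_hat f g x = prod_hat f' g' x.
Proof.
move=> mf mf' mg mg' ff gg; apply: cint_ae; [exact: cmeas_conv|exact: cmeas_conv|].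
have := ae_reflect x ff; move: gg; apply: filterS2.
  exact: ae_filter_lebesgue.
by move=> y -> ->.
Qed.

Lemma ddx_norm (f : R -> C) (x : R) : nc (ddx f x) = `|x| * nc (f x).
Proof. by rewrite /ddx cnormM normCE /= expr0n add0r sqrtr_sqr. Qed.

Lemma cmeas_ddx (f : R -> C) : cmeas f -> cmeas (ddx f).
Proof. by move=> mf; apply: cmeasM => //; apply: cmeas_Complex. Qed.

(* Reflecting [y] to [x - y] and averaging moves the derivative out of the product. *)
Lemma prod_hat_ddx (sigma a : R) (f : R -> C) (x : R) : 0 < sigma -> cmeas f ->
  (forall y, `|f y| <= a * wt sigma y) ->
  prod_hat f (ddx f) x = 2^-1 *: ddx (prod_hat f f) x.
Proof.
move=> s0 mf fa; have [M M0 hM] := pow_exp_bound 1 s0.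
have a0 : 0 <= a.
  have := le_trans (normr_ge0 _) (fa 0).
  by rewrite pmulr_lge0// mulr_gt0 ?expR_gt0 ?lorentz_gt0.
have mP : cmeas (fun y : R => f (x - y) * ddx f y) by apply: cmeas_conv => //; exact: cmeas_ddx.
have dP : cdom (fun y => (a * a * M) * lorentz y) (fun y => f (x - y) * ddx f y).
  split => // [|y]; first exact/rintZ/rint_lorentz.
  rewrite cnormM ddx_norm.
  have h1 : `|f (x - y)| <= a.
    apply: le_trans (fa _) _; rewrite -[leRHS]mulr1 ler_wpM2l//.
    exact: le_trans (wt_le_lorentz _ (ltW s0)) (lorentz_le1 _).
  have h2 : `|y| * `|f y| <= a * M * lorentz y.
    apply: (@le_trans _ _ (`|y| * (a * wt sigma y))); first by rewrite ler_wpM2l.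
    rewrite /wt (_ : `|y| * _ = a * (`|y| ^+ 1 * expR (- (sigma * `|y|))) * lorentz y).
      by rewrite ler_wpM2r ?(ltW (lorentz_gt0 _))// ler_wpM2l.
    by rewrite expr1; ring.
  by rewrite -!mulrA; apply: ler_pM => //; rewrite ?mulr_ge0// !mulrA.
have dP' : cdom (fun y => (a * a * M) * lorentz (x - y)) (fun y => f (x - (x - y)) * ddx f (x - y)).
  have [_ iP nP] := dP; split => //.
    by apply: (@cmeas_comp R _ _ _ _ _ (fun y : R => x - y) _ mP); meas.
  exact: (rint_reflect x iP).
have E : prod_hat f (ddx f) x + prod_hat f (ddx f) x = ddx (prod_hat f f) x.
  rewrite {1}/prod_hat -(cint_reflect x mP) /prod_hat -(cintD dP' dP).
  rewrite /ddx -(cintM _ (conv_dom x (ltW s0) mf mf fa fa)).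
  apply: eq_cint => y _; rewrite /ddx subKr.
  by case: (f _) => ? ?; case: (f _) => ? ?; apply: ceqP => /=; ring.
rewrite -E; apply: ceqP; rewrite ?cReZ ?cImZ ?cReD ?cImD; by field.
Qed.

Definition cis (x : R) : C := Complex (cos x) (sin x).

Lemma norm_cis x : nc (cis x) = 1.
Proof. by rewrite normCE /= cos2Dsin2 sqrtr1. Qed.

Lemma cisD x y : cis (x + y) = cis x * cis y.
Proof. by apply: ceqP; rewrite /= ?cosD ?sinD //; ring. Qed.

Lemma measurable_cis d (X : measurableType d) (f : X -> R) :
  measurable_fun setT f -> cmeas (fun x => cis (f x)).
Proof.
move=> mf; apply: cmeas_Complex; apply: (measurableT_comp _ mf).
  by apply: continuous_measurable_fun; exact: continuous_cos.
by apply: continuous_measurable_fun; exact: continuous_sin.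
Qed.

Lemma norm_cisB x y : nc (cis x - cis y) <= 2 * `|x - y|.
Proof.
have H (f df : R -> R) : (forall x : R, is_derive x 1 f (df x)) ->
    (forall x, `|df x| <= 1) -> `|f x - f y| <= `|x - y|.
  move=> fd b; wlog xy : x y / y <= x.
    by move=> H; case: (leP y x) => [/H//|/ltW/H]; rewrite distrC (distrC x).
  have [|c _ ->] := @MVT_segment _ f df y x xy (fun z _ => fd z).
    apply: continuous_subspaceT => z; apply: differentiable_continuous.
    by apply/derivable1_diffP; have [] := fd z.
  by rewrite normrM ler_piMl.
rewrite mulrDl mul1r; apply: le_trans (norm_Complex_le _ _) _.
apply: lerD.
  apply: (H cos (fun x => - sin x)) => z; by rewrite normrN ler_norml sin_geN1 sin_le1.
by apply: (H sin cos) => z; rewrite ler_norml cos_geN1 cos_le1.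
Qed.

End Convolution.

(** * Bounds and bilinearity of the Duhamel operator in the weighted norms *)

Section Duhamel.
Context {R : realType} (T : R) (T0 : 0 < T).
Local Notation C := (Rcomplex R).
Local Notation nc z := (@Num.norm R _ (z : C)).
Implicit Types (f g : R -> R -> C).

(* The analyticity radius [2 T - |t|] shrinks at unit speed, which pays for the
   derivative in the nonlinearity, and stays at least [T] for [|t| <= T]. *)
Definition Wt (t x : R) : R := if `|t| <= T then wt (2 * T - `|t|) x else 0.

Lemma Wt_ge0 t x : 0 <= Wt t x.
Proof. by rewrite /Wt; case: ifP => // _; exact: wt_ge0. Qed.

Lemma Wt_le t x : Wt t x <= wt T x.
Proof.
rewrite /Wt; case: ifP => [tT|_]; last exact: wt_ge0.
rewrite ler_wpM2r ?(ltW (lorentz_gt0 _))// ler_expR lerN2 ler_wpM2r//; lra.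
Qed.

(** The ball of radius [a] of the space in which the iteration runs. Joint measurability in time and
    frequency is what makes time integrals and convolutions measurable in the remaining variable. *)
Definition fam (a : R) f :=
  cmeas (fun p : R * R => f p.1 p.2) /\ forall t x, nc (f t x) <= a * Wt t x.

Lemma fam_ge0 a f : fam a f -> 0 <= a.
Proof.
move=> [_ /(_ 0 0)] h; have := le_trans (normr_ge0 _) h.
rewrite /Wt normr0 (ltW T0) pmulr_lge0// mulr_gt0 ?expR_gt0 ?lorentz_gt0//.
Qed.

Lemma fam_cmeas a f t : fam a f -> cmeas (f t).
Proof.
move=> [mf _]; apply: (@cmeas_comp R _ _ _ _ _ (fun x : R => (t, x)) _ mf).
by meas.
Qed.

Lemma fam_wt a f t x : fam a f -> `|t| <= T -> nc (f t x) <= a * wt (2 * T - `|t|) x.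
Proof. by move=> [_ /(_ t x) + tT]; rewrite /Wt tT. Qed.

Lemma fam_wtT a f t x : fam a f -> nc (f t x) <= a * wt T x.
Proof.
by move=> fa; have [_ /(_ t x)/le_trans] := fa; apply; rewrite ler_wpM2l ?Wt_le ?(fam_ge0 fa).
Qed.

Lemma famW a b f : a <= b -> fam a f -> fam b f.
Proof.
move=> ab [mf fa]; split => // t x.
by apply: le_trans (fa t x) _; rewrite ler_wpM2r ?Wt_ge0.
Qed.

Lemma fam_add a b f g : fam a f -> fam b g -> fam (a + b) (fun t x => f t x + g t x).
Proof.
move=> [mf fa] [mg gb]; split; first exact: cmeasD.
by move=> t x; apply: le_trans (ler_normD _ _) _; rewrite mulrDl lerD.
Qed.

Lemma famN a f : fam a f -> fam a (fun t x => - f t x).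
Proof. by move=> [mf fa]; split => [|t x]; [exact: cmeasN|rewrite normrN]. Qed.

Lemma fam_sub a b f g : fam a f -> fam b g -> fam (a + b) (fun t x => f t x - g t x).
Proof. by move=> fa gb; apply: fam_add => //; exact: famN. Qed.

Lemma famZ a (k : R) f : fam a f -> fam (`|k| * a) (fun t x => k *: f t x).
Proof.
move=> [mf fa]; split => [|t x].
  by apply: cmeasZ => //; exact: measurable_cst.
by rewrite normCZ -mulrA ler_wpM2l.
Qed.

Definition dint (beta : R) f g (t x r : R) : C :=
  sgk t r *: airy beta (t - r) (ddx (prod_hat (f r) (g r))) x.

(* Cut off at [|t| <= T], like [Wt], so that the bounds hold without conditions on [t]. *)
Definition Dh (beta : R) f g (t x : R) : C :=
  if `|t| <= T then cint setT (dint beta f g t x) else 0.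

Lemma Dh_in beta f g t x : `|t| <= T -> Dh beta f g t x = cint setT (dint beta f g t x).
Proof. by rewrite /Dh => ->. Qed.

Lemma Dh_out beta f g t x : ~~ (`|t| <= T) -> Dh beta f g t x = 0.
Proof. by rewrite /Dh => /negbTE ->. Qed.

Lemma cmeas_dint3 beta f g : cmeas (fun p : R * R => f p.1 p.2) ->
  cmeas (fun p : R * R => g p.1 p.2) ->
  cmeas (fun p : (R * R) * R => dint beta f g p.1.1 p.1.2 p.2).
Proof.
move=> mf mg.
have mP : cmeas (fun p : R * R => prod_hat (f p.1) (g p.1) p.2).
  apply: (@cmeas_cint R _ _ (fun q : (R * R) * R => f q.1.1 (q.1.2 - q.2) * g q.1.1 q.2)).
  apply: cmeasM.
    by apply: (@cmeas_comp R _ _ _ _ _ (fun q : (R * R) * R => (q.1.1, q.1.2 - q.2)) _ mf); meas.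
  by apply: (@cmeas_comp R _ _ _ _ _ (fun q : (R * R) * R => (q.1.1, q.2)) _ mg); meas.
apply: cmeasZ.
  apply: (@measurableT_comp _ _ _ _ _ _ (fun p : R * R => sgk p.1 p.2) setT
    (fun p : (R * R) * R => (p.1.1, p.2))); first exact: measurable_sgk.
  by meas.
apply: cmeasM.
  by apply: (@measurable_cis R _ _ (fun p : (R * R) * R => beta * (p.1.1 - p.2) * p.1.2 ^+ 3)); meas.
apply: cmeasM; first by apply: cmeas_Complex; meas.
by apply: (@cmeas_comp R _ _ _ _ _ (fun p : (R * R) * R => (p.2, p.1.2)) _ mP); meas.
Qed.

Lemma cmeas_dint beta f g t x a b : fam a f -> fam b g -> cmeas (dint beta f g t x).
Proof.
move=> [mf _] [mg _].
by apply: (@cmeas_comp R _ _ _ _ _ (fun r : R => ((t, x), r)) _ (cmeas_dint3 beta mf mg)); meas.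
Qed.

Lemma cmeas_Dh beta f g a b : fam a f -> fam b g ->
  cmeas (fun p : R * R => Dh beta f g p.1 p.2).
Proof.
move=> [mf _] [mg _]; apply: cmeas_if.
- apply: measurable_fun_ler; last by meas.
  by apply: measurableT_comp => //; meas.
- exact: cmeas_cint (cmeas_dint3 beta mf mg).
- by split; exact: measurable_cst.
Qed.

Lemma airy_norm beta t (f : R -> C) x : nc (airy beta t f x) = nc (f x).
Proof. by rewrite /airy cnormM (norm_cis (beta * t * x ^+ 3)) mul1r. Qed.

Lemma dint_le beta f g t x r a b : fam a f -> fam b g -> `|t| <= T ->
  nc (dint beta f g t x r) <= `|sgk t r| * (`|x| * (8 * (a * b) * lorentz_mass * wt (2 * T - `|r|) x)).
Proof.
move=> fa gb tT; rewrite normCZ airy_norm ddx_norm.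
apply: norm_sgk_mul => rt; have rT := le_trans rt tT.
rewrite ler_wpM2l//; apply: prod_hat_le.
- by rewrite subr_ge0 (le_trans rT)// mulr_natl mulr2n lerDl ltW.
- exact: fam_cmeas fa.
- exact: fam_cmeas gb.
- by move=> y; exact: fam_wt.
- by move=> y; exact: fam_wt.
Qed.

Lemma dint_dom beta f g t x a b : fam a f -> fam b g -> `|t| <= T ->
  cdom (fun r => (8 * (a * b) * lorentz_mass * wt (2 * T) x) * (`|sgk t r| * (`|x| * expR (`|x| * `|r|))))
    (dint beta f g t x).
Proof.
move=> fa gb tT; split; first exact: cmeas_dint fa gb.
  by have [h _] := Rint_sgk_exp t (normr_ge0 x); exact: rintZ.
move=> r; apply: le_trans (dint_le beta x r fa gb tT) _.
by rewrite wt_shift le_eqVlt; apply/orP; left; apply/eqP; ring.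
Qed.

(** The convolution of two functions of radius [2 T - |r|] has the same radius, the derivative
    contributes [|x|], and [Rint_sgk_exp] turns the time integral of [|x| e^{|x| |r|}] into
    [e^{|x| |t|}], which is the weight at time [t]. The constant does not depend on [T]. *)
Lemma Dh_fam beta f g a b : fam a f -> fam b g -> fam (16 * lorentz_mass * (a * b)) (Dh beta f g).
Proof.
move=> fa gb; split; first exact: cmeas_Dh fa gb.
move=> t x; rewrite /Dh /Wt; case: ifP => [tT|_]; last by rewrite normr0 mulr0.
apply: le_trans (cint_norm_le (dint_dom beta x fa gb tT)) _.
have [h1 h2] := Rint_sgk_exp t (normr_ge0 x).
rewrite RintegralZl// wt_shift.
rewrite (_ : 16 * lorentz_mass * _ * _ = 2 * ((8 * (a * b) * lorentz_mass * wt (2 * T) x) * expR (`|x| * `|t|))); last by ring.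
have := fam_ge0 fa; have := fam_ge0 gb => b0 a0.
by rewrite ler_wpM2l// ler_wpM2l// mulr_ge0 ?wt_ge0// mulr_ge0 ?lorentz_mass_ge0// !mulr_ge0.
Qed.

Lemma conv_fam f g a b r x : fam a f -> fam b g ->
  exists h, cdom h (fun y => f r (x - y) * g r y).
Proof.
move=> fa gb; eexists; apply: (conv_dom x (ltW T0) (fam_cmeas r fa) (fam_cmeas r gb)).
  by move=> y; exact: fam_wtT fa.
by move=> y; exact: fam_wtT gb.
Qed.

Lemma dint_lin (k : R) (z w P P' : C) :
  k *: (z * (w * P)) - k *: (z * (w * P')) = k *: (z * (w * (P - P'))).
Proof. by rewrite !mulrBr scalerBr. Qed.

Lemma Dh_subl beta f f' g a a' b t x : fam a f -> fam a' f' -> fam b g ->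
  Dh beta f g t x - Dh beta f' g t x = Dh beta (fun t x => f t x - f' t x) g t x.
Proof.
move=> fa fa' gb; have [tT|tT] := boolP (`|t| <= T); last by rewrite !Dh_out// subr0.
rewrite !(Dh_in _ _ _ _ tT).
rewrite -(cintB (dint_dom beta x fa gb tT) (dint_dom beta x fa' gb tT)).
apply: eq_cint => r _.
have [h d] := conv_fam r x fa gb; have [h' d'] := conv_fam r x fa' gb.
rewrite [LHS]dint_lin; congr (_ *: (_ * (_ * _))).
by rewrite -[LHS](cintB d d'); apply: eq_cint => y _; rewrite mulrBl.
Qed.

Lemma Dh_subr beta f g g' a b b' t x : fam a f -> fam b g -> fam b' g' ->
  Dh beta f g t x - Dh beta f g' t x = Dh beta f (fun t x => g t x - g' t x) t x.
Proof.
move=> fa gb gb'; have [tT|tT] := boolP (`|t| <= T); last by rewrite !Dh_out// subr0.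
rewrite !(Dh_in _ _ _ _ tT).
rewrite -(cintB (dint_dom beta x fa gb tT) (dint_dom beta x fa gb' tT)).
apply: eq_cint => r _.
have [h d] := conv_fam r x fa gb; have [h' d'] := conv_fam r x fa gb'.
rewrite [LHS]dint_lin; congr (_ *: (_ * (_ * _))).
by rewrite -[LHS](cintB d d'); apply: eq_cint => y _; rewrite mulrBr.
Qed.

Lemma DhZ beta f g a b (k : R) t x : fam a f -> fam b g ->
  Dh beta (fun t x => k *: f t x) (fun t x => k *: g t x) t x = k ^+ 2 *: Dh beta f g t x.
Proof.
move=> fa gb; have [tT|tT] := boolP (`|t| <= T); last by rewrite !Dh_out// scaler0.
rewrite !(Dh_in _ _ _ _ tT).
rewrite cscaleE -(cintM _ (dint_dom beta x fa gb tT)).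
apply: eq_cint => r _; rewrite /dint /airy /ddx.
have [h d] := conv_fam r x fa gb.
have -> : prod_hat (fun x => k *: f r x) (fun x => k *: g r x) x =
    (Complex (k ^+ 2) 0 : C) * prod_hat (f r) (g r) x.
  rewrite -(cintM _ d); apply: eq_cint => y _; rewrite !cscaleE.
  by case: (f _ _) => ? ?; case: (g _ _) => ? ?; apply: ceqP => /=; ring.
rewrite !cscaleE; case: (prod_hat _ _ _) => ? ?; apply: ceqP => /=; ring.
Qed.

(** Telescoping through [Dh f' g]. The number [c] is a distance relative to the sizes [a] and [b],
    so that the same statement serves the contraction and the cubic remainder. *)
Lemma Dh_diff beta f f' g g' a b c t x : fam a f -> fam a f' -> fam b g -> fam b g' ->
  (forall t x, nc (f t x - f' t x) <= c * a * Wt t x) ->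
  (forall t x, nc (g t x - g' t x) <= c * b * Wt t x) ->
  nc (Dh beta f g t x - Dh beta f' g' t x) <= 32 * lorentz_mass * (a * b) * c * Wt t x.
Proof.
move=> fa fa' gb gb' ff gg.
have F : fam (c * a) (fun t x => f t x - f' t x).
  by have [m _] := fam_sub fa fa'.
have G : fam (c * b) (fun t x => g t x - g' t x).
  by have [m _] := fam_sub gb gb'.
have -> : Dh beta f g t x - Dh beta f' g' t x =
    Dh beta (fun t x => f t x - f' t x) g t x + Dh beta f' (fun t x => g t x - g' t x) t x.
  rewrite -[LHS](subrKA (Dh beta f' g t x)).
  exact: (congr2 +%R (Dh_subl beta t x fa fa' gb) (Dh_subr beta t x fa' gb gb')).
apply: le_trans (ler_normD _ _) _.
have [_ /(_ t x) h1] := Dh_fam beta F gb; have [_ /(_ t x) h2] := Dh_fam beta fa' G.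
apply: (le_trans (lerD h1 h2)).
by rewrite le_eqVlt; apply/orP; left; apply/eqP; ring.
Qed.

Definition herm f := forall t x, f t (- x) = conjc (f t x).

Lemma Dh_herm beta f g a b : fam a f -> fam b g -> herm f -> herm g -> herm (Dh beta f g).
Proof.
move=> fa gb hf hg t x; have [tT|tT] := boolP (`|t| <= T); last first.
  by rewrite !Dh_out//; apply: ceqP => /=; rewrite ?oppr0.
rewrite !(Dh_in _ _ _ _ tT).
rewrite -(cint_conj (dint_dom beta x fa gb tT)); apply: eq_cint => r _.
rewrite /dint /airy /ddx.
rewrite (prod_hat_herm (fam_cmeas r fa) (fam_cmeas r gb) (conv_fam r x fa gb) (hf r) (hg r)).
rewrite (_ : beta * (t - r) * (- x) ^+ 3 = - (beta * (t - r) * x ^+ 3)); last by ring.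
rewrite cosN sinN; case: (prod_hat _ _ _) => ? ?; apply: ceqP => /=; ring.
Qed.

Lemma ccvg0P (z_ : nat -> C) z (k : C) : ccvg z_ z -> ccvg (fun n => k * z_ n) (k * z).
Proof.
move=> h; rewrite /ccvg.
rewrite (_ : (fun n => nc (k * z_ n - k * z)) = (fun n => nc k * nc (z_ n - z))).
  by rewrite -(mulr0 (nc k)); apply: cvgM => //; exact: cvg_cst.
by apply/funext => n; rewrite -mulrBr cnormM.
Qed.

(** Dominated convergence twice: in [y] inside the convolution, then in the time variable. The
    uniform [fam] bounds provide both majorants. *)
Lemma Dh_cvg beta (f_ g_ : nat -> R -> R -> C) f g a b t x :
  (forall n, fam a (f_ n)) -> (forall n, fam b (g_ n)) -> fam a f -> fam b g ->
  (forall r y, ccvg (fun n => f_ n r y) (f r y)) ->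
  (forall r y, ccvg (fun n => g_ n r y) (g r y)) ->
  ccvg (fun n => Dh beta (f_ n) (g_ n) t x) (Dh beta f g t x).
Proof.
move=> fa_ gb_ fa gb cf cg; have [tT|tT] := boolP (`|t| <= T); last first.
  rewrite /ccvg; under eq_fun do rewrite !Dh_out// subrr normr0; exact: cvg_cst.
rewrite (Dh_in _ _ _ _ tT); under eq_fun do rewrite (Dh_in _ _ _ _ tT).
apply: (cint_dct (fun n => dint_dom beta x (fa_ n) (gb_ n) tT)).
  exact: cmeas_dint fa gb.
move=> r; rewrite /dint /airy /ddx cscaleE.
under [X in ccvg X]eq_fun do rewrite cscaleE.
do 3 apply: ccvg0P.
have dn n := conv_dom x (ltW T0) (fam_cmeas r (fa_ n)) (fam_cmeas r (gb_ n))
   (fun y => fam_wtT r y (fa_ n)) (fun y => fam_wtT r y (gb_ n)).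
apply: (cint_dct dn).
  exact: cmeas_conv (fam_cmeas r fa) (fam_cmeas r gb).
move=> y; have /ccvgP[p1 p2] := cf r (x - y); have /ccvgP[q1 q2] := cg r y.
apply/ccvgP; split.
  under eq_fun do rewrite cReM; rewrite cReM.
  by apply: cvgB; apply: cvgM.
under eq_fun do rewrite cImM; rewrite cImM.
by apply: cvgD; apply: cvgM.
Qed.

End Duhamel.

(** * Picard iteration *)

Section ComplexLimits.
Context {R : realType}.
Local Notation C := (Rcomplex R).
Local Notation nc z := (@Num.norm R _ (z : C)).

Implicit Types (zs ws : nat -> C).

Lemma ccvg_unique zs z w : ccvg zs z -> ccvg zs w -> z = w.
Proof.
move=> /ccvgP[z1 z2] /ccvgP[w1 w2]; apply: ceqP.
  exact: (cvg_unique (@norm_hausdorff _ _) z1 w1).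
exact: (cvg_unique (@norm_hausdorff _ _) z2 w2).
Qed.

Lemma ccvgB zs ws z w : ccvg zs z -> ccvg ws w -> ccvg (fun n => zs n - ws n) (z - w).
Proof.
move=> /ccvgP[z1 z2] /ccvgP[w1 w2]; apply/ccvgP; split.
  by under eq_fun do rewrite cReD cReN; rewrite cReD cReN; apply: cvgB.
by under eq_fun do rewrite cImD cImN; rewrite cImD cImN; apply: cvgB.
Qed.

Lemma ccvg_cst (z : C) : ccvg (fun=> z) z.
Proof. by rewrite /ccvg subrr normr0; exact: cvg_cst. Qed.

Lemma ccvg_scale (ks : nat -> R) (k : R) zs z : ks n @[n --> \oo] --> k -> ccvg zs z ->
  ccvg (fun n => ks n *: zs n) (k *: z).
Proof.
move=> ck /ccvgP[z1 z2]; apply/ccvgP; split.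
  by under eq_fun do rewrite cReZ; rewrite cReZ; apply: cvgM.
by under eq_fun do rewrite cImZ; rewrite cImZ; apply: cvgM.
Qed.

Lemma ccvg_conj zs z : ccvg zs z -> ccvg (fun n => conjc (zs n)) (conjc z).
Proof.
move=> /ccvgP[z1 z2]; apply/ccvgP; split.
  rewrite (_ : Re (conjc z) = Re z); last by case: (z).
  rewrite (_ : (fun n => _) = (fun n => Re (zs n)))//.
  by apply/funext => n; case: (zs n).
rewrite (_ : Im (conjc z) = - Im z); last by case: (z).
rewrite (_ : (fun n => _) = (fun n => - Im (zs n))); first exact: cvgN.
by apply/funext => n; case: (zs n).
Qed.

Lemma ccvg_shift zs z : ccvg zs z -> ccvg (fun n => zs n.+1) z.
Proof. by rewrite /ccvg => h; rewrite (cvg_shiftS (fun n => nc (zs n - z))). Qed.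

Lemma ccvg_le zs z (k : R) : ccvg zs z -> (forall n, nc (zs n) <= k) -> nc z <= k.
Proof.
move=> h zk; rewrite -subr_le0.
apply: (cvgr_to_ge h); apply: nearW => n.
rewrite lerBlDr; apply: le_trans (lerD (lexx _) (zk n)).
by rewrite addrC -{1}(subKr (zs n) z); exact: ler_normB.
Qed.

(** The sequence is its first term plus a telescoping series, dominated by a geometric one. *)
Lemma real_geo_cvg (a_ : nat -> R) (c : R) :
  (forall n, `|a_ n.+1 - a_ n| <= c * 2^-1 ^+ n) -> cvgn a_.
Proof.
move=> h; have c0 : 0 <= c by have := le_trans (normr_ge0 _) (h 0%N); rewrite mulr1.
have E : a_ = fun n => a_ 0%N + series (telescope a_) n.
  by apply/funext => n; exact: eq_sum_telescope.
rewrite E; apply: is_cvgD; first exact: is_cvg_cst.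
apply: normed_cvg; apply: (series_le_cvg (v_ := geometric c 2^-1)) => [n|n|//|].
- exact: normr_ge0.
- by rewrite /geometric/= mulr_ge0// exprn_ge0// invr_ge0.
apply: is_cvg_geometric_series.
by rewrite ger0_norm ?invr_ge0// invf_lt1// ltr1n.
Qed.

Definition clim zs : C := Complex (limn (fun n => Re (zs n))) (limn (fun n => Im (zs n))).

Lemma clim_geo zs (c : R) :
  (forall n, nc (zs n.+1 - zs n) <= c * 2^-1 ^+ n) -> ccvg zs (clim zs).
Proof.
move=> h; apply/ccvgP; split => /=.
  apply: (@real_geo_cvg _ c) => n; apply: le_trans (h n).
  by rewrite -cReN -cReD; exact: cnorm_Re.
apply: (@real_geo_cvg _ c) => n; apply: le_trans (h n).
by rewrite -cImN -cImD; exact: cnorm_Im.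
Qed.

Lemma cmeas_lim d (X : measurableType d) (f_ : nat -> X -> C) (f : X -> C) :
  (forall n, cmeas (f_ n)) -> (forall x, ccvg (f_^~ x) (f x)) -> cmeas f.
Proof.
move=> mf cf; split.
  apply: (@measurable_fun_cvg _ _ _ _ (fun n x => Re (f_ n x))).
    by move=> n; have [] := mf n.
  by move=> x _; have /ccvgP[] := cf x.
apply: (@measurable_fun_cvg _ _ _ _ (fun n x => Im (f_ n x))).
  by move=> n; have [] := mf n.
by move=> x _; have /ccvgP[] := cf x.
Qed.

End ComplexLimits.

Lemma normB_subl {R : realType} (a b c : Rcomplex R) : `|a - b - (a - c)| = `|b - c|.
Proof. by rewrite opprB addrC addrA subrK distrC. Qed.

Lemma norm_half {R : realType} (z : Rcomplex R) : `|2^-1 *: z| <= `|z|.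
Proof. by rewrite normCZ ler_piMl// ger0_norm ?invr_ge0// invf_le1// ler1n. Qed.

Lemma sub_diff {R : realType} (l a b z w : Rcomplex R) (k : R) :
  z = l - a -> w = l - b -> `|b - a| <= k -> `|z - w| <= k.
Proof. by move=> -> ->; rewrite normB_subl distrC. Qed.

Lemma half_diff {R : realType} (l a b z w : Rcomplex R) (k : R) :
  z = l - 2^-1 *: a -> w = l - 2^-1 *: b -> `|b - a| <= k -> `|z - w| <= k.
Proof.
move=> zE wE bk; apply: (sub_diff zE wE); apply: le_trans bk.
by rewrite -scalerBr; exact: norm_half.
Qed.

(** * Construction of the solution and its expansion to second order *)

Section FixedPoint.
Context {R : realType} (T : R) (T0 : 0 < T).
Local Notation C := (Rcomplex R).
Local Notation nc z := (@Num.norm R _ (z : C)).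

Context (alpha A : R) (u0 v0 : R -> C).
Hypotheses (mu0 : cmeas u0) (mv0 : cmeas v0).
Hypotheses (hu0 : forall x, u0 (- x) = conjc (u0 x)) (hv0 : forall x, v0 (- x) = conjc (v0 x)).
Hypotheses (bu0 : forall x, nc (u0 x) <= A * wt (2 * T) x).
Hypotheses (bv0 : forall x, nc (v0 x) <= A * wt (2 * T) x).
Hypothesis smallA : 128 * (@lorentz_mass R) * A <= 1.
Local Notation fam := (fam T).
Local Notation Dh := (Dh T).

Definition lin (beta : R) (f : R -> C) (t x : R) : C :=
  if `|t| <= T then airy beta t f x else 0.

(** The Airy group only rotates the phase, and the data have the full radius [2 T], at least that of
    the weight at time [t]. *)
Lemma lin_fam beta f : cmeas f -> (forall x, nc (f x) <= A * wt (2 * T) x) -> fam A (lin beta f).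
Proof.
move=> mf bf; split.
  apply: cmeas_if.
  - by apply: measurable_fun_ler; [apply: measurableT_comp => //|]; meas.
  - apply: cmeasM.
      by apply: (@measurable_cis R _ _ (fun p : R * R => beta * p.1 * p.2 ^+ 3)); meas.
    by apply: (@cmeas_comp R _ _ _ _ f (fun p : R * R => p.2)) => //; meas.
  - by split; exact: measurable_cst.
move=> t x; rewrite /lin /Wt; case: (`|t| <= T); last by rewrite normr0 mulr0.
rewrite airy_norm; apply: le_trans (bf x) _.
have A0 : 0 <= A.
  have := le_trans (normr_ge0 _) (bf 0).
  by rewrite pmulr_lge0// mulr_gt0 ?expR_gt0 ?lorentz_gt0.
by rewrite ler_wpM2l// wt_shift ler_peMl ?wt_ge0// -expR0 ler_expR mulr_ge0.
Qed.

Lemma lin_herm beta f : (forall x, f (- x) = conjc (f x)) -> herm (lin beta f).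
Proof.
move=> hf t x; rewrite /lin; case: (`|t| <= T); last by apply: ceqP => /=; rewrite ?oppr0.
rewrite /airy hf (_ : beta * t * (- x) ^+ 3 = - (beta * t * x ^+ 3)); last by ring.
by rewrite cosN sinN; case: (f x) => ? ?; apply: ceqP => /=; ring.
Qed.

Local Notation l1 := (lin 1 u0).
Local Notation l2 := (lin alpha v0).

(** The coefficient [2^-1] appears because [v v_x] is half the derivative of [v^2], which lets both
    equations use the same operator [Dh]. *)
Definition step (F : (R -> R -> C) * (R -> R -> C)) : (R -> R -> C) * (R -> R -> C) :=
  (fun t x => l1 t x - 2^-1 *: Dh 1 F.2 F.2 t x,
   fun t x => l2 t x - Dh alpha F.1 F.2 t x).

Definition picard (n : nat) := iter n step (fun _ _ => 0, fun _ _ => 0).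

Lemma A_ge0 : 0 <= A.
Proof. exact: (fam_ge0 T0 (lin_fam 1 mu0 bu0)). Qed.

Lemma quad_small : 16 * (@lorentz_mass R) * (2 * A * (2 * A)) <= A.
Proof.
have := ler_wpM2r A_ge0 smallA; rewrite mul1r; apply: le_trans.
rewrite -subr_ge0; rewrite (_ : _ - _ = 64 * (@lorentz_mass R) * A * A); last by ring.
by rewrite !mulr_ge0 ?lorentz_mass_ge0 ?A_ge0.
Qed.

(** Half of the radius [2 A] is spent on the free evolution, the other half on the quadratic
    term. *)
Lemma step_fam F : fam (2 * A) F.1 -> fam (2 * A) F.2 ->
  fam (2 * A) (step F).1 /\ fam (2 * A) (step F).2.
Proof.
move=> f1 f2; split; apply: (famW (a := A + A)).
- by rewrite mulr_natl mulr2n.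
- apply: fam_sub; first exact: lin_fam.
  apply: famW (famZ 2^-1 (Dh_fam T0 1 f2 f2)).
  apply: le_trans quad_small; rewrite ler_piMl ?mulr_ge0 ?lorentz_mass_ge0 ?A_ge0//.
  by rewrite ger0_norm ?invr_ge0// invf_le1// ler1n.
- by rewrite mulr_natl mulr2n.
- apply: fam_sub; first exact: lin_fam.
  by apply: famW quad_small _; exact: Dh_fam.
Qed.

Lemma picard_fam n : fam (2 * A) (picard n).1 /\ fam (2 * A) (picard n).2.
Proof.
elim: n => [|n [h1 h2]]; last exact: step_fam.
have z : fam (2 * A) (fun _ _ => 0).
  split; first by split; exact: measurable_cst.
  by move=> t x; rewrite normr0 !mulr_ge0 ?Wt_ge0 ?A_ge0.
by [].
Qed.

Lemma step_herm F : fam (2 * A) F.1 -> fam (2 * A) F.2 -> herm F.1 -> herm F.2 ->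
  herm (step F).1 /\ herm (step F).2.
Proof.
move=> f1 f2 h1 h2; split => t x /=.
  rewrite (lin_herm 1 hu0) (Dh_herm T0 1 f2 f2 h2 h2).
  by case: (lin _ _ _ _) => ? ?; case: (Dh _ _ _ _ _) => ? ?; apply: ceqP => /=; ring.
rewrite (lin_herm alpha hv0) (Dh_herm T0 alpha f1 f2 h1 h2).
by case: (lin _ _ _ _) => ? ?; case: (Dh _ _ _ _ _) => ? ?; apply: ceqP => /=; ring.
Qed.

Lemma picard_herm n : herm (picard n).1 /\ herm (picard n).2.
Proof.
elim: n => [|n [h1 h2]].
  by split => t x; apply: ceqP => /=; rewrite ?oppr0.
by have [f1 f2] := picard_fam n; exact: step_herm.
Qed.

Lemma picardS1 n t x :
  (picard n.+1).1 t x = l1 t x - 2^-1 *: Dh 1 (picard n).2 (picard n).2 t x.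
Proof. by []. Qed.

Lemma picardS2 n t x :
  (picard n.+1).2 t x = l2 t x - Dh alpha (picard n).1 (picard n).2 t x.
Proof. by []. Qed.

(** A contraction with ratio 1/2: [Dh_diff] on the ball of radius [2 A] gives [32 (2 A)^2 = 128 A^2]
    times the mass of [lorentz], and the constant in [smallA] is chosen so that this is at most
    [A]. *)
Lemma picard_diff n t x :
  nc ((picard n.+1).1 t x - (picard n).1 t x) <= 2^-1 ^+ n * (2 * A) * Wt T t x /\
  nc ((picard n.+1).2 t x - (picard n).2 t x) <= 2^-1 ^+ n * (2 * A) * Wt T t x.
Proof.
elim: n t x => [|n IHn] t x.
  have [[_ h1] [_ h2]] := picard_fam 1.
  by rewrite !subr0 expr0 mul1r.
have [f1 f2] := picard_fam n; have [g1 g2] := picard_fam n.+1.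
have I1 t x := (IHn t x).1; have I2 t x := (IHn t x).2.
have W := Wt_ge0 T t x.
have P : 0 <= (2^-1 : R) ^+ n by rewrite exprn_ge0// invr_ge0.
have small : 32 * (@lorentz_mass R) * (2 * A * (2 * A)) * 2^-1 ^+ n * Wt T t x <=
    2^-1 ^+ n.+1 * (2 * A) * Wt T t x.
  rewrite ler_wpM2r// exprS.
  rewrite (_ : 32 * _ * _ * _ = (128 * (@lorentz_mass R) * A) * (A * 2^-1 ^+ n)); last by ring.
  rewrite (_ : 2^-1 * _ * _ = A * 2^-1 ^+ n); last by field.
  by rewrite ler_piMl// mulr_ge0// A_ge0.
have J1 t' x' := eq_ind_r (fun y => y <= _) (I1 t' x') (distrC _ _).
have J2 t' x' := eq_ind_r (fun y => y <= _) (I2 t' x') (distrC _ _).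
split.
  apply: (half_diff (picardS1 n.+1 t x) (picardS1 n t x)); apply: le_trans small.
  exact: (Dh_diff T0 1 t x f2 g2 f2 g2 J2 J2).
apply: (sub_diff (picardS2 n.+1 t x) (picardS2 n t x)); apply: le_trans small.
exact: (Dh_diff T0 alpha t x f1 g1 f2 g2 J1 J2).
Qed.

Definition sol1 (t x : R) : C := clim (fun n => (picard n).1 t x).
Definition sol2 (t x : R) : C := clim (fun n => (picard n).2 t x).

Lemma picard_cvg1 t x : ccvg (fun n => (picard n).1 t x) (sol1 t x).
Proof.
apply: (@clim_geo _ _ (2 * A * Wt T t x)) => n.
by rewrite mulrC mulrA; exact: (picard_diff n t x).1.
Qed.

Lemma picard_cvg2 t x : ccvg (fun n => (picard n).2 t x) (sol2 t x).
Proof.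
apply: (@clim_geo _ _ (2 * A * Wt T t x)) => n.
by rewrite mulrC mulrA; exact: (picard_diff n t x).2.
Qed.

Lemma sol1_fam : fam (2 * A) sol1.
Proof.
split.
  apply: (@cmeas_lim _ _ _ (fun n (p : R * R) => (picard n).1 p.1 p.2)).
    by move=> n; have [[]] := picard_fam n.
  by move=> p; exact: picard_cvg1.
move=> t x; apply: (ccvg_le (picard_cvg1 t x)) => n.
by have [[_ h] _] := picard_fam n.
Qed.

Lemma sol2_fam : fam (2 * A) sol2.
Proof.
split.
  apply: (@cmeas_lim _ _ _ (fun n (p : R * R) => (picard n).2 p.1 p.2)).
    by move=> n; have [_ []] := picard_fam n.
  by move=> p; exact: picard_cvg2.
move=> t x; apply: (ccvg_le (picard_cvg2 t x)) => n.
by have [_ [_ h]] := picard_fam n.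
Qed.

Lemma sol1_herm : herm sol1.
Proof.
move=> t x; apply: (ccvg_unique (picard_cvg1 t (- x))).
have -> : (fun n => (picard n).1 t (- x)) = (fun n => conjc ((picard n).1 t x)).
  by apply/funext => n; have [h _] := picard_herm n; rewrite h.
exact/ccvg_conj/picard_cvg1.
Qed.

Lemma sol2_herm : herm sol2.
Proof.
move=> t x; apply: (ccvg_unique (picard_cvg2 t (- x))).
have -> : (fun n => (picard n).2 t (- x)) = (fun n => conjc ((picard n).2 t x)).
  by apply/funext => n; have [_ h] := picard_herm n; rewrite h.
exact/ccvg_conj/picard_cvg2.
Qed.

Lemma sol1E t x : sol1 t x = l1 t x - 2^-1 *: Dh 1 sol2 sol2 t x.
Proof.
apply: (ccvg_unique (ccvg_shift (picard_cvg1 t x))).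
apply: ccvgB; first exact: ccvg_cst.
apply: ccvg_scale; first exact: cvg_cst.
have f n := (picard_fam n).2.
exact: (Dh_cvg T0 1 t x f f sol2_fam sol2_fam picard_cvg2 picard_cvg2).
Qed.

Lemma sol2E t x : sol2 t x = l2 t x - Dh alpha sol1 sol2 t x.
Proof.
apply: (ccvg_unique (ccvg_shift (picard_cvg2 t x))).
apply: ccvgB; first exact: ccvg_cst.
have f1 n := (picard_fam n).1; have f2 n := (picard_fam n).2.
exact: (Dh_cvg T0 alpha t x f1 f2 sol1_fam sol2_fam picard_cvg1 picard_cvg2).
Qed.

(** The solution differs from the free evolution by [O(A^2)], so replacing one by the other in the
    quadratic term costs [O(A^3)]. In terms of the radius [2 A] the relative distance is [c = 32 A]
    times the mass of [lorentz], and [32 * 4 * 32 = 4096]. *)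
Lemma sol_expand t x : nc (sol2 t x - (l2 t x - Dh alpha l1 l2 t x)) <=
  4096 * (@lorentz_mass R) ^+ 2 * A ^+ 3 * Wt T t x.
Proof.
have L f beta : cmeas f -> (forall x, nc (f x) <= A * wt (2 * T) x) -> fam (2 * A) (lin beta f).
  by move=> mf bf; apply: famW (lin_fam beta mf bf); rewrite mulr_natl mulr2n lerDl A_ge0.
have subl (z l b : C) (k : R) : z = l - b -> nc b <= k -> nc (l - z) <= k.
  by move=> ->; rewrite subKr.
have D1 t' x' : nc (l1 t' x' - sol1 t' x') <= 32 * (@lorentz_mass R) * A * (2 * A) * Wt T t' x'.
  apply: (subl _ _ _ _ (sol1E t' x')); apply: le_trans (norm_half _) _.
  have [_ /(_ t' x') h] := Dh_fam T0 1 sol2_fam sol2_fam.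
  by apply: le_trans h _; rewrite le_eqVlt; apply/orP; left; apply/eqP; ring.
have D2 t' x' : nc (l2 t' x' - sol2 t' x') <= 32 * (@lorentz_mass R) * A * (2 * A) * Wt T t' x'.
  apply: (subl _ _ _ _ (sol2E t' x')).
  have [_ /(_ t' x') h] := Dh_fam T0 alpha sol1_fam sol2_fam.
  by apply: le_trans h _; rewrite le_eqVlt; apply/orP; left; apply/eqP; ring.
have D := Dh_diff T0 alpha t x (L _ 1 mu0 bu0) sol1_fam (L _ alpha mv0 bv0) sol2_fam D1 D2.
apply: (sub_diff (sol2E t x) (erefl _)); apply: le_trans D _.
by rewrite le_eqVlt; apply/orP; left; apply/eqP; ring.
Qed.

End FixedPoint.

(** * The iterate as a solution in H^s *)

Section TimeRegularity.
Context {R : realType} (T : R) (T0 : 0 < T).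
Local Notation C := (Rcomplex R).
Local Notation nc z := (@Num.norm R _ (z : C)).

Implicit Types (f g : R -> R -> C).

Lemma lorentz_absorb (n : nat) : exists2 M : R, 0 <= M &
  forall x : R, `|x| ^+ n * wt T x <= M * lorentz x.
Proof.
have [M M0 h] := pow_exp_bound n T0; exists M => // x.
by rewrite /wt mulrA ler_wpM2r ?(ltW (lorentz_gt0 _)).
Qed.

(** Lipschitz in time at each frequency, with a square integrable majorant: for [s <= 0] this gives
    Lipschitz continuity into [H^s]. *)
Definition tlip f := exists2 L : R, 0 <= L & forall t t0 x, `|t| <= T -> `|t0| <= T ->
  nc (f t x - f t0 x) <= L * `|t - t0| * lorentz x.

(** Differentiating the Airy phase in time costs [|x|^3], which the exponential decay of radius [T]
    absorbs. *)
Lemma lin_lip beta (u : R -> C) a : 0 <= a ->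
  (forall x, nc (u x) <= a * wt (2 * T) x) -> tlip (lin T beta u).
Proof.
move=> a0 ua; have [M M0 hM] := lorentz_absorb 3.
exists (2 * `|beta| * a * M); first by rewrite !mulr_ge0.
move=> t t0 x tT t0T; rewrite /lin tT t0T /airy -mulrBl cnormM.
have h1 := norm_cisB (beta * t * x ^+ 3) (beta * t0 * x ^+ 3).
have h2 : nc (u x) <= a * wt T x.
  apply: le_trans (ua x) _; rewrite ler_wpM2l// ler_wpM2r ?(ltW (lorentz_gt0 _))//.
  by rewrite ler_expR lerN2 ler_wpM2r// mulr_natl mulr2n lerDl ltW.
apply: le_trans (ler_pM (normr_ge0 _) (normr_ge0 _) h1 h2) _.
have -> : beta * t * x ^+ 3 - beta * t0 * x ^+ 3 = beta * (t - t0) * x ^+ 3 by ring.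
rewrite (normrM (beta * (t - t0))) (normrM beta) normrX.
rewrite (_ : _ * (a * wt T x) = (2 * `|beta| * a * `|t - t0|) * (`|x| ^+ 3 * wt T x)); last by ring.
rewrite (_ : _ * lorentz x = (2 * `|beta| * a * `|t - t0|) * (M * lorentz x)); last by ring.
by rewrite ler_wpM2l// !mulr_ge0.
Qed.

(** Moving [t] changes both the interval of integration and the Airy phase. The first change costs
    the [|x|] of the derivative, the second a further [|x|^3]; hence the powers 1 and 4 to be
    absorbed. *)
Lemma Dh_lip beta f g a b : fam T a f -> fam T b g -> tlip (Dh T beta f g).
Proof.
move=> fa gb.
have [M1 M10 hM1] := lorentz_absorb 1; have [M4 M40 hM4] := lorentz_absorb 4.
have a0 := fam_ge0 T0 fa; have b0 := fam_ge0 T0 gb; have i0 := lorentz_mass_ge0 (R := R).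
pose k := 8 * (a * b) * (@lorentz_mass R).
have k0 : 0 <= k by rewrite !mulr_ge0.
exists (2 * (2 * k * M1 + T * (2 * `|beta|) * k * M4)).
  by rewrite !(mulr_ge0, addr_ge0)// ltW.
move=> t t0 x tT t0T; rewrite (Dh_in _ _ _ _ tT) (Dh_in _ _ _ _ t0T).
have dt := dint_dom T0 beta x fa gb tT; have dt0 := dint_dom T0 beta x fa gb t0T.
rewrite -(cintB dt dt0).
pose n := `|x| * (k * wt T x).
have n0 : 0 <= n by rewrite mulr_ge0// mulr_ge0// wt_ge0.
pose X r := ddx (prod_hat (f r) (g r)) x.
have Xn r : nc (X r) <= n.
  rewrite ddx_norm /n ler_wpM2l// /k; apply: prod_hat_le.
  - exact: ltW.
  - exact: fam_cmeas fa.
  - exact: fam_cmeas gb.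
  - by move=> y; exact: (fam_wtT T0 r y fa).
  - by move=> y; exact: (fam_wtT T0 r y gb).
(* The phase at [t] with the kernel at [t0] is the intermediate term: the first summand lives
   between [t0] and [t], the second carries the difference of the phases. *)
have E r : dint beta f g t x r - dint beta f g t0 x r =
    (sgk t r - sgk t0 r) *: (cis (beta * (t - r) * x ^+ 3) * X r) +
    sgk t0 r *: ((cis (beta * (t - r) * x ^+ 3) - cis (beta * (t0 - r) * x ^+ 3)) * X r).
  rewrite /dint /airy -/(X r) -!/(cis _) scalerBl mulrBl scalerBr.
  by rewrite addrA subrK.
have [s1 s2] := Rint_sgkB t t0; have [r1 r2] := Rint_sgk t0.
pose m := n * (2 * (`|beta| * `|t - t0| * `|x| ^+ 3)).
have dE : cdom (fun r => n * `|sgk t r - sgk t0 r| + m * `|sgk t0 r|)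
    (fun r => dint beta f g t x r - dint beta f g t0 x r).
  split.
  - by apply: cmeasB; [have [] := dt|have [] := dt0].
  - by apply: rintD; exact: rintZ.
  - move=> r; rewrite E; apply: le_trans (ler_normD _ _) _; apply: lerD.
      by rewrite normCZ cnormM norm_cis mul1r mulrC ler_wpM2r.
    rewrite normCZ cnormM mulrC ler_wpM2r// mulrC; apply: ler_pM => //.
    apply: le_trans (norm_cisB _ _) _; rewrite ler_wpM2l//.
    rewrite (_ : _ - _ = beta * (t - t0) * x ^+ 3); last by ring.
    by rewrite (normrM (beta * (t - t0))) (normrM beta) normrX.
apply: le_trans (cint_norm_le dE) _.
rewrite RintegralD//; [|exact: rintZ|exact: rintZ].
rewrite !RintegralZl// r2.
apply: (@le_trans _ _ (2 * (n * (2 * `|t - t0|) + m * T))).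
  have m0 : 0 <= m by rewrite mulr_ge0// !mulr_ge0.
  by rewrite ler_wpM2l// lerD// ler_wpM2l.
have e1 : n <= k * M1 * lorentz x.
  rewrite /n mulrCA -mulrA ler_wpM2l//; have := hM1 x; rewrite expr1//.
have e4 : n * `|x| ^+ 3 <= k * M4 * lorentz x.
  rewrite (_ : n * _ = k * (`|x| ^+ 4 * wt T x)); last by rewrite /n; ring.
  by rewrite -mulrA ler_wpM2l.
rewrite (_ : n * (2 * `|t - t0|) + m * T =
  (2 * `|t - t0|) * n + (T * (2 * `|beta|) * `|t - t0|) * (n * `|x| ^+ 3)); last by rewrite /m; ring.
rewrite (_ : _ * lorentz x = 2 * ((2 * `|t - t0|) * (k * M1 * lorentz x) +
  (T * (2 * `|beta|) * `|t - t0|) * (k * M4 * lorentz x))); last by ring.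
rewrite ler_wpM2l//.
by apply: lerD; rewrite ler_wpM2l// !mulr_ge0// ltW.
Qed.

Lemma tlipB f g h : tlip f -> tlip g -> (forall t x, h t x = f t x - g t x) -> tlip h.
Proof.
move=> [L L0 hL] [M M0 hM] hE; exists (L + M); first exact: addr_ge0.
move=> t t0 x tT t0T; rewrite !hE.
have -> : f t x - g t x - (f t0 x - g t0 x) = (f t x - f t0 x) - (g t x - g t0 x).
  by rewrite !opprB !addrA addrAC [in RHS]addrAC; congr (_ + _); rewrite addrAC.
apply: le_trans (ler_normB _ _) _; rewrite mulrDl mulrDl; apply: lerD; [exact: hL|exact: hM].
Qed.

Lemma tlip_half f : tlip f -> tlip (fun t x => 2^-1 *: f t x).
Proof.
move=> [L L0 hL]; exists L => // t t0 x tT t0T; rewrite -scalerBr.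
by apply: le_trans (norm_half _) _; exact: hL.
Qed.

End TimeRegularity.

(** * Upper and lower bounds for Sobolev norms *)

Section SobolevNorms.
Context {R : realType} (s : R).
Local Notation C := (Rcomplex R).
Local Notation nc z := (@Num.norm R _ (z : C)).
Local Notation mu := (@lebesgue_measure R).

Definition lorentz_norm2 : R := fine ('N[mu]_2%:E[EFin \o @lorentz R])%E.

(** Since [lorentz] is at most 1, its square is bounded by itself, which is integrable. *)
Lemma Lnorm_lorentz : ('N[mu]_2%:E[EFin \o @lorentz R] = lorentz_norm2%:E)%E.
Proof.
rewrite /lorentz_norm2 fineK// ge0_fin_numE ?Lnorm_ge0// unlock.
apply: poweR_lty.
have [_ h] := integrableP _ _ _ (@rint_lorentz R).
apply: le_lt_trans h; apply: ge0_le_integral => //.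
- by move=> x _; exact: poweR_ge0.
- apply: (measurableT_comp (measurable_poweR _)).
  by apply: measurableT_comp => //; apply/measurable_EFinP; exact: measurable_lorentz.
- by apply: measurableT_comp => //; apply/measurable_EFinP; exact: measurable_lorentz.
- move=> x _ /=; rewrite lee_fin ger0_norm ?(ltW (lorentz_gt0 _))//.
  rewrite powR_mulrn ?(ltW (lorentz_gt0 _))// expr2 ler_piMl ?(ltW (lorentz_gt0 _))//.
  exact: lorentz_le1.
Qed.

Lemma lorentz_norm2_ge0 : 0 <= lorentz_norm2.
Proof. by rewrite -lee_fin -Lnorm_lorentz Lnorm_ge0. Qed.

Lemma Lnorm2Z (a : R) (f : R -> R) : measurable_fun setT f ->
  ('N[mu]_2%:E[EFin \o f] < +oo)%E ->
  ('N[mu]_2%:E[EFin \o (fun x => a * f x)%R] = `|a|%:E * 'N[mu]_2%:E[EFin \o f])%E.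
Proof.
move=> mf fy.
have Lf : f \in Lfun mu 2%:E by rewrite inE; apply/andP; split; rewrite inE.
have p1 : (1 <= 2%:E :> \bar R)%E by rewrite lee_fin ler1n.
exact: (LnormZ (Lfun_Sub p1 Lf) a).
Qed.

Lemma japanese_powR_le1 x : s <= 0 -> japanese x `^ s <= 1.
Proof.
move=> s0; have j1 : 1 <= japanese x.
  by rewrite /japanese -{1}sqrtr1 ler_sqrt ?lerDl ?sqr_ge0// addr_ge0 ?sqr_ge0.
by rewrite -(powRr0 (japanese x)) ler_powR.
Qed.

(** Here [s <= 0] enters: the Sobolev weight is at most 1, so an [L^2] majorant is enough. *)
Lemma Lnorm_dominated (f : R -> C) (a : R) : s <= 0 -> cmeas f ->
  (forall x, nc (f x) <= a * lorentz x) ->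
  ('N[mu]_2%:E[EFin \o Hs_weighted s f] <= (a * lorentz_norm2)%:E)%E.
Proof.
move=> s0 [f1 f2] fa.
have a0 : 0 <= a.
  by have := le_trans (normr_ge0 _) (fa 0); rewrite pmulr_lge0// lorentz_gt0.
apply: le_trans (_ : _ <= 'N[mu]_2%:E[EFin \o (fun x => a * lorentz x)%R])%E _.
  apply: le_Lnorm2 => [||x].
  - exact: measurable_Hs_weighted.
  - by apply: measurable_funM => //; exact: measurable_lorentz.
  - rewrite ger0_norm ?Hs_weighted_ge0// ger0_norm ?mulr_ge0 ?(ltW (lorentz_gt0 _))//.
    by apply: le_trans (fa x); rewrite /Hs_weighted ler_piMl// japanese_powR_le1.
rewrite Lnorm2Z ?Lnorm_lorentz ?ltry//; last exact: measurable_lorentz.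
by rewrite ger0_norm// EFinM.
Qed.

Lemma is_Hs_dominated (f : R -> C) (a : R) : s <= 0 -> cmeas f ->
  (forall x, f (- x) = conjc (f x)) -> (forall x, nc (f x) <= a * lorentz x) -> is_Hs s f.
Proof.
move=> s0 mf hf fa; have [f1 f2] := mf; split => //.
by apply: le_lt_trans (Lnorm_dominated s0 mf fa) _; rewrite ltry.
Qed.

Lemma Hs_norm_dominated (f : R -> C) (a : R) : s <= 0 -> cmeas f -> is_Hs s f ->
  (forall x, nc (f x) <= a * lorentz x) -> Hs_norm s f <= a * lorentz_norm2.
Proof.
by move=> s0 mf Hf fa; rewrite -lee_fin Hs_normE//; exact: Lnorm_dominated.
Qed.

Lemma Lnorm_indic (p q : R) : p <= q ->
  ('N[mu]_2%:E[EFin \o (fun x => (p <= x <= q)%R%:R)] = (Num.sqrt (q - p))%:E)%E.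
Proof.
move=> pq; rewrite unlock.
have [i1 i2] := Rint_itv pq.
have -> : (\int[mu]_x (`|(EFin \o (fun x : R => (p <= x <= q)%R%:R)) x| `^ 2) = (q - p)%:E)%E.
  rewrite -i2 /Rintegral fineK; last exact: integrable_fin_num.
  apply: eq_integral => x _ /=; case: (_ <= _ <= _) => /=.
    by rewrite normr1 powR1.
  by rewrite normr0 powR0.
by rewrite poweR_EFin powR12_sqrt ?subr_ge0.
Qed.

(** On the whole line the weighted modulus dominates [k] times the indicator of [[p, q]], whose
    [L^2] norm is explicit. *)
Lemma Hs_norm_ge (f : R -> C) (p q k : R) : is_Hs s f -> p <= q -> 0 <= k ->
  (forall x, p <= x <= q -> k <= Hs_weighted s f x) ->
  k * Num.sqrt (q - p) <= Hs_norm s f.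
Proof.
move=> Hf pq k0 fk; have [f1 f2 _ _] := Hf.
have mi : measurable_fun setT (fun x : R => (p <= x <= q)%R%:R : R).
  by apply: measurable_boolR; apply: measurable_and; apply: measurable_fun_ler.
rewrite -lee_fin Hs_normE// EFinM -Lnorm_indic// -{1}(ger0_norm k0) -Lnorm2Z//; last first.
  by rewrite Lnorm_indic// ltry.
apply: le_Lnorm2 => [||x].
- exact: measurable_funM.
- exact: measurable_Hs_weighted.
- rewrite [leRHS]ger0_norm ?Hs_weighted_ge0// ger0_norm ?mulr_ge0//.
  by case: (boolP (p <= x <= q)) => [/fk|_]; rewrite ?mulr1// mulr0 Hs_weighted_ge0.
Qed.

End SobolevNorms.

#[local] Existing Instance ae_filter_lebesgue.

Section HsClasses.
Context {R : realType} {s : R}.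
Local Notation C := (Rcomplex R).

Definition mkHs (f : R -> C) (H : is_Hs s f) : HsFun s := MkHsFun (introT (Hs_predP s f) H).

Lemma Hs_classB (f g : HsFun s) : Hs_class (f - g) = Hs_class f - Hs_class g.
Proof. by apply/eqP; rewrite eq_sym subr_eq -Hs_classD subrK. Qed.

Lemma Hs_class_scale (a : R) (f : HsFun s) : Hs_class (a *: f) = a *: Hs_class f.
Proof. exact: Hs_classZ. Qed.

Lemma Hs_class_norm (f : HsFun s) : `|Hs_class f| = Hs_norm s f.
Proof. exact: Hs_normQ_class. Qed.

Lemma cmeas_hsfun (f : HsFun s) : cmeas f.
Proof. by have [? ? _ _] := hsfun_is_Hs f. Qed.

End HsClasses.

(** * Convergence of the truncated Duhamel integrals *)

Section Truncation.
Context {R : realType} (T : R) (T0 : 0 < T).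
Local Notation C := (Rcomplex R).
Local Notation nc z := (@Num.norm R _ (z : C)).
Local Notation mu := (@lebesgue_measure R).

Definition cutf (m : R -> R) (f : R -> R -> C) (t x : R) : C := m x *: f t x.

Lemma cutf_fam (m : R -> R) (M a : R) f : measurable_fun setT m -> (forall x, `|m x| <= M) ->
  fam T a f -> fam T (M * a) (cutf m f).
Proof.
move=> mm mM [mf fa]; split.
  apply: cmeasZ => //; apply: (measurableT_comp (f := m) (g := fun p : R * R => p.2)) => //.
  by meas.
by move=> t x; rewrite normCZ -mulrA ler_pM.
Qed.

Lemma Dh_scale (c beta : R) f g a b t x : fam T a f -> fam T b g -> `|t| <= T ->
  duhamel beta t (fun r x => c *: ddx (prod_hat (f r) (g r)) x) x = c *: Dh T beta f g t x.
Proof.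
move=> fa gb tT; rewrite (Dh_in _ _ _ _ tT) /duhamel cint0E cscaleE.
rewrite -(cintM _ (dint_dom T0 beta x fa gb tT)); apply: eq_cint => r _.
rewrite /dint /airy; move: (ddx _ x) (Complex (cos _) _ : C) => z w.
rewrite !cscaleE; by case: z w => [? ?] [? ?]; apply: ceqP => /=; ring.
Qed.

Lemma schwartz_measurable (psi : R -> R) : schwartz psi -> measurable_fun setT psi.
Proof.
move=> [d _]; apply: continuous_measurable_fun => x.
by apply: differentiable_continuous; apply/derivable1_diffP; exact: (d 0%N).
Qed.

Lemma schwartz_bounded (psi : R -> R) : schwartz psi ->
  exists2 M, 0 <= M & forall x, `|psi x| <= M.
Proof.
move=> [_ /(_ 0%N 0%N)[M h]]; exists M.
  exact: le_trans (normr_ge0 _) (h 0).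
by move=> x; have := h x; rewrite expr0 mul1r.
Qed.

(** For families of the iteration space the weak formulation reduces to the exact identity
    [z = c Dh f g]: the cutoffs are uniformly bounded and tend to 1, so the truncated integrals
    converge pointwise in frequency under a common integrable majorant, and the pairing with the
    bounded [psi] passes to the limit. The scalar [c] is 1/2 for [v v_x] and 1 for [(u v)_x]. *)
Lemma is_duhamelP (s c beta t a b : R) N (w : R -> Hs s * Hs s) (z : R -> C) f g :
  `|t| <= T -> fam T a f -> fam T b g -> cmeas z ->
  {ae mu, forall x, z x = c *: Dh T beta f g t x} ->
  (forall (m : R -> R) (M : R), measurable_fun setT m -> (forall x, `|m x| <= M) -> forall r x,
     N (freq_cut m (hat (w r).1)) (freq_cut m (hat (w r).2)) x =
     c *: ddx (prod_hat (cutf m f r) (cutf m g r)) x) ->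
  is_duhamel beta t N w z.
Proof.
move=> tT fa gb mz zE NE m [mm _ [M hM] m1] psi spsi.
have [P P0 hP] := schwartz_bounded spsi; have mpsi := schwartz_measurable spsi.
have cf n := cutf_fam (mm n) (hM n) fa; have cg n := cutf_fam (mm n) (hM n) gb.
have E n x : duhamel beta t (fun r =>
    N (freq_cut (m n) (hat (w r).1)) (freq_cut (m n) (hat (w r).2))) x =
    c *: Dh T beta (cutf (m n) f) (cutf (m n) g) t x.
  have -> : (fun r => N (freq_cut (m n) (hat (w r).1)) (freq_cut (m n) (hat (w r).2))) =
      (fun r y => c *: ddx (prod_hat (cutf (m n) f r) (cutf (m n) g r)) y).
    by apply/funext => r; apply/funext => y; exact: NE (mm n) (hM n) r y.
  exact: Dh_scale (cf n) (cg n) tT.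
have -> : pairing z psi = cint setT (fun x => psi x *: (c *: Dh T beta f g t x)).
  have mD : cmeas (Dh T beta f g t) by exact: fam_cmeas (Dh_fam T0 beta fa gb).
  apply: cint_ae.
  - exact: cmeasZ.
  - by apply: cmeasZ => //; apply: cmeasZ => //; exact: measurable_cst.
  - by apply: filterS zE => x ->.
rewrite (_ : (fun n => _) = (fun n =>
  nc (cint setT (fun x => psi x *: (c *: Dh T beta (cutf (m n) f) (cutf (m n) g) t x)) -
      cint setT (fun x => psi x *: (c *: Dh T beta f g t x))))); last first.
  apply/funext => n; congr (nc (_ - _)); apply: eq_cint => x _.
  by rewrite E.
pose K := 16 * (@lorentz_mass R) * (M * a * (M * b)).
have Dn n : fam T K (Dh T beta (cutf (m n) f) (cutf (m n) g)) by exact: Dh_fam.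
have K0 : 0 <= K by exact: (fam_ge0 T0 (Dn 0%N)).
apply: (@cint_dct _ (fun x => (P * (`|c| * K)) * lorentz x)).
- move=> n; split.
  + apply: cmeasZ => //; apply: cmeasZ; first exact: measurable_cst.
    exact: fam_cmeas (Dn n).
  + exact/rintZ/rint_lorentz.
  + move=> x; rewrite !normCZ -(mulrA P) -(mulrA (`|c|)); apply: ler_pM; [exact: normr_ge0|exact: mulr_ge0|exact: hP|].
    rewrite ler_wpM2l//; apply: le_trans (fam_wtT T0 t x (Dn n)) _.
    by rewrite ler_wpM2l// wt_le_lorentz// ltW.
- apply: cmeasZ => //; apply: cmeasZ; first exact: measurable_cst.
  exact: fam_cmeas (Dh_fam T0 beta fa gb).
- move=> x; apply: ccvg_scale; first exact: cvg_cst.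
  apply: ccvg_scale; first exact: cvg_cst.
  (* [Num.max M 1] provides one bound for the truncated families and for their limits. *)
  have M0 : 1 <= Num.max M 1 by rewrite le_max lexx orbT.
  have w1 : fam T (Num.max M 1 * a) f.
    by apply: (famW _ fa); rewrite ler_peMl// (fam_ge0 T0 fa).
  have w2 : fam T (Num.max M 1 * b) g.
    by apply: (famW _ gb); rewrite ler_peMl// (fam_ge0 T0 gb).
  apply: (Dh_cvg T0 beta t x (a := Num.max M 1 * a) (b := Num.max M 1 * b)) => //.
  + by move=> n; apply: famW (cf n); rewrite ler_wpM2r ?(fam_ge0 T0 fa)// le_max lexx.
  + by move=> n; apply: famW (cg n); rewrite ler_wpM2r ?(fam_ge0 T0 gb)// le_max lexx.
  + move=> r y; rewrite /cutf -{2}(scale1r (f r y)); apply: ccvg_scale; [exact: m1|exact: ccvg_cst].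
  + move=> r y; rewrite /cutf -{2}(scale1r (g r y)); apply: ccvg_scale; [exact: m1|exact: ccvg_cst].
Qed.

End Truncation.

(** * The constructed pair as a solution curve in [H^s] *)

Section Solution.
Context {R : realType} (T : R) (T0 : 0 < T) (s : R) (s0 : s <= 0).
Local Notation C := (Rcomplex R).
Local Notation nc z := (@Num.norm R _ (z : C)).
Local Notation mu := (@lebesgue_measure R).

Context (alpha A : R) (u0 v0 : R -> C).
Hypotheses (mu0 : cmeas u0) (mv0 : cmeas v0).
Hypotheses (hu0 : forall x, u0 (- x) = conjc (u0 x)) (hv0 : forall x, v0 (- x) = conjc (v0 x)).
Hypotheses (bu0 : forall x, nc (u0 x) <= A * wt (2 * T) x).
Hypotheses (bv0 : forall x, nc (v0 x) <= A * wt (2 * T) x).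
Hypothesis smallA : 128 * (@lorentz_mass R) * A <= 1.
Hypotheses (Hu0 : is_Hs s u0) (Hv0 : is_Hs s v0).
Local Notation F1 := (sol1 T alpha u0 v0).
Local Notation F2 := (sol2 T alpha u0 v0).
Let f1 : fam T (2 * A) F1. Proof. exact: sol1_fam. Qed.
Let f2 : fam T (2 * A) F2. Proof. exact: sol2_fam. Qed.

Lemma fam_is_Hs a f t : fam T a f -> herm f -> is_Hs s (f t).
Proof.
move=> fa hf; apply: (is_Hs_dominated (a := a)) => //.
- exact: fam_cmeas fa.
- move=> x; apply: le_trans (fam_wtT T0 t x fa) _.
  by rewrite ler_wpM2l ?(fam_ge0 T0 fa)// wt_le_lorentz// ltW.
Qed.

Lemma sol1_is_Hs t : is_Hs s (F1 t).
Proof. apply: (fam_is_Hs _ f1); exact: (sol1_herm T0 alpha mu0 mv0 hu0 hv0 bu0 bv0 smallA). Qed.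

Lemma sol2_is_Hs t : is_Hs s (F2 t).
Proof. apply: (fam_is_Hs _ f2); exact: (sol2_herm T0 alpha mu0 mv0 hu0 hv0 bu0 bv0 smallA). Qed.

Definition mb_data : Hs s * Hs s := (Hs_class (mkHs Hu0), Hs_class (mkHs Hv0)).
Definition mb_curve (t : R) : Hs s * Hs s :=
  (Hs_class (mkHs (sol1_is_Hs t)), Hs_class (mkHs (sol2_is_Hs t))).

Lemma tlip_continuous f (H : forall t, is_Hs s (f t)) : (forall t, cmeas (f t)) -> tlip T f ->
  {within `[- T, T], continuous (fun t => Hs_class (mkHs (H t)))}.
Proof.
move=> mf [L L0 hL]; apply/subspace_continuousP => t0 /=; rewrite in_itv/= => t0T.
apply/cvgrPdist_le => e e0; rewrite near_withinE.
have LL : 0 < L * lorentz_norm2 + 1 :> R by rewrite ltr_wpDl// mulr_ge0// lorentz_norm2_ge0.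
near=> t => /=; rewrite in_itv/= => tT.
rewrite -Hs_classB Hs_class_norm.
have tn : `|t0 - t| <= e / (L * lorentz_norm2 + 1).
  near: t; apply: cvgr_dist_le; [exact: cvg_id|exact: divr_gt0].
apply: (@le_trans _ _ (L * `|t0 - t| * lorentz_norm2)).
  apply: Hs_norm_dominated => //; first exact: cmeas_hsfun.
    exact: hsfun_is_Hs.
  by move=> x; apply: hL; rewrite ler_norml.
rewrite mulrAC; apply: (@le_trans _ _ ((L * lorentz_norm2 + 1) * `|t0 - t|)).
  by rewrite ler_wpM2r// lerDl.
by rewrite mulrC -ler_pdivlMr.
Unshelve. all: by end_near.
Qed.

Lemma sol1_lip : tlip T F1.
Proof.
have A0 := A_ge0 T0 mu0 bu0.
apply: (tlipB (lin_lip T0 1 A0 bu0) (tlip_half (Dh_lip T0 1 f2 f2))).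
exact: sol1E.
Qed.

Lemma sol2_lip : tlip T F2.
Proof.
have A0 := A_ge0 T0 mu0 bu0.
apply: (tlipB (lin_lip T0 alpha A0 bv0) (Dh_lip T0 alpha f1 f2)).
exact: sol2E.
Qed.

Lemma hat_curve1 r : {ae mu, forall x, hat (mb_curve r).1 x = F1 r x}.
Proof. exact: hat_class. Qed.

Lemma hat_curve2 r : {ae mu, forall x, hat (mb_curve r).2 x = F2 r x}.
Proof. exact: hat_class. Qed.

Lemma cmeas_freq_cut m (f : R -> C) : measurable_fun setT m -> cmeas f -> cmeas (freq_cut m f).
Proof. by move=> mm mf; exact: cmeasZ. Qed.

(** Continuity comes from the Lipschitz bounds and the two equations from [is_duhamelP];
    representatives are exchanged for [sol1] and [sol2] almost everywhere before any convolution is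
    compared. *)
Lemma sol_MB : MB_solution alpha T mb_data mb_curve.
Proof.
split.
  have c1 := tlip_continuous (H := sol1_is_Hs) (fun t => fam_cmeas t f1) sol1_lip.
  have c2 := tlip_continuous (H := sol2_is_Hs) (fun t => fam_cmeas t f2) sol2_lip.
  by move=> t; exact: (cvg_pair (c1 t) (c2 t)).
move=> t tT; have nT : `|t| <= T by rewrite ler_norml.
have airyE beta (u : R -> C) x : airy beta t u x = lin T beta u t x by rewrite /lin nT.
have mairy beta (h : HsFun s) : cmeas (airy beta t h).
  apply: cmeasM; last exact: cmeas_hsfun.
  by apply: (@measurable_cis R _ _ (fun x : R => beta * t * x ^+ 3)); meas.
split.
  apply: (is_duhamelP T0 (c := 2^-1) nT f2 f2).
  - by apply: cmeasB; [exact: mairy|exact: cmeas_hsfun].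
  - have hu : {ae mu, forall x, hat mb_data.1 x = u0 x} by exact: hat_class.
    move: hu (hat_curve1 t); apply: filterS2.
    move=> x h1 h2; rewrite h2 /airy h1 -/(airy 1 t u0 x) airyE.
    by rewrite (sol1E T0 alpha mu0 mv0 bu0 bv0 smallA) subKr.
  - move=> m M mm mM r x; rewrite /nonlin_u.
    have cf := cutf_fam mm mM f2.
    (* The truncation acts on each factor, so the identity for half the derivative of a square still
       applies to the truncated function. *)
    rewrite -(prod_hat_ddx x T0 (fam_cmeas r cf) (fun y => fam_wtT T0 r y cf)).
    have mh : cmeas (freq_cut m (hat (mb_curve r).2)).
      by apply: cmeas_freq_cut => //; exact: cmeas_hsfun.
    have ae1 : {ae mu, forall y, freq_cut m (hat (mb_curve r).2) y = cutf m F2 r y}.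
      by apply: filterS (hat_curve2 r) => y h; rewrite /freq_cut h.
    apply: prod_hat_ae => //; first exact: fam_cmeas cf.
    + exact: cmeas_ddx.
    + by apply: cmeas_ddx; exact: fam_cmeas cf.
    + by apply: filterS ae1 => y h; rewrite /ddx h.
apply: (is_duhamelP T0 (c := 1) nT f1 f2).
- by apply: cmeasB; [exact: mairy|exact: cmeas_hsfun].
- have hv : {ae mu, forall x, hat mb_data.2 x = v0 x} by exact: hat_class.
  move: hv (hat_curve2 t); apply: filterS2.
  move=> x h1 h2; rewrite h2 /airy h1 -/(airy alpha t v0 x) airyE.
  by rewrite (sol2E T0 alpha mu0 mv0 bu0 bv0 smallA) subKr scale1r.
- move=> m M mm mM r x; rewrite /nonlin_v scale1r /ddx; congr (_ * _).
  have mh (h : HsFun s) : cmeas (freq_cut m h).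
    by apply: cmeas_freq_cut => //; exact: cmeas_hsfun.
  apply: prod_hat_ae => //.
  + exact: fam_cmeas (cutf_fam mm mM f1).
  + exact: fam_cmeas (cutf_fam mm mM f2).
  + by apply: filterS (hat_curve1 r) => y h; rewrite /freq_cut h.
  + by apply: filterS (hat_curve2 r) => y h; rewrite /freq_cut h.
Qed.

End Solution.

(** * Second differences of the flow *)

Section SecondDifference.
Context {R : realType}.

(** A supremum argument valid for vector values. With slope [K' = K + e / b], the set of points
    where the bound holds contains its supremum, and the local estimate there would carry it further
    if the supremum were below [b]. *)
Lemma mean_value_le (V : normedModType R) (phi : R -> V) (b K : R) : 0 <= b ->
  (forall x, 0 <= x <= b -> forall e, 0 < e -> exists2 r : R, 0 < r &
     forall y, `|y - x| < r -> `|phi y - phi x| <= (K + e) * `|y - x|) ->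
  `|phi b - phi 0| <= K * b.
Proof.
move=> b0 loc; apply/ler_addgt0Pr => e e0.
have [->|bn0] := eqVneq b 0; first by rewrite subrr normr0 mulr0 add0r ltW.
have bgt0 : 0 < b by rewrite lt_def bn0.
pose K' := K + e / b.
have eb : 0 < e / b by rewrite divr_gt0.
rewrite (_ : K * b + e = K' * b); last by rewrite mulrDl divfK.
pose S := [set x | 0 <= x <= b /\ `|phi x - phi 0| <= K' * x].
have S0 : S 0 by split; rewrite ?lexx ?b0// subrr normr0 mulr0.
have ubS : ubound S b by move=> x [/andP[]].
have hsS : has_sup S by split; [exists 0|exists b].
pose c := sup S.
have c0 : 0 <= c by exact: sup_upper_bound hsS _ S0.
have cb : c <= b by apply: ge_sup => //; exists 0.
have cin : 0 <= c <= b by rewrite c0 cb.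
have [r r0 hr] := loc c cin _ eb.
have Sc : S c.
  split => //; have [x Sx cx] := sup_adherent r0 hsS; have [x0b hx] := Sx.
  have xc : x <= c by exact: sup_upper_bound.
  have xcr : `|x - c| < r by rewrite distrC ger0_norm ?subr_ge0// ltrBlDl -ltrBlDr.
  have h := hr _ xcr; rewrite distrC (distrC x) (ger0_norm (_ : 0 <= c - x)) ?subr_ge0// in h.
  rewrite -(subrKA (phi x)); apply: le_trans (ler_normD _ _) _.
  by apply: le_trans (lerD h hx) _; rewrite -/K' -mulrDr subrK.
have [<-|ncb] := eqVneq c b; first by have [] := Sc.
have cltb : c < b by rewrite lt_neqAle ncb.
pose y := Num.min b (c + r / 2).
have cy : c < y by rewrite lt_min cltb ltrDl divr_gt0.
have ycr : `|y - c| < r.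
  rewrite gtr0_norm ?subr_gt0// ltrBlDl (le_lt_trans (_ : _ <= c + r / 2))//.
    by rewrite ge_min lexx orbT.
  by rewrite ltrD2l ltr_pdivrMr// ltr_pMr// ltr1n.
have Sy : S y.
  split; first by rewrite (le_trans c0 (ltW cy)) ge_min lexx.
  have [_ hc] := Sc; have h := hr _ ycr; rewrite (ger0_norm (_ : 0 <= y - c)) ?subr_ge0 ?(ltW cy)// in h.
  rewrite -(subrKA (phi c)); apply: le_trans (ler_normD _ _) _.
  by apply: le_trans (lerD h hc) _; rewrite -/K' -mulrDr subrK.
by have := sup_upper_bound hsS Sy; rewrite leNgt cy.
Qed.

(** Differentiability along the line through [d], in the local form that [mean_value_le]
    consumes. *)
Lemma differentiable_slope (V W : normedModType R) (f : V -> W) (d : V) (x : R) :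
  differentiable f (x *: d) -> forall e, 0 < e -> exists2 r : R, 0 < r &
  forall y, `|y - x| < r ->
    `|f (y *: d) - f (x *: d) - (y - x) *: 'd f (x *: d) d| <= e * `|y - x|.
Proof.
move=> df e e0.
have : (fun h : R => h^-1 *: ((f \o shift (x *: d)) (h *: d) - f (x *: d))) @ 0^' -->
    'd f (x *: d) d 
    by have dd : derivable f (x *: d) d := diff_derivable df; rewrite -(deriveE _ df); exact: dd.
move=> /cvgrPdist_le /(_ e e0).
rewrite near_withinE near_simpl => /nbhs_ballP[r /= r0 hr]; exists r => // y yx.
have [->|yx0] := eqVneq y x.
  by rewrite !subrr scale0r subr0 !normr0 mulr0.
have h0 : y - x != 0 by rewrite subr_eq0.
have := hr (y - x); rewrite -ball_normE/= sub0r normrN => /(_ yx h0).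
rewrite -scalerDl subrK => h.
have hn : 0 < `|y - x| by rewrite normr_gt0.
rewrite -ler_pdivrMr// mulrC -normfV -normrZ scalerBr scalerA mulVf// scale1r.
by rewrite distrC.
Qed.

(** The even function [phi y = f (y d) + f (- y d)] has derivative [Df(y d) d - Df(- y d) d], of
    size at most a constant times [y |d|^2] near 0, and the mean value inequality gives one more
    power of [x]. The radius [r] depends on [d], but [M] does not. *)
Lemma C2_quadratic (V W : normedModType R) (U : set V) (f : V -> W) :
  open U -> U 0 -> C2_on U f -> exists2 M : R, 0 <= M &
  forall d, exists2 r : R, 0 < r & forall x, 0 <= x <= r ->
    `|f (x *: d) + f (- (x *: d)) - 2 *: f 0| <= M * `|d| ^+ 2 * x ^+ 2.
Proof.
move=> oU U0 [df [B [HB dB _]]].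
have [linB _ [M0 hM0]] := HB _ U0.
pose M := Num.max M0 0; have M1 : 0 <= M by rewrite le_max lexx orbT.
have hM h k : `|B 0 h k| <= M * `|h| * `|k|.
  by apply: le_trans (hM0 h k) _; rewrite -!mulrA ler_wpM2r ?mulr_ge0// le_max lexx.
exists (2 * (M + 1)); first by rewrite mulr_ge0// addr_ge0.
move=> d.
have /nbhs_ballP[r1 /= r10 hr1] := open_nbhs_nbhs (conj oU U0).
(* The differentiability of [Df] at 0 with error 1: near 0 it makes [Df(u) - Df(0)] at most
   [(M + 1) |u|] in operator norm. *)
have /nbhs_ballP[r2 /= r20 hr2] := dB _ U0 1 ltr01.
pose r := Num.min r1 r2 / (`|d| + 1).
have d1 : 0 < `|d| + 1 by rewrite ltr_wpDl.
have r0 : 0 < r by rewrite divr_gt0// lt_min r10.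
have small x : `|x| < r -> `|x *: d| < r1 /\ `|x *: d| < r2.
  rewrite ltr_pdivlMr// => xr; apply/andP; rewrite -lt_min; apply: le_lt_trans xr.
  by rewrite normrZ ler_wpM2l// lerDl.
exists (r / 2); first by rewrite divr_gt0.
move=> x /andP[x0 xr].
have xlt y : 0 <= y <= x -> `|y| < r.
  move=> /andP[y0 yx]; rewrite ger0_norm// (le_lt_trans yx)// (le_lt_trans xr)//.
  by rewrite ltr_pdivrMr// ltr_pMr// ltr1n.
pose phi y := f (y *: d) + f (y *: (- d)).
have step (y : R) : 0 <= y <= x -> forall e : R, 0 < e -> exists2 r : R, 0 < r &
    forall z, `|z - y| < r -> `|phi z - phi y| <= (2 * (M + 1) * `|d| ^+ 2 * x + e) * `|z - y|.
  move=> yx e e0; have [y1 y2] := small _ (xlt _ yx).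
  have Ud : U (y *: d) by apply: hr1; rewrite -ball_normE/= sub0r normrN.
  have Ud' : U (y *: (- d)) by apply: hr1; rewrite -ball_normE/= sub0r normrN scalerN normrN.
  have e2 : 0 < e / 2 by rewrite divr_gt0.
  have [ra ra0 ha] := differentiable_slope (df _ Ud) e2.
  have [rb rb0 hb] := differentiable_slope (df _ Ud') e2.
  exists (Num.min ra rb); first by rewrite lt_min ra0.
  move=> z; rewrite lt_min => /andP[za zb].
  have E : phi z - phi y =
      (f (z *: d) - f (y *: d) - (z - y) *: 'd f (y *: d) d) +
      (f (z *: - d) - f (y *: - d) - (z - y) *: 'd f (y *: - d) (- d)) +
      (z - y) *: ('d f (y *: d) d + 'd f (y *: - d) (- d)).
    rewrite scalerDr /phi opprD.
    have regroup (p q p' q' u u' : W) : p + q + (- p' - q') = (p - p' - u) + (q - q' - u') + (u + u').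
      by rewrite [X in _ = X + _]addrACA -[X in _ = _ + X + _]opprD subrK addrACA.
    exact: regroup.
  rewrite E; apply: le_trans (ler_normD _ _) _.
  rewrite mulrDl addrC; apply: lerD; last first.
    apply: le_trans (ler_normD _ _) _.
    apply: le_trans (lerD (ha _ za) (hb _ zb)) _.
    by rewrite -mulrDl -splitr.
  rewrite normrZ mulrC ler_wpM2r//.
  have nb : forall u : V, `|u| < r2 -> `|'d f u d - 'd f 0 d| <= (M + 1) * `|u| * `|d|.
    move=> u ur; have := hr2 u; rewrite -ball_normE/= sub0r normrN => /(_ ur d).
    rewrite subr0 => h; rewrite -[X in `|X|](subrK (B 0 u d)).
    apply: le_trans (ler_normD _ _) _; apply: le_trans (lerD h (hM _ _)) _.
    by rewrite -!mulrDl addrC.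
  have -> : 'd f (y *: d) d + 'd f (y *: - d) (- d) =
      ('d f (y *: d) d - 'd f 0 d) - ('d f (y *: - d) d - 'd f 0 d).
    by rewrite linearN/= opprB addrA subrK.
  apply: le_trans (ler_normB _ _) _.
  have y2' : `|y *: - d| < r2 by rewrite scalerN normrN.
  apply: le_trans (lerD (nb _ y2) (nb _ y2')) _.
  rewrite scalerN normrN normrZ.
  have /andP[y0 yx'] := yx.
  rewrite (ger0_norm y0).
  rewrite (_ : _ + _ = (2 * (M + 1) * `|d| ^+ 2) * y); last by ring.
  by rewrite ler_wpM2l// !mulr_ge0// addr_ge0.
have := mean_value_le x0 step.
rewrite /phi !scale0r scalerN (_ : f 0 + f 0 = 2 *: f 0); last by rewrite scaler_nat.
by rewrite -mulrA -expr2.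
Qed.

End SecondDifference.

(** * Expansion of the flow along multiples of fixed data *)

Section Expansion.
Context {R : realType} (T : R) (T0 : 0 < T) (s : R) (s0 : s <= 0).
Local Notation C := (Rcomplex R).
Local Notation nc z := (@Num.norm R _ (z : C)).
Context (alpha B : R) (u v : R -> C).
Hypotheses (mu' : cmeas u) (mv : cmeas v).
Hypotheses (hu : forall x, u (- x) = conjc (u x)) (hv : forall x, v (- x) = conjc (v x)).
Hypotheses (bu : forall x, nc (u x) <= B * wt (2 * T) x).
Hypotheses (bv : forall x, nc (v x) <= B * wt (2 * T) x).
Hypotheses (Hu : is_Hs s u) (Hv : is_Hs s v).
Local Notation l1 := (lin T 1 u).
Local Notation l2 := (lin T alpha v).

Lemma lin2_is_Hs t : is_Hs s (l2 t).
Proof. by apply: (fam_is_Hs T0 s0 _ (lin_fam alpha mv bv)); exact: lin_herm. Qed.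

Lemma bilinear_fam : fam T (16 * (@lorentz_mass R) * (B * B)) (Dh T alpha l1 l2).
Proof. exact: (Dh_fam T0 alpha (lin_fam 1 mu' bu) (lin_fam alpha mv bv)). Qed.

Lemma bilinear_is_Hs t : is_Hs s (Dh T alpha l1 l2 t).
Proof.
apply: (fam_is_Hs T0 s0 _ bilinear_fam).
by apply: (Dh_herm T0 alpha (lin_fam 1 mu' bu) (lin_fam alpha mv bv)); exact: lin_herm.
Qed.

Lemma linZ beta (k : R) (f : R -> C) : lin T beta (fun x => k *: f x) = fun t x => k *: lin T beta f t x.
Proof.
apply/funext => t; apply/funext => x; rewrite /lin; case: (`|t| <= T); last by rewrite scaler0.
by rewrite /airy; case: (f x) => ? ?; apply: ceqP => /=; ring.
Qed.

(** For small [k] the data [k d] lie in [U] and are small enough for the iteration, so uniqueness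
    identifies [Phi t (k d)] with the constructed solution, to which [sol_expand] applies with
    [A = |k| B]. *)
Lemma Phi_expand (U : set (Hs s * Hs s)) (Phi : R -> Hs s * Hs s -> Hs s * Hs s) (t : R) :
  MB_wellposed alpha T U Phi -> `|t| <= T ->
  exists2 r : R, 0 < r & forall k : R, `|k| < r ->
    `|(Phi t (k *: (mb_data Hu Hv))).2 - (k *: Hs_class (mkHs (lin2_is_Hs t)) -
       k ^+ 2 *: Hs_class (mkHs (bilinear_is_Hs t)))| <=
    (4096 * (@lorentz_mass R) ^+ 2 * B ^+ 3 * lorentz_norm2) * `|k| ^+ 3.
Proof.
move=> [_ oU U0 sol _] tT; set d := mb_data Hu Hv.
have i0 := lorentz_mass_ge0 (R := R).
have B0 : 0 <= B by exact: (A_ge0 T0 mu' bu).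
have /nbhs_ballP[r1 /= r10 hr1] := open_nbhs_nbhs (conj oU U0).
have d1 : 0 < `|d| + 1 by rewrite ltr_wpDl.
have q1 : 0 < 128 * (@lorentz_mass R) * B + 1 by rewrite ltr_wpDl// !mulr_ge0.
(* The first bound keeps [k d] inside [U], the second ensures the smallness condition for [|k| B];
   the summands 1 avoid division by 0. *)
exists (Num.min (r1 / (`|d| + 1)) (1 / (128 * (@lorentz_mass R) * B + 1))).
  by rewrite lt_min !divr_gt0.
move=> k; rewrite lt_min !ltr_pdivlMr// => /andP[k1 k2].
have Ud : U (k *: d).
  apply: hr1; rewrite -ball_normE/= sub0r normrN normrZ.
  by apply: le_lt_trans k1; rewrite ler_wpM2l// lerDl.
pose uk x := k *: u x; pose vk x := k *: v x.
have Huk : is_Hs s uk by exact: (hsfun_is_Hs (k *: mkHs Hu)).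
have Hvk : is_Hs s vk by exact: (hsfun_is_Hs (k *: mkHs Hv)).
have muk : cmeas uk by apply: cmeasZ => //; exact: measurable_cst.
have mvk : cmeas vk by apply: cmeasZ => //; exact: measurable_cst.
have hk (f : R -> C) : (forall x, f (- x) = conjc (f x)) ->
    forall x, k *: f (- x) = conjc (k *: f x).
  by move=> hf x; rewrite hf; case: (f x) => ? ?; apply: ceqP => /=; ring.
have bk (f : R -> C) : (forall x, nc (f x) <= B * wt (2 * T) x) ->
    forall x, nc (k *: f x) <= (`|k| * B) * wt (2 * T) x.
  by move=> bf x; rewrite normCZ -mulrA ler_wpM2l.
have small : 128 * (@lorentz_mass R) * (`|k| * B) <= 1.
  apply: le_trans (ltW k2); rewrite mulrDr mulr1.
  rewrite (_ : 128 * _ * _ = `|k| * (128 * (@lorentz_mass R) * B)); last by ring.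
  by rewrite lerDl.
have S := sol_MB T0 s0 alpha muk mvk (hk _ hu) (hk _ hv) (bk _ bu) (bk _ bv) small Huk Hvk.
have E : mb_data Huk Hvk = k *: d.
  rewrite /mb_data /d; congr pair; rewrite -Hs_class_scale; apply/Hs_classP; exact: aeW.
rewrite E in S.
have [_ /(_ _ S t)] := sol _ Ud.
rewrite -ler_norml => /(_ tT) <-.
rewrite -!Hs_class_scale -!Hs_classB Hs_class_norm.
rewrite -(mulrAC _ (`|k| ^+ 3)).
apply: (Hs_norm_dominated s0 (cmeas_hsfun _) (hsfun_is_Hs _)) => x.
suff : nc (sol2 T alpha uk vk t x - (k *: l2 t x - k ^+ 2 *: Dh T alpha l1 l2 t x)) <=
  4096 * (@lorentz_mass R) ^+ 2 * B ^+ 3 * `|k| ^+ 3 * lorentz x by [].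
have X := sol_expand T0 alpha muk mvk (bk _ bu) (bk _ bv) small t x.
have L1 := lin_fam 1 mu' bu; have L2 := lin_fam alpha mv bv.
rewrite !linZ (DhZ T0 alpha k t x L1 L2) in X.
apply: (le_trans X).
rewrite exprMn (_ : _ * (_ * B ^+ 3) = 4096 * (@lorentz_mass R) ^+ 2 * B ^+ 3 * `|k| ^+ 3); last by ring.
have c0 : 0 <= 4096 * (@lorentz_mass R) ^+ 2 * B ^+ 3 * `|k| ^+ 3.
  apply: mulr_ge0; [apply: mulr_ge0; [apply: mulr_ge0|]|]; [exact: ler0n|exact: exprn_ge0|exact: exprn_ge0|exact: exprn_ge0].
apply: (ler_wpM2l c0).
by apply: le_trans (Wt_le _ t x) _; rewrite wt_le_lorentz// ltW.
Qed.

End Expansion.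

(** * The quadratic estimate forced by a flow of class [C^2] *)

Section SecondOrderBound.
Context {R : realType} (T : R) (T0 : 0 < T) (s : R) (s0 : s <= 0) (alpha : R).
Local Notation C := (Rcomplex R).
Local Notation nc z := (@Num.norm R _ (z : C)).

(** [M] is fixed before the data. The remainder constant depends on [B], but it multiplies a cube
    and disappears when the second difference is divided by the square of the step. Hence the bound
    sees only the Sobolev size [K]. *)
Lemma C2_bilinear_bound (U : set (Hs s * Hs s)) (Phi : R -> Hs s * Hs s -> Hs s * Hs s) (t : R) :
  MB_wellposed alpha T U Phi -> `|t| <= T -> C2_on U (Phi t) ->
  exists2 M : R, 0 <= M & forall (B K : R) (u v : R -> C),
    cmeas u -> cmeas v ->
    (forall x, u (- x) = conjc (u x)) -> (forall x, v (- x) = conjc (v x)) ->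
    (forall x, nc (u x) <= B * wt (2 * T) x) -> (forall x, nc (v x) <= B * wt (2 * T) x) ->
    is_Hs s u -> is_Hs s v -> Hs_norm s u <= K -> Hs_norm s v <= K ->
    Hs_norm s (Dh T alpha (lin T 1 u) (lin T alpha v) t) <= M * K ^+ 2.
Proof.
move=> wp tT c2; have [_ oU U0 _ _] := wp.
have [M M0 hM] := C2_quadratic oU U0 c2; exists M => //.
move=> B K u v mu' mv hu hv bu bv Hu Hv uK vK.
set d := mb_data Hu Hv.
have B0 : 0 <= B by exact: (A_ge0 T0 mu' bu).
have dK : `|d| <= K.
  rewrite /Num.norm/= ge_max; apply/andP; split.
    by have := Hs_class_norm (mkHs Hu) => ->.
  by have := Hs_class_norm (mkHs Hv) => ->.
have K0 : 0 <= K by exact: le_trans (normr_ge0 d) dK.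
set L := Hs_class (mkHs (lin2_is_Hs T0 s0 alpha mv hv bv t)).
set Q := Hs_class (mkHs (bilinear_is_Hs T0 s0 alpha mu' mv hu hv bu bv t)).
have [r1 r10 h1] := Phi_expand T0 s0 mu' mv hu hv bu bv Hu Hv wp tT.
rewrite -/d -/L -/Q in h1.
set k := _ * lorentz_norm2 in h1.
have [r2 r20 h2] := hM d.
have k0 : 0 <= k.
  apply: mulr_ge0; last exact: lorentz_norm2_ge0.
  apply: mulr_ge0; [apply: mulr_ge0|]; [exact: ler0n|exact/exprn_ge0/lorentz_mass_ge0|exact: exprn_ge0].
have -> : Hs_norm s (Dh T alpha (lin T 1 u) (lin T alpha v) t) = `|Q|.
  by rewrite /Q Hs_class_norm.
(* The expansion at [k = 0] already contains the vanishing of the flow at the origin. *)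
have z0 : (Phi t 0).2 = 0.
  have := h1 0; rewrite normr0 => /(_ r10); rewrite !scale0r expr0n/= !expr0n/= scale0r subr0 mulr0 subr0.
  by rewrite normr_le0 => /eqP.
apply/ler_addgt0Pr => e e0.
(* The step is within the range of the expansion, within that of the second-difference bound, and
   small enough to make the cubic remainder at most [e] after division. *)
pose x := Num.min (r1 / 2) (Num.min r2 (e / (k + 1))).
have k1 : 0 < k + 1 by rewrite ltr_wpDl.
have x0 : 0 < x by rewrite !lt_min r20 !divr_gt0.
have xr1 : `|x| < r1.
  rewrite gtr0_norm// (le_lt_trans (_ : _ <= r1 / 2))//; first by rewrite ge_min lexx.
  by rewrite ltr_pdivrMr// ltr_pMr// ltr1n.
have xr2 : 0 <= x <= r2 by rewrite ltW//= !ge_min lexx orbT.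
have xe : k * x <= e.
  have : x <= e / (k + 1) by rewrite !ge_min lexx !orbT.
  rewrite ler_pdivlMr// => h; apply: le_trans h.
  by rewrite mulrC ler_wpM2l ?(ltW x0)// lerDl.
have p := h1 x xr1; have m := h1 (- x); rewrite normrN in m; have {}m := m xr1.
have q : `|(Phi t (x *: d) + Phi t (- (x *: d)) - 2 *: Phi t 0).2| <= M * `|d| ^+ 2 * x ^+ 2.
  by apply: le_trans (h2 x xr2); rewrite [leRHS]/Num.norm/= le_max lexx orbT.
move: q; rewrite /= z0 scaler0 subr0 => q.
(* Adding the expansions at [x d] and [- x d] cancels the linear term and leaves [- 2 x^2 Q] up to
   two cubic remainders. *)
have E : 2 * x ^+ 2 * `|Q| <= M * `|d| ^+ 2 * x ^+ 2 + 2 * k * x ^+ 3.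
  have regroup (P P' X Y : Hs s) : Y + Y = (P - (X - Y)) + (P' - (- X - Y)) - (P + P').
    rewrite [X in _ = X - _]addrACA [RHS]addrAC subrr add0r !opprB opprK.
    by rewrite addrACA addNr addr0.
  have QQ : 2 * x ^+ 2 * `|Q| = `|x ^+ 2 *: Q + x ^+ 2 *: Q|.
    rewrite -scalerDl normrZ ger0_norm ?addr_ge0 ?sqr_ge0//.
    by congr (_ * _); ring.
  rewrite QQ (regroup (Phi t (x *: d)).2 (Phi t (- (x *: d))).2 (x *: L)).
  move: m; rewrite !scaleNr sqrrN => m.
  apply: le_trans (ler_normB _ _) _; rewrite addrC; apply: lerD => //.
  apply: le_trans (ler_normD _ _) _; apply: le_trans (lerD p m) _.
  by rewrite (gtr0_norm x0) le_eqVlt; apply/orP; left; apply/eqP; ring.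
have x2 : 0 < x ^+ 2 by rewrite exprn_gt0.
rewrite -(ler_pM2l (_ : 0 < 2 * x ^+ 2)) ?mulr_gt0//; apply: (le_trans E).
have MK : M * `|d| ^+ 2 <= M * K ^+ 2.
  by rewrite ler_wpM2l// ler_pXn2r// nnegrE.
have MK0 : 0 <= M * K ^+ 2 by rewrite mulr_ge0// exprn_ge0.
rewrite -subr_ge0.
rewrite (_ : _ - _ = x ^+ 2 * (M * K ^+ 2 + (M * K ^+ 2 - M * `|d| ^+ 2) + 2 * (e - k * x))); last by ring.
apply: mulr_ge0 (ltW x2) _; apply: addr_ge0; first by apply: addr_ge0 => //; rewrite subr_ge0.
by apply: mulr_ge0 => //; rewrite subr_ge0.
Qed.

End SecondOrderBound.

(** * Resonant data *)

Section Box.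
Context {R : realType}.
Local Notation C := (Rcomplex R).
Local Notation nc z := (@Num.norm R _ (z : C)).
Local Notation mu := (@lebesgue_measure R).

(** Depending only on [|x|] and real, it is the Fourier transform of a real-valued function. *)
Definition box (a g x : R) : C := Complex ((`| `|x| - a| <= g)%R%:R) 0.

Lemma norm_box a g x : nc (box a g x) = (`| `|x| - a| <= g)%R%:R.
Proof. by rewrite normCE /= expr0n addr0 sqrtr_sqr normr_nat. Qed.

Lemma cmeas_box a g : cmeas (box a g).
Proof.
apply: cmeas_Complex; last exact: measurable_cst.
apply: measurable_boolR; apply: measurable_fun_ler => //.
by apply: measurableT_comp => //; apply: measurable_funB => //; exact: measurableT_comp.
Qed.

Lemma box_herm a g x : box a g (- x) = conjc (box a g x).
Proof. by apply: ceqP; rewrite /= ?normrN ?oppr0. Qed.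

(** Compact support allows any exponential weight; the constant is exponentially large in [a], but
    only affects the range of small steps and the cubic remainder. *)
Lemma box_wt (T a g : R) : 0 < T -> 0 <= a -> 0 <= g -> forall x,
  nc (box a g x) <= (expR (2 * T * (a + g)) * (1 + (a + g) ^+ 2)) * wt (2 * T) x.
Proof.
move=> T0 a0 g0 x; rewrite norm_box; case: (boolP (_ <= g)) => [h|_]; last first.
  by apply: mulr_ge0 (wt_ge0 _ _); apply: mulr_ge0 (expR_ge0 _) (addr_ge0 ler01 (sqr_ge0 _)).
have xa : `|x| <= a + g by move: h; rewrite ler_norml lerBlDl => /andP[_].
rewrite /wt mulrACA -expRD -[leLHS](mulr1 1) ler_pM//.
  rewrite -expR0 ler_expR subr_ge0 ler_wpM2l// ?mulr_ge0// ltW//.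
rewrite /lorentz ler_pdivlMr ?ltr_pwDl ?sqr_ge0// mul1r lerD2l.
by rewrite -(real_normK (num_real x)) ler_pXn2r// ?nnegrE// addr_ge0.
Qed.

Lemma japanese_ge (x : R) : `|x| <= japanese x.
Proof. by rewrite -sqrtr_sqr ler_sqrt ?addr_ge0 ?sqr_ge0// lerDr. Qed.

Lemma powR_le_neg (s x y : R) : s <= 0 -> 0 < x -> x <= y -> y `^ s <= x `^ s.
Proof.
move=> s0 x0 xy; have y0 := lt_le_trans x0 xy.
rewrite -(opprK s) !(powRN _ (- s)) lef_pV2 ?posrE ?powR_gt0//.
by apply: ge0_ler_powR; rewrite ?oppr_ge0 ?nnegrE ?(ltW x0) ?(ltW y0).
Qed.

(** On the support [|x| >= a - g >= a / 2], and [s <= 0] bounds the Sobolev weight by [(a / 2)^s].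
    The factor 2 counts the two intervals around [a] and [- a]. *)
Lemma box_Hs (s a g : R) : s <= 0 -> 0 < g -> 4 * g <= a ->
  is_Hs s (box a g) /\ Hs_norm s (box a g) <= 2 * ((a / 2) `^ s * Num.sqrt (2 * g)).
Proof.
move=> s0 g0 ga.
have a0 : 0 < a by apply: lt_le_trans ga; rewrite mulr_gt0.
set I1 := (fun x : R => (a - g <= x <= a + g)%R%:R : R).
set I2 := (fun x : R => (- a - g <= x <= - a + g)%R%:R : R).
have m1 : measurable_fun setT I1.
  by apply: measurable_boolR; apply: measurable_and; apply: measurable_fun_ler.
have m2 : measurable_fun setT I2.
  by apply: measurable_boolR; apply: measurable_and; apply: measurable_fun_ler.
set w := (a / 2) `^ s.
have w0 : 0 <= w by exact: powR_ge0.
have N1 : ('N[mu]_2%:E[EFin \o I1] = (Num.sqrt (2 * g))%:E)%E.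
  rewrite Lnorm_indic; last by lra.
  by congr (Num.sqrt _)%:E; ring.
have N2 : ('N[mu]_2%:E[EFin \o I2] = (Num.sqrt (2 * g))%:E)%E.
  rewrite Lnorm_indic; last by lra.
  by congr (Num.sqrt _)%:E; ring.
have [b1 b2] := cmeas_box a g.
have bound : ('N[mu]_2%:E[EFin \o Hs_weighted s (box a g)] <= (2 * (w * Num.sqrt (2 * g)))%:E)%E.
  apply: (@le_trans _ _ ('N[mu]_2%:E[EFin \o ((fun x => w * I1 x) \+ (fun x => w * I2 x))%R])%E).
    apply: le_Lnorm2 => [||x].
    - exact: measurable_Hs_weighted.
    - by apply: measurable_funD; exact: measurable_funM.
    - rewrite ger0_norm ?Hs_weighted_ge0// ger0_norm ?addr_ge0 ?mulr_ge0 ?ler0n//.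
      rewrite /Hs_weighted norm_box.
      case: (boolP (_ <= g)) => [h|_]; last by rewrite mulr0 addr_ge0// mulr_ge0// ler0n.
      rewrite mulr1 /= -mulrDr.
      have jw : japanese x `^ s <= w.
        apply: powR_le_neg => //; first by rewrite divr_gt0.
        by apply: le_trans (japanese_ge x); move: h; rewrite ler_norml => /andP[]; lra.
      apply: (le_trans jw); rewrite ler_peMr// /I1 /I2.
      have [x0|x0] := leP 0 x.
        move: h; rewrite (ger0_norm x0) ler_norml => /andP[h1 h2].
        by rewrite (_ : a - g <= x <= a + g) ?lerDl ?ler0n//; apply/andP; split; lra.
      move: h; rewrite (ltr0_norm x0) ler_norml => /andP[h1 h2].
      by rewrite (_ : - a - g <= x <= - a + g) ?lerDr ?ler0n//; apply/andP; split; lra.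
  apply: le_trans (minkowski_EFin mu _ _ _) _ => //.
  - exact: measurable_funM.
  - exact: measurable_funM.
  - by rewrite ler1n.
  rewrite !Lnorm2Z ?N1 ?N2 ?ltry//.
  by rewrite (ger0_norm w0) -!EFinM -EFinD lee_fin; lra.
have H : is_Hs s (box a g).
  by split => //; [move=> x; exact: box_herm|exact: le_lt_trans bound (ltry _)].
by split => //; rewrite -lee_fin Hs_normE.
Qed.

End Box.

(** * Lower bound for the resonant interaction *)

Section Resonance.
Context {R : realType} (T : R) (T0 : 0 < T) (alpha : R) (alpha0 : 0 < alpha) (alpha1 : alpha < 1).
Local Notation C := (Rcomplex R).
Local Notation nc z := (@Num.norm R _ (z : C)).
Local Notation mu := (@lebesgue_measure R).
Context (a b g : R).
Local Notation N := (a + b).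
Hypotheses (g0 : 0 < g) (ga : 4 * g <= a) (gb : 4 * g <= b).
Hypothesis res : a ^+ 3 + alpha * b ^+ 3 = alpha * N ^+ 3.
(* Keeps the oscillation of the phase over the boxes below 1/4. *)
Hypothesis gN : 144 * T * g * N ^+ 2 <= 1.
Local Notation l1 := (lin T 1 (box a g)).
Local Notation l2 := (lin T alpha (box b g)).

Lemma cos_ge_half (x : R) : `|x| <= 4^-1 -> 2^-1 <= cos x.
Proof.
move=> x4; have h := le_trans (cnorm_Re _) (norm_cisB x 0).
move: h; rewrite cReD cReN /= cos0 subr0 ler_norml => /andP[h _]; lra.
Qed.

(** Each of the three terms of [x^2 + x y + y^2] is at most [(2 n)^2]. *)
Lemma cube_diff (n x y : R) : 0 <= x <= 2 * n -> 0 <= y <= 2 * n -> `|x - y| <= g ->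
  `|x ^+ 3 - y ^+ 3| <= 12 * n ^+ 2 * g.
Proof.
move=> /andP[x0 xn] /andP[y0 yn] xy.
have -> : x ^+ 3 - y ^+ 3 = (x - y) * (x ^+ 2 + x * y + y ^+ 2) by ring.
rewrite normrM mulrC; apply: ler_pM => //.
rewrite ger0_norm ?addr_ge0 ?mulr_ge0 ?sqr_ge0//.
have h1 : x ^+ 2 <= (2 * n) ^+ 2 by rewrite ler_pXn2r// nnegrE// (le_trans x0).
have h2 : y ^+ 2 <= (2 * n) ^+ 2 by rewrite ler_pXn2r// nnegrE// (le_trans y0).
have h3 : x * y <= (2 * n) ^+ 2 by rewrite expr2; exact: ler_pM.
have -> : 12 * n ^+ 2 = (2 * n) ^+ 2 + (2 * n) ^+ 2 + (2 * n) ^+ 2 by ring.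
by rewrite !lerD.
Qed.

(** By [res] the phase vanishes at the centres. Each of the three cubes moves by at most [12 N^2 g],
    and [alpha < 1], so the phase is at most [36 T N^2 g], a quarter of the quantity in [gN]. *)
Lemma resonant_phase (p q x r : R) : `|p - a| <= g -> `|q - b| <= g -> `|x - N| <= g ->
  `|r| <= T -> `|r * (p ^+ 3 + alpha * q ^+ 3 - alpha * x ^+ 3)| <= 4^-1.
Proof.
have g1 := g0; have ga1 := ga; have gb1 := gb.
move=> pa qb xN rT.
have a0 : 0 < a by apply: lt_le_trans ga; rewrite mulr_gt0.
have b0 : 0 < b by apply: lt_le_trans gb; rewrite mulr_gt0.
have H y c : 4 * g <= c -> c <= N -> `|y - c| <= g -> `|y ^+ 3 - c ^+ 3| <= 12 * N ^+ 2 * g.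
  by move=> gc cN yc; apply: cube_diff => //; move: yc; rewrite ler_norml => /andP[? ?]; apply/andP; split; lra.
have h1 := H p a ga (_ : a <= N) pa.
have {}h1 : `|p ^+ 3 - a ^+ 3| <= 12 * N ^+ 2 * g by apply: h1; lra.
have h2 : `|q ^+ 3 - b ^+ 3| <= 12 * N ^+ 2 * g by apply: H => //; lra.
have h3 : `|x ^+ 3 - N ^+ 3| <= 12 * N ^+ 2 * g by apply: H => //; lra.
have -> : p ^+ 3 + alpha * q ^+ 3 - alpha * x ^+ 3 =
    (p ^+ 3 - a ^+ 3) + alpha * (q ^+ 3 - b ^+ 3) - alpha * (x ^+ 3 - N ^+ 3).
  rewrite !mulrBr -res; ring.
have al (y : R) : `|alpha * y| <= `|y|.
  by rewrite normrM (gtr0_norm alpha0) ler_piMl// ltW.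
have k : `|p ^+ 3 - a ^+ 3 + alpha * (q ^+ 3 - b ^+ 3) - alpha * (x ^+ 3 - N ^+ 3)| <=
    36 * N ^+ 2 * g.
  apply: le_trans (ler_normB _ _) _.
  have -> : 36 * N ^+ 2 * g = 12 * N ^+ 2 * g + 12 * N ^+ 2 * g + 12 * N ^+ 2 * g by ring.
  apply: lerD; last exact: le_trans (al _) h3.
  apply: le_trans (ler_normD _ _) _; apply: lerD => //; exact: le_trans (al _) h2.
rewrite normrM; apply: le_trans (ler_pM (normr_ge0 _) (normr_ge0 _) rT k) _.
have -> : T * (36 * N ^+ 2 * g) = 4^-1 * (144 * T * g * N ^+ 2) by field.
by rewrite -[leRHS]mulr1 ler_wpM2l// invr_ge0.
Qed.

(** A factor near [- a] or [- b] would put the sum of the two frequencies far from [a + b], since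
    [a] and [b] are at least [4 g]; only the two positive intervals contribute. *)
Lemma box_support (x y : R) : `|x - N| <= g -> `| `|x - y| - a| <= g -> `| `|y| - b| <= g ->
  `|x - y - a| <= g /\ `|y - b| <= g.
Proof.
have g1 := g0; have ga1 := ga; have gb1 := gb.
rewrite !ler_norml => /andP[x1 x2].
have [y0|y0] := leP 0 y; have [z0|z0] := leP 0 (x - y).
- by rewrite (ger0_norm y0) (ger0_norm z0).
- rewrite (ger0_norm y0) (ltr0_norm z0) => /andP[? ?] /andP[? ?]; lra.
- rewrite (ltr0_norm y0) (ger0_norm z0) => /andP[? ?] /andP[? ?]; lra.
- rewrite (ltr0_norm y0) (ltr0_norm z0) => /andP[? ?] /andP[? ?]; lra.
Qed.

(** The integrand of the convolution after undoing the evolution of the output wave, so that only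
    the resonance phase remains. *)
Definition inner (x r y : R) : C := cis (- (alpha * r * x ^+ 3)) * (l1 r (x - y) * l2 r y).

(** Inside the boxes the cosine of the phase is at least 1/2, elsewhere the integrand is 0. Centring
    [y] at [b + (x - N) / 2] shares the deviation of [x] equally between the two factors, so that an
    interval of length [g] fits in both boxes. *)
Lemma inner_ge (x r y : R) : `|x - N| <= g -> `|r| <= T ->
  2^-1 * ((b + (x - N) / 2 - g / 2 <= y <= b + (x - N) / 2 + g / 2)%R%:R) <= Re (inner x r y).
Proof.
have g1 := g0; have ga1 := ga; have gb1 := gb.
move=> xN rT.
have E : Re (inner x r y) = cos (r * ((x - y) ^+ 3 + alpha * y ^+ 3 - alpha * x ^+ 3)) *
    ((`| `|x - y| - a| <= g)%R%:R * (`| `|y| - b| <= g)%R%:R).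
  rewrite /inner /lin rT /airy -!/(cis _).
  rewrite (_ : cis _ * _ = cis (r * ((x - y) ^+ 3 + alpha * y ^+ 3 - alpha * x ^+ 3)) *
    (box a g (x - y) * box b g y)); last first.
    rewrite (_ : r * _ = - (alpha * r * x ^+ 3) + (1 * r * (x - y) ^+ 3 + alpha * r * y ^+ 3)); last by ring.
    by rewrite !cisD -!mulrA; congr (_ * (_ * _)); rewrite mulrCA.
  by rewrite cReM cReM cImM /=; ring.
rewrite E; case: (boolP (`| `|x - y| - a| <= g)) => h1; last first.
  rewrite /= mul0r mulr0; case: (boolP (_ <= y <= _)) => [/andP[y1 y2]|_]; last by rewrite mulr0.
  exfalso; move: h1; apply/negP; rewrite negbK.
  move: xN; rewrite ler_norml => /andP[x1 x2].
  have z0 : 0 <= x - y by lra.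
  by rewrite (ger0_norm z0) ler_norml; apply/andP; split; lra.
case: (boolP (`| `|y| - b| <= g)) => h2; last first.
  rewrite /= !mulr0; case: (boolP (_ <= y <= _)) => [/andP[y1 y2]|_]; last by rewrite mulr0.
  exfalso; move: h2; apply/negP; rewrite negbK.
  move: xN; rewrite ler_norml => /andP[x1 x2].
  have y0 : 0 <= y by lra.
  by rewrite (ger0_norm y0) ler_norml; apply/andP; split; lra.
have [p q] := box_support xN h1 h2.
rewrite /= !mulr1; apply: le_trans (cos_ge_half (resonant_phase p q xN rT)).
by rewrite -[leRHS]mulr1 ler_wpM2l ?invr_ge0// lern1 leq_b1.
Qed.

Lemma lin_box_fam : exists A, fam T A l1 /\ fam T A l2.
Proof.
have a0 : 0 <= a by apply: le_trans ga; rewrite mulr_ge0// ltW.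
have b0 : 0 <= b by apply: le_trans gb; rewrite mulr_ge0// ltW.
have h1 := box_wt T0 a0 (ltW g0); have h2 := box_wt T0 b0 (ltW g0).
set A := (X in forall x, _ <= X * _) in h1; set B := (X in forall x, _ <= X * _) in h2.
exists (Num.max A B); split.
  by apply: famW (lin_fam 1 (cmeas_box a g) h1); rewrite le_max lexx.
by apply: famW (lin_fam alpha (cmeas_box b g) h2); rewrite le_max lexx orbT.
Qed.

Lemma conv_ge (x r : R) : `|x - N| <= g -> `|r| <= T ->
  g / 2 <= Re (cis (- (alpha * r * x ^+ 3)) * prod_hat (l1 r) (l2 r) x).
Proof.
have g1 := g0; have ga1 := ga; have gb1 := gb.
move=> xN rT; have [A [f1 f2]] := lin_box_fam.
have [h d] := conv_fam T0 r x f1 f2.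
rewrite -(cintM _ d) /=.
have ord : b + (x - N) / 2 - g / 2 <= b + (x - N) / 2 + g / 2 by lra.
have [i1 i2] := Rint_itv ord.
apply: (@le_trans _ _ (\int[mu]_y (2^-1 *
   ((b + (x - N) / 2 - g / 2 <= y <= b + (x - N) / 2 + g / 2)%R%:R)))).
  by rewrite RintegralZl// i2; lra.
apply: le_Rintegral => //.
- exact: rintZ.
- exact: (cdom_Re (cdomM _ d)).
- by move=> y _; exact: inner_ge.
Qed.

(** There is no cancellation in time: after a rotation independent of [r] the integrand has real
    part at least [x (g / 2)] on the interval between 0 and [t], and [x >= N / 2]. *)
Lemma resonant_bilinear_ge (t x : R) : `|t| <= T -> `|x - N| <= g ->
  (a + b) * g * `|t| / 4 <= nc (Dh T alpha l1 l2 t x).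
Proof.
have g1 := g0; have ga1 := ga; have gb1 := gb.
move=> tT xN; have [A [f1 f2]] := lin_box_fam.
pose sg : R := if 0 <= t then 1 else -1.
have sg2 : sg * sg = 1 by rewrite /sg; case: ifP; rewrite ?mulr1// mulrNN mulr1.
have sgn : `|sg| = 1 by rewrite /sg; case: ifP; rewrite ?normrN normr1.
have sgkE r : sgk t r = sg * `|sgk t r|.
  by rewrite /sgk /sg; case: ifP => _; rewrite ?normrN normr_nat ?mul1r ?mulN1r.
(* This unimodular factor cancels the [i] of the derivative, the sign of the orientation, and the
   part of the Airy phase that depends on [t]. *)
pose z0 : C := Complex 0 (- sg) * cis (- (alpha * t * x ^+ 3)).
have nz0 : nc z0 = 1.
  by rewrite cnormM norm_cis mulr1 normCE /= expr0n add0r sqrtr_sqr normrN.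
have d := dint_dom T0 alpha x f1 f2 tT.
have -> : nc (Dh T alpha l1 l2 t x) = nc (cint setT (fun r => z0 * dint alpha l1 l2 t x r)).
  by rewrite (cintM z0 d) cnormM nz0 mul1r (Dh_in _ _ _ _ tT).
apply: le_trans (cnorm_Re _); apply: le_trans (ler_norm _).
rewrite -[leRHS]/(\int[mu]_r Re (z0 * dint alpha l1 l2 t x r)).
have E r : Re (z0 * dint alpha l1 l2 t x r) = `|sgk t r| *
    (x * Re (cis (- (alpha * r * x ^+ 3)) * prod_hat (l1 r) (l2 r) x)).
  rewrite /dint sgkE normrM sgn mul1r normr_id /airy -/(cis _) /ddx.
  rewrite (_ : - (alpha * r * x ^+ 3) = - (alpha * t * x ^+ 3) + alpha * (t - r) * x ^+ 3); last by ring.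
  rewrite cisD /z0; move: (prod_hat _ _ _) (cis _) (cis _) => P w1 w2.
  rewrite -[RHS]mul1r -sg2 !(cReM, cImM, cReZ, cImZ) /=; ring.
have x0 : (a + b) / 2 <= x by move: xN; rewrite ler_norml => /andP[]; lra.
have a0 : 0 <= a by apply: le_trans ga; rewrite mulr_ge0// ltW.
have b0 : 0 <= b by apply: le_trans gb; rewrite mulr_ge0// ltW.
have [s1 s2] := Rint_sgk t.
apply: (@le_trans _ _ (\int[mu]_r (((a + b) / 2 * (g / 2)) * `|sgk t r|))).
  by rewrite RintegralZl// s2 le_eqVlt; apply/orP; left; apply/eqP; field.
apply: le_Rintegral => //.
- exact: rintZ.
- exact: (cdom_Re (cdomM z0 d)).
- move=> r _; rewrite E mulrC; apply: norm_sgk_mul => rt.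
  apply: ler_pM => //.
  + by rewrite divr_ge0// addr_ge0.
  + by rewrite divr_ge0// ltW.
  + by apply: conv_ge => //; exact: le_trans tT.
Qed.

End Resonance.

(** * Choice of frequencies and comparison of powers of [N] *)

Section Conclusion.
Context {R : realType}.
Implicit Types (alpha s T N c y : R).

(** The difference of the two sides is [x] times [(1 - alpha) x^2 + 3 alpha x - 3 alpha], and the
    witness is the positive root of this quadratic. *)
Lemma resonance_root alpha : 0 < alpha < 1 ->
  exists2 x : R, 0 < x < 1 & x ^+ 3 + alpha * (1 - x) ^+ 3 = alpha.
Proof.
move=> /andP[a0 a1].
(* [D] is the discriminant. Positivity of the root amounts to [12 alpha (1 - alpha) > 0], and the
   bound by 1 to [4 (1 - alpha)^2 > 0]. *)
pose D := 12 * alpha - 3 * alpha ^+ 2; pose S := Num.sqrt D.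
have D0 : 0 <= D by rewrite /D; nra.
have SS : S ^+ 2 = D by rewrite sqr_sqrtr.
have S0 : 0 <= S by exact: sqrtr_ge0.
have e0 : 0 < 2 * (1 - alpha) by lra.
have e1 : 1 - alpha != 0 by rewrite gt_eqF//; lra.
exists ((S - 3 * alpha) / (2 * (1 - alpha))).
  apply/andP; split.
    apply: divr_gt0 => //; rewrite subr_gt0.
    rewrite -(ltr_pXn2r (n := 2)) ?nnegrE ?mulr_ge0 ?(ltW a0)// SS /D; nra.
  rewrite ltr_pdivrMr// mul1r ltrBlDr.
  have -> : 2 * (1 - alpha) + 3 * alpha = 2 + alpha by ring.
  rewrite -(ltr_pXn2r (n := 2)) ?nnegrE ?addr_ge0 ?(ltW a0)// SS /D.
  have : 0 < (1 - alpha) ^+ 2 by rewrite exprn_gt0// subr_gt0.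
  nra.
set x := _ / _.
have q : (1 - alpha) * x ^+ 2 + 3 * alpha * x - 3 * alpha = 0.
  have -> : (1 - alpha) * x ^+ 2 + 3 * alpha * x - 3 * alpha =
      (S ^+ 2 - D) / (4 * (1 - alpha)) by rewrite /x /D; field.
  by rewrite SS subrr mul0r.
have -> : x ^+ 3 + alpha * (1 - x) ^+ 3 =
  alpha + x * ((1 - alpha) * x ^+ 2 + 3 * alpha * x - 3 * alpha) by ring.
by rewrite q mulr0 addr0.
Qed.

(** The witness is [y^(1/s)]; as [s < 0], capping [y] by [N0^s] pushes it above [N0]. *)
Lemma powR_small s (N0 e : R) : s < 0 -> 0 < N0 -> 0 < e ->
  exists2 N, N0 <= N & N `^ s <= e.
Proof.
move=> s0 n0 e0.
have sV : s^-1 <= 0 by rewrite invr_le0 ltW.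
have sn0 : s != 0 by rewrite lt_eqF.
pose y := Num.min e (N0 `^ s).
have y0 : 0 < y by rewrite lt_min e0 powR_gt0.
exists (y `^ s^-1).
  rewrite -{1}(powRr1 (ltW n0)) -(divff sn0) powRrM.
  by apply: powR_le_neg => //; rewrite ge_min lexx orbT.
by rewrite -powRrM mulVf// powRr1 ?(ltW y0)// ge_min lexx.
Qed.

(** The output wave gives the lower bound [(4 N)^s (N g |t| / 4) sqrt (2 g)], the data give the
    upper bound [M (2 (c N)^s sqrt (2 g))^2]. Dividing by [g N^s] leaves a left side free of [N].
    The lower bounds on [N] ensure that the boxes are narrow compared with their distance from 0. *)
Lemma bilinear_growth alpha s T t x c M N : 0 < alpha < 1 -> s <= 0 -> 0 < T -> `|t| <= T ->
  0 < x < 1 -> x ^+ 3 + alpha * (1 - x) ^+ 3 = alpha ->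
  0 < c -> 2 * c <= x -> 2 * c <= 1 - x -> 1 <= N -> (72 * T * c)^-1 <= N ->
  (forall (B K : R) (u v : R -> Rcomplex R), cmeas u -> cmeas v ->
    (forall x, u (- x) = conjc (u x)) -> (forall x, v (- x) = conjc (v x)) ->
    (forall x, `|u x| <= B * wt (2 * T) x) -> (forall x, `|v x| <= B * wt (2 * T) x) ->
    is_Hs s u -> is_Hs s v -> Hs_norm s u <= K -> Hs_norm s v <= K ->
    Hs_norm s (Dh T alpha (lin T 1 u) (lin T alpha v) t) <= M * K ^+ 2) ->
  4 `^ s * (`|t| / 4) * Num.sqrt ((72 * T)^-1) <= 8 * M * (c `^ s) ^+ 2 * N `^ s.
Proof.
move=> /andP[al0 al1] s0 T0 tT /andP[x0 x1] root c0 cx cx' N1 NT hM.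
have N0 : 0 < N by exact: lt_le_trans N1.
(* [g] is the largest half-width allowed by the condition on the phase. *)
pose a := x * N; pose b := (1 - x) * N; pose g := (144 * T * N ^+ 2)^-1.
have ab : a + b = N by rewrite /a /b; ring.
have d0 : 0 < 144 * T * N ^+ 2 by rewrite !mulr_gt0// exprn_gt0.
have g0 : 0 < g by rewrite invr_gt0.
have gN : 144 * T * g * (a + b) ^+ 2 <= 1.
  by rewrite ab /g le_eqVlt; apply/orP; left; apply/eqP; field; rewrite !gt_eqF.
have g4 : 4 * g <= 2 * c * N.
  have tc0 : 0 < 72 * T * c by rewrite !mulr_gt0.
  have h : 1 <= N * (72 * T * c) by rewrite -ler_pdivrMr// mul1r.
  have h2 : 1 <= N ^+ 2 by rewrite exprn_ege1.
  have h3 : 1 <= N * (72 * T * c) * N ^+ 2 by rewrite -[leLHS](mulr1 1) ler_pM.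
  rewrite ler_pdivrMr//.
  rewrite (_ : 2 * c * N * _ = 4 * (N * (72 * T * c) * N ^+ 2)); last by ring.
  by rewrite ler_peMr.
have ga : 4 * g <= a by apply: (le_trans g4); rewrite ler_wpM2r// ltW.
have gb : 4 * g <= b by apply: (le_trans g4); rewrite ler_wpM2r// ltW.
have res : a ^+ 3 + alpha * b ^+ 3 = alpha * (a + b) ^+ 3.
  by rewrite ab -[X in _ = X * _]root /a /b; ring.
have a0 : 0 <= a by rewrite mulr_ge0 ?ltW.
have b0 : 0 <= b by rewrite mulr_ge0 ?subr_ge0 ?ltW.
have [Hu nu] := box_Hs s0 g0 ga; have [Hv nv] := box_Hs s0 g0 gb.
have bu := box_wt T0 a0 (ltW g0); have bv := box_wt T0 b0 (ltW g0).
pose A1 := expR (2 * T * (a + g)) * (1 + (a + g) ^+ 2).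
pose A2 := expR (2 * T * (b + g)) * (1 + (b + g) ^+ 2).
rewrite -/A1 in bu; rewrite -/A2 in bv.
pose A := Num.max A1 A2.
have bu' y : `|box a g y| <= A * wt (2 * T) y.
  by apply: le_trans (bu y) _; rewrite ler_wpM2r ?wt_ge0// le_max lexx.
have bv' y : `|box b g y| <= A * wt (2 * T) y.
  by apply: le_trans (bv y) _; rewrite ler_wpM2r ?wt_ge0// le_max lexx orbT.
pose w := (c * N) `^ s; pose r := Num.sqrt (2 * g).
have w0 : 0 <= w by exact: powR_ge0.
have r0 : 0 <= r by exact: sqrtr_ge0.
have cN0 : 0 < c * N by exact: mulr_gt0.
have {}nu : Hs_norm s (box a g) <= 2 * (w * r).
  apply: (le_trans nu); rewrite ler_wpM2l// ler_wpM2r//.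
  apply: powR_le_neg => //; rewrite ler_pdivlMr// /a mulrAC ler_wpM2r ?(ltW N0)//; lra.
have {}nv : Hs_norm s (box b g) <= 2 * (w * r).
  apply: (le_trans nv); rewrite ler_wpM2l// ler_wpM2r//.
  apply: powR_le_neg => //; rewrite ler_pdivlMr// /b mulrAC ler_wpM2r ?(ltW N0)//; lra.
have up := hM A _ _ _ (cmeas_box a g) (cmeas_box b g) (box_herm a g) (box_herm b g)
  bu' bv' Hu Hv nu nv.
have HQ := bilinear_is_Hs T0 s0 alpha (cmeas_box a g) (cmeas_box b g)
  (box_herm a g) (box_herm b g) bu' bv' t.
pose k := (4 * N) `^ s * (N * g * `|t| / 4).
have k0 : 0 <= k by rewrite mulr_ge0 ?powR_ge0// !mulr_ge0// ltW.
have low : k * r <= Hs_norm s (Dh T alpha (lin T 1 (box a g)) (lin T alpha (box b g)) t).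
  have -> : r = Num.sqrt ((N + g) - (N - g)) by congr Num.sqrt; ring.
  apply: Hs_norm_ge => //; first by lra.
  move=> y /andP[y1 y2]; rewrite /Hs_weighted /k.
  have yN : `|y - (a + b)| <= g by rewrite ab ler_norml; apply/andP; split; lra.
  apply: ler_pM; rewrite ?powR_ge0//.
  - by rewrite !mulr_ge0// ltW.
  (* As [g <= N] and [1 <= N], one has [1 + y^2 <= (4 N)^2], and the exponent [s <= 0] reverses the
     comparison. *)
  - apply: powR_le_neg => //; first exact: japanese_gt0.
    rewrite -(ler_pXn2r (n := 2)) ?nnegrE ?mulr_ge0 ?(ltW N0) ?(ltW (japanese_gt0 _))//.
    rewrite sqr_sqrtr ?addr_ge0 ?sqr_ge0//.
    have gN' : g <= N by rewrite -ab; lra.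
    nra.
  - rewrite -{1}ab; exact: (resonant_bilinear_ge T0 al0 al1 g0 ga gb res gN tT yN).
have {low up} := le_trans low up.
have rr : r ^+ 2 = 2 * g by rewrite sqr_sqrtr// mulr_ge0// ltW.
(* With this [g] the quantity [2 g N^2] is constant, which removes [N] from the left side. *)
have rN : r * N = Num.sqrt ((72 * T)^-1).
  rewrite -[in LHS](gtr0_norm N0) -sqrtr_sqr -sqrtrM ?mulr_ge0 ?(ltW g0)//.
  by congr Num.sqrt; rewrite /g; field; rewrite !gt_eqF.
have wE : w = c `^ s * N `^ s by rewrite /w powRM// ltW.
have kE : (4 * N) `^ s = 4 `^ s * N `^ s by rewrite powRM// ltW.
have Ns : 0 < N `^ s by rewrite powR_gt0.
rewrite /k kE -rN => h.
rewrite -(ler_pM2l Ns) -(ler_pM2l g0).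
rewrite (_ : g * (N `^ s * _) = 4 `^ s * N `^ s * (N * g * `|t| / 4) * r); last by ring.
apply: (le_trans h); rewrite wE !exprMn rr le_eqVlt; apply/orP; left; apply/eqP; ring.
Qed.

End Conclusion.

Theorem theorem4 (R : realType) (alpha s : R) (alpha01 : 0 < alpha < 1)
    (T : R) (U : set (Hs s * Hs s)) (Phi : R -> Hs s * Hs s -> Hs s * Hs s)
    (wp : MB_wellposed alpha T U Phi)
    (t : R) (t0 : t != 0) (tT : `|t| <= T) (Phi_C2 : C2_on U (Phi t)) :
  0 <= s.
Proof.
have [//|s0] := leP 0 s.
have [T0 _ _ _ _] := wp.
have [M M0 hM] := C2_bilinear_bound T0 (ltW s0) wp tT Phi_C2.
have [x x01 root] := resonance_root alpha01.
have /andP[x0 x1] := x01.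
(* Both centres [x N] and [(1 - x) N] are then at least [2 c N]. *)
pose c := Num.min x (1 - x) / 2.
have c0 : 0 < c by rewrite divr_gt0// lt_min x0 subr_gt0.
have c2 : 2 * c = Num.min x (1 - x) by rewrite /c mulrC divfK.
have cx : 2 * c <= x by rewrite c2 ge_min lexx.
have cx' : 2 * c <= 1 - x by rewrite c2 ge_min lexx orbT.
pose kappa := 4 `^ s * (`|t| / 4) * Num.sqrt ((72 * T)^-1).
pose K := 8 * M * (c `^ s) ^+ 2.
have kappa0 : 0 < kappa.
  by rewrite !mulr_gt0 ?powR_gt0 ?normr_gt0 ?invr_gt0 ?sqrtr_gt0 ?invr_gt0 ?mulr_gt0.
have K0 : 0 <= K by apply: mulr_ge0; [exact: mulr_ge0|exact/exprn_ge0/powR_ge0].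
have K1 : 0 < K + 1 by rewrite ltr_wpDl.
have N00 : 0 < Num.max 1 (72 * T * c)^-1 by rewrite lt_max ltr01.
(* Neither [kappa] nor [K] depends on [N]; with [N^s] at most [kappa / (2 (K + 1))] the inequality
   [kappa <= K N^s] would give [kappa <= kappa / 2]. *)
have e0 : 0 < kappa / (K + 1) / 2 by rewrite !divr_gt0.
have [N] := powR_small s0 N00 e0; rewrite ge_max => /andP[N1 NT] Ns.
have h := bilinear_growth alpha01 (ltW s0) T0 tT x01 root c0 cx cx' N1 NT hM.
rewrite -/kappa -/K in h.
have : kappa < kappa.
  apply: (le_lt_trans h); apply: (@le_lt_trans _ _ ((K + 1) * (kappa / (K + 1) / 2))).
    apply: ler_pM => //; first exact: powR_ge0.
    by rewrite lerDl.
  rewrite (_ : _ * _ = kappa / 2); last by field; rewrite gt_eqF.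
  by rewrite ltr_pdivrMr// ltr_pMr// ltr1n.
by rewrite ltxx.
Qed.
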